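(* Let $C>1$, $z>0$ and $z\le\min\{Ce^{-CC_\phi};\,2Ce^{-2CC_\phi}\}$. Let $k\in\overline{D(\widehat L^* )}\subset\mathcal K_C$ be a positive definite function. Then $k_t:=\widehat T^\odot(t)k\in\overline{D(\widehat L^* )}\subset\mathcal K_C$ is a positive definite function for any $t\ge0$.
   Context: $\Gamma$ is the set of all locally finite subsets of $\mathbb R^d$; $\Gamma_0$ is the set of all finite subsets, with the Lebesgue–Poisson measure $\lambda$: $\int_{\Gamma_0}G\,d\lambda=G(\emptyset)+\sum_{n\ge1}\frac1{n!}\int_{(\mathbb R^d)^n}G(\{x_1,\dots,x_n\})\,dx_1\cdots dx_n$; $\Gamma(\Lambda)=\{\eta\in\Gamma_0:\eta\subset\Lambda\}$ for bounded Borel $\Lambda$. $|\eta|$ is the cardinality. For $c>0$, $\mathcal L_c=L^1(\Gamma_0,c^{|\cdot|}d\lambda)$, and $\mathcal K_c=\{k:\Gamma_0\to\mathbb R\mid \|k\|_{\mathcal K_c}:=\|c^{-|\cdot|}k\|_{L^\infty(\lambda)}<\infty\}$, identified with the dual of $\mathcal L_c$ through $\langle\!\langle G,k\rangle\!\rangle=\int_{\Gamma_0}Gk\,d\lambda$. $\phi:\mathbb R^d\setminus\{0\}\to[0,\infty)$ is a measurable even function with $C_\phi:=\int_{\mathbb R^d}(1-e^{-\phi(x)})\,dx<\infty$; $E^\phi(x,\xi)=\sum_{y\in\xi}\phi(x-y)$; $e_\lambda(f,\eta)=\prod_{x\in\eta}f(x)$, $e_\lambda(f,\emptyset)=1$.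 The operator $\widehat L$ in $\mathcal L_C$ with domain $\mathcal L_{2C}$ is $$(\widehat LG)(\eta)=-|\eta|G(\eta)+z\sum_{\xi\subset\eta}\int_{\mathbb R^d}e^{-E^\phi(x,\xi)}G(\xi\cup x)\,e_\lambda(e^{-\phi(x-\cdot)}-1,\eta\setminus\xi)\,dx ;$$ under the stated condition on $z$ its closure generates a strongly continuous contraction semigroup $\widehat T(t)$ on $\mathcal L_C$. $\widehat L^*$, with domain $D(\widehat L^* )\subset\mathcal K_C$, and $\widehat T^*(t)$ are the adjoints in $\mathcal K_C$ with respect to $\langle\!\langle\cdot,\cdot\rangle\!\rangle$; $\overline{D(\widehat L^* )}$ is the closure in the norm of $\mathcal K_C$, and $\widehat T^\odot(t)$ is the restriction of $\widehat T^*(t)$ to $\overline{D(\widehat L^* )}$. Positive definiteness. A measurable $G:\Gamma_0\to\mathbb R$ has local support if there is a bounded Borel $\Lambda$ with $G=0$ on $\Gamma_0\setminus\Gamma(\Lambda)$; for such $G$, $(KG)(\gamma)=\sum_{\eta\subset\gamma,\,|\eta|<\infty}G(\eta)$, $\gamma\in\Gamma$ (a finite sum). $\mathcal L_C^{\mathrm{ls}}$ is the set of $G\in\mathcal L_C$ with local support. A function $k\in\mathcal K_C$ is called positive definite if $\int_{\Gamma_0}G(\eta)k(\eta)\,d\lambda(\eta)\ge0$ for every $G\in\mathcal L_C^{\mathrm{ls}}$ with $(KG)(\gamma)\ge0$ for all $\gamma\in\Gamma$. *)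

(* Defs.v *)
From HB Require Import structures.
From mathcomp Require Import all_boot all_order all_algebra finmap.
From mathcomp Require Import all_classical all_reals all_analysis.

Set Implicit Arguments.
Unset Strict Implicit.
Unset Printing Implicit Defensive.
Import Order.TTheory GRing.Theory Num.Theory.
Import numFieldNormedType.Exports.

Local Open Scope classical_set_scope.
Local Open Scope ring_scope.

Section sigma_finite_image.
Context d1 d2 (T1 : measurableType d1) (T2 : measurableType d2) (R : realType).
Variables (m : {sigma_finite_measure set T1 -> \bar R}) (f : T1 -> T2)
  (g : T2 -> T1).
Hypotheses (mf : measurable_fun setT f) (mg : measurable_fun setT g)
  (fK : cancel f g).

(* g is there only to make the image sigma-finite. *)
Definition image_measure & measurable_fun setT f & measurable_fun setT g
  & cancel f g := pushforward m f.

Local Notation im := (image_measure mf mg fK).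

HB.instance Definition _ := Measure.copy im
  (measure_function_pushforward__canonical__measure_function_Measure m mf).

Let im_sigma_finite : sigma_finite setT im.
Proof.
have [F UF mF] := sigma_finiteT m.
exists (fun n => g @^-1` F n); first by rewrite -preimage_bigcup -UF.
move=> n; have [mFn Fn_fin] := mF n; split.
  by rewrite -[X in measurable X]setTI; exact: mg.
rewrite /image_measure /pushforward (_ : _ @^-1` _ = F n)//.
by apply/seteqP; split => x /=; rewrite fK.
Qed.

HB.instance Definition _ := Measure_isSigmaFinite.Build _ _ _ im im_sigma_finite.

End sigma_finite_image.

(* A name for [m1 \x m2] carrying the sigma-finite structure: the library
   declares it on [_ \x _] itself, but it is shadowed there by the instance for
   products of subprobabilities. *)
Section sigma_finite_product.
Context d1 d2 (T1 : measurableType d1) (T2 : measurableType d2) (R : realType).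
Variables (m1 : {sigma_finite_measure set T1 -> \bar R})
  (m2 : {sigma_finite_measure set T2 -> \bar R}).

Definition sigma_finite_product : set (T1 * T2) -> \bar R := (m1 \x m2)%E.

HB.instance Definition _ := Measure.on sigma_finite_product.

Let sigma_finite_productT : sigma_finite setT sigma_finite_product.
Proof.
have /sigma_finiteP[F [TF ndF Foo]] := sigma_finiteT m1.
have /sigma_finiteP[G [TG ndG Goo]] := sigma_finiteT m2.
exists (fun n => F n `*` G n).
  rewrite -setXTT TF TG predeqE => -[x y]; split.
    move=> [/= [n _ Fnx] [k _ Gky]]; exists (maxn n k) => //; split.
    - by move: x Fnx; exact/subsetPset/ndF/leq_maxl.
    - by move: y Gky; exact/subsetPset/ndG/leq_maxr.
  by move=> [n _ []/= ? ?]; split; exists n.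
move=> k; have [? ?] := Foo k; have [? ?] := Goo k.
split; first exact: measurableX.
by rewrite /sigma_finite_product product_measure1E// lte_mul_pinfty//
  ge0_fin_numE.
Qed.

HB.instance Definition _ := Measure_isSigmaFinite.Build _ _ _
  sigma_finite_product sigma_finite_productT.

End sigma_finite_product.

Section tuple_measure.
Context disp (T : measurableType disp) (R : realType).
Variable mu : {sigma_finite_measure set T -> \bar R}.

Definition cons_tuple n (p : T * n.-tuple T) : n.+1.-tuple T :=
  [the n.+1.-tuple T of p.1 :: p.2].

Definition uncons_tuple n (t : n.+1.-tuple T) : T * n.-tuple T :=
  (thead t, [tuple of behead t]).

Lemma measurable_cons_tuple n : measurable_fun setT (@cons_tuple n).
Proof. exact: measurable_cons. Qed.

Lemma measurable_uncons_tuple n : measurable_fun setT (@uncons_tuple n).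
Proof.
apply/measurable_fun_pairP; split => /=; first exact: measurable_tnth.
exact: measurable_behead.
Qed.

Lemma cons_tupleK n : cancel (@cons_tuple n) (@uncons_tuple n).
Proof.
by move=> [x t]; congr pair; apply/val_inj.
Qed.

Definition tuple_measureS n
    (m : {sigma_finite_measure set (n.-tuple T) -> \bar R}) :
    {sigma_finite_measure set (n.+1.-tuple T) -> \bar R} :=
  image_measure (sigma_finite_product mu m) (@measurable_cons_tuple n)
    (@measurable_uncons_tuple n) (@cons_tupleK n).

Fixpoint tuple_measure n : {sigma_finite_measure set (n.-tuple T) -> \bar R} :=
  if n is m.+1 then tuple_measureS (tuple_measure m)
  else \d_([tuple] : 0.-tuple T).

End tuple_measure.

Section measurable_row.
Context disp (T : measurableType disp) (n : nat).

Let coord (i : 'I_n) (x : 'rV[T]_n) : T := x ord0 i.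

Definition measure_row_display : measure_display -> measure_display.
Proof. exact. Qed.

Let row_set0 : g_sigma_preimage coord set0.
Proof. exact: sigma_algebra0. Qed.

Let row_setC A : g_sigma_preimage coord A -> g_sigma_preimage coord (~` A).
Proof. exact: sigma_algebraC. Qed.

Let row_bigcup (F : (set 'rV[T]_n)^nat) :
  (forall i, g_sigma_preimage coord (F i)) ->
  g_sigma_preimage coord (\bigcup_i F i).
Proof. exact: sigma_algebra_bigcup. Qed.

(* The product sigma-algebra; for T = R this is the Borel sigma-algebra. *)
HB.instance Definition _ := @isMeasurable.Build (measure_row_display disp)
  'rV[T]_n (g_sigma_preimage coord) row_set0 row_setC row_bigcup.

Definition row_of_tuple (t : n.-tuple T) : 'rV[T]_n := \row_i tnth t i.

Definition tuple_of_row (x : 'rV[T]_n) : n.-tuple T := [tuple x ord0 i | i < n].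

Lemma row_of_tupleK : cancel row_of_tuple tuple_of_row.
Proof. by move=> t; apply: eq_from_tnth => i; rewrite tnth_mktuple mxE. Qed.

Lemma measurable_tuple_of_row : measurable_fun setT tuple_of_row.
Proof.
apply/measurable_fun_tnthP => i.
rewrite (_ : _ \o _ = coord i); last first.
  by apply/funext => x /=; rewrite tnth_mktuple.
move=> _ Y mY; rewrite setTI; apply: sub_sigma_algebra => /=.
rewrite -bigcup_seq/=; exists i => /=; first by rewrite mem_index_enum.
by exists Y => //; rewrite setTI.
Qed.

Lemma measurable_row_of_tuple : measurable_fun setT row_of_tuple.
Proof.
move=> _ Y mY; rewrite setTI.
have := @g_sigma_preimage_comp _ _ n _ coord _ row_of_tuple.
rewrite (_ : (fun i => coord i \o row_of_tuple) = fun i t => tnth t i); last first.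
  by apply/funext => i; apply/funext => t /=; rewrite /coord mxE.
by move=> E; rewrite /measurable/= E; exists Y => //; rewrite setTI.
Qed.

End measurable_row.

Definition lebesgue_measure_row (R : realType) (d : nat) :
    {sigma_finite_measure set 'rV[R]_d -> \bar R} :=
  image_measure (tuple_measure lebesgue_measure d) (@measurable_row_of_tuple _ R d)
    (@measurable_tuple_of_row _ R d) (@row_of_tupleK _ R d).

Section finite_configurations.
Context disp (T : measurableType disp).

Definition fset_of_tuple n (t : n.-tuple T) : {fset T} := [fset x in tval t]%fset.

(* The final sigma-algebra for the maps (x_1, ..., x_n) |-> {x_1, ..., x_n}.
   For T = R^d it is the usual one, given by these maps on the tuples of
   pairwise distinct points: a tuple with repeated entries is sent to the same
   configuration as a shorter tuple. *)
Definition fset_measurable : set (set {fset T}) :=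
  [set A | forall n, measurable (@fset_of_tuple n @^-1` A)].

Definition measure_fset_display : measure_display -> measure_display.
Proof. exact. Qed.

Let fset_measurable0 : fset_measurable set0.
Proof. by move=> n; rewrite preimage_set0. Qed.

Let fset_measurableC A : fset_measurable A -> fset_measurable (~` A).
Proof. by move=> mA n; rewrite preimage_setC; apply: measurableC; exact: mA. Qed.

Let fset_measurable_bigcup (F : (set {fset T})^nat) :
  (forall i, fset_measurable (F i)) -> fset_measurable (\bigcup_i F i).
Proof.
by move=> mF n; rewrite preimage_bigcup; apply: bigcup_measurable => i _; exact: mF.
Qed.

HB.instance Definition _ := @isMeasurable.Build (measure_fset_display disp)
  {fset T} fset_measurable fset_measurable0 fset_measurableC
  fset_measurable_bigcup.

Lemma measurable_fset_of_tuple n : measurable_fun setT (@fset_of_tuple n).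
Proof. by move=> _ A mA; rewrite setTI; exact: mA. Qed.

End finite_configurations.

Section lebesgue_poisson.
Context disp (T : measurableType disp) (R : realType).
Variable mu : {sigma_finite_measure set T -> \bar R}.

Definition fset_image_measure n : set {fset T} -> \bar R :=
  pushforward (tuple_measure mu n) (@fset_of_tuple _ T n).

HB.instance Definition _ n := Measure.copy (fset_image_measure n)
  (measure_function_pushforward__canonical__measure_function_Measure
    (tuple_measure mu n) (@measurable_fset_of_tuple _ T n)).

(* For an atomless mu the tuples with repeated entries are negligible. *)
Definition lebesgue_poisson : set {fset T} -> \bar R :=
  mseries (fun n => mscale (n`!%:R^-1)%:nng (fset_image_measure n)) 0.

HB.instance Definition _ := Measure.on lebesgue_poisson.

End lebesgue_poisson.

Definition locally_finite (R : realType) d (gamma : set 'rV[R]_d) : Prop :=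
  forall B : set 'rV[R]_d, bounded_set B -> finite_set (gamma `&` B).

(* Elements of L_c and K_c are represented by functions, equality in these
   spaces being equality almost everywhere; operators are represented by their
   graphs. *)

Section spaces.
Context (R : realType) (d : nat).
Implicit Types (c : R) (G H k : {fset 'rV[R]_d} -> R).

Definition lambda : {measure set {fset 'rV[R]_d} -> \bar R} :=
  lebesgue_poisson (lebesgue_measure_row R d).

Definition weightL c G : {fset 'rV[R]_d} -> R :=
  fun eta => c ^+ #|` eta| * G eta.

Definition weightK c k : {fset 'rV[R]_d} -> R :=
  fun eta => c ^- #|` eta| * k eta.

Definition spaceL c : set ({fset 'rV[R]_d} -> R) :=
  [set G | weightL c G \in Lfun lambda 1].

Definition spaceK c : set ({fset 'rV[R]_d} -> R) :=
  [set k | weightK c k \in Lfun lambda +oo%E].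

Definition normL c G : \bar R := 'N[lambda]_1[EFin \o weightL c G].

Definition normK c k : \bar R := 'N[lambda]_+oo[EFin \o weightK c k].

Definition pairing G k : R := \int[lambda]_eta (G eta * k eta).

Definition closureK c (D : set ({fset 'rV[R]_d} -> R)) :
    set ({fset 'rV[R]_d} -> R) :=
  [set k | spaceK c k /\ forall e : R, 0 < e ->
     exists2 k', D k' & (normK c (k \- k')%R < e%:E)%E].

Definition operatorL :=
  set (({fset 'rV[R]_d} -> R) * ({fset 'rV[R]_d} -> R)).

Definition closure_operator c (A : operatorL) : operatorL :=
  [set GH | [/\ spaceL c GH.1, spaceL c GH.2 &
    exists s : nat -> ({fset 'rV[R]_d} -> R) * ({fset 'rV[R]_d} -> R),
      [/\ forall n, A (s n),
          normL c ((s n).1 \- GH.1) @[n --> \oo] --> 0%E &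
          normL c ((s n).2 \- GH.2) @[n --> \oo] --> 0%E]]].

Definition adjoint_operator c (A : operatorL) : operatorL :=
  [set kk' | [/\ spaceK c kk'.1, spaceK c kk'.2 &
    forall G H, A (G, H) -> pairing H kk'.1 = pairing G kk'.2]].

Definition operator_domain (A : operatorL) : set ({fset 'rV[R]_d} -> R) :=
  [set k | exists k', A (k, k')].

(* Linearity and contractivity imply that each T t respects equality almost
   everywhere; only the values of T t on spaceL c matter. *)
Record contraction_semigroup c
    (T : R -> ({fset 'rV[R]_d} -> R) -> ({fset 'rV[R]_d} -> R)) : Prop := {
  semigroup_spaceL : forall t G, 0 <= t -> spaceL c G -> spaceL c (T t G) ;
  semigroup_linear : forall t a G H, 0 <= t -> spaceL c G -> spaceL c H ->
    T t (fun eta => a * G eta + H eta) =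
      (fun eta => a * T t G eta + T t H eta) %[ae lambda] ;
  semigroup_contraction : forall t G, 0 <= t -> spaceL c G ->
    (normL c (T t G) <= normL c G)%E ;
  semigroup0 : forall G, spaceL c G -> T 0 G = G %[ae lambda] ;
  semigroupD : forall s t G, 0 <= s -> 0 <= t -> spaceL c G ->
    T (s + t) G = T s (T t G) %[ae lambda] ;
  semigroup_continuous : forall G, spaceL c G ->
    normL c (T t G \- G) @[t --> 0^'+] --> 0%E
}.

Definition semigroup_generator c
    (T : R -> ({fset 'rV[R]_d} -> R) -> ({fset 'rV[R]_d} -> R)) : operatorL :=
  [set GH | [/\ spaceL c GH.1, spaceL c GH.2 &
    normL c (fun eta => t^-1 * (T t GH.1 eta - GH.1 eta) - GH.2 eta)
      @[t --> 0^'+] --> 0%E]].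

Definition everywhere_defined c
    (S : ({fset 'rV[R]_d} -> R) -> ({fset 'rV[R]_d} -> R)) : operatorL :=
  [set GH | spaceL c GH.1 /\ GH.2 = S GH.1].

End spaces.

Section positive_definite.
Context (R : realType) (d : nat).

Definition local_support (G : {fset 'rV[R]_d} -> R) : Prop :=
  exists B : set 'rV[R]_d, [/\ bounded_set B, measurable B &
    forall eta : {fset 'rV[R]_d}, ~ [set` eta] `<=` B -> G eta = 0].

(* [\sum_(_ \in _)] is the finite-support sum of the library: it is 0 when
   infinitely many terms are nonzero, which does not happen for G of local
   support and gamma locally finite. *)
Definition K_transform (G : {fset 'rV[R]_d} -> R) (gamma : set 'rV[R]_d) : R :=
  \sum_(eta \in [set eta : {fset 'rV[R]_d} | [set` eta] `<=` gamma]) G eta.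

Definition positive_definite (c : R) (k : {fset 'rV[R]_d} -> R) : Prop :=
  spaceK c k /\
  forall G, spaceL c G -> local_support G ->
    (forall gamma, locally_finite gamma -> 0 <= K_transform G gamma) ->
    0 <= pairing G k.

End positive_definite.

Section hatL.
Context (R : realType) (d : nat).
Variables (z : R) (phi : 'rV[R]_d -> R).

(* The potential is only meaningful away from 0. Its value at 0 never matters:
   in the integrals over x below, x - y = 0 for finitely many x. *)
Definition pair_potential : Prop :=
  [/\ measurable_fun [set x : 'rV[R]_d | x != 0] phi,
      forall x, x != 0 -> 0 <= phi x &
      forall x, x != 0 -> phi (- x) = phi x].

Definition C_phi : \bar R :=
  (\int[lebesgue_measure_row R d]_x (1 - expR (- phi x))%:E)%E.

Definition rel_energy (x : 'rV[R]_d) (xi : {fset 'rV[R]_d}) : R :=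
  \sum_(y <- xi) phi (x - y).

Definition e_lambda (f : 'rV[R]_d -> R) (eta : {fset 'rV[R]_d}) : R :=
  \prod_(x <- eta) f x.

Definition hatL (G : {fset 'rV[R]_d} -> R) : {fset 'rV[R]_d} -> R :=
  fun eta => - #|` eta|%:R * G eta +
    z * \sum_(xi <- fpowerset eta)
      \int[lebesgue_measure_row R d]_x
        (expR (- rel_energy x xi) * G (x |` xi)%fset *
         e_lambda (fun y => expR (- phi (x - y)) - 1) (eta `\` xi)%fset).

Definition hatL_operator (C : R) : operatorL R d :=
  [set GH | spaceL (2 * C) GH.1 /\ GH.2 = hatL GH.1].

Definition sun_dual (C : R)
    (T : R -> ({fset 'rV[R]_d} -> R) -> ({fset 'rV[R]_d} -> R)) (t : R) :
    operatorL R d :=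
  [set kk' |
    closureK C (operator_domain (adjoint_operator C (hatL_operator C))) kk'.1 /\
    adjoint_operator C (everywhere_defined C (T t)) kk'].

End hatL.

(* Submission.v *)
(* The adjoint flow [T^*(t) k] exists by the duality of L^1 and L^oo, and leaves
   the domain closure invariant because [T t] commutes with its generator.  For
   positivity let P be the cone of exponentially bounded [G] in L_C whose subset
   sums [sum_(xi <= gamma) G xi] are nonnegative.  In the discrete step

     V G = (1 - delta)^|.| G + delta z (births in B of (1 - delta)^|.| G)

   every point dies with probability delta and one point is born in a bounded set
   B.  If [delta z |B| <= 1] it preserves P, since the subset sums of the births
   are an integral of a Boltzmann factor times [K G (x |` gamma) - K G gamma]; by
   the smallness of z it is a contraction of L_C, and [(V - 1) / delta] converges
   to the generator on its core.  Hence the distance to P is dissipative for the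
   generator, so it stays 0 along [T t g] for g in P and in the core.  Every local
   G with [K G >= 0] is a limit of such g, namely of the inverse K-transforms of
   [min (K G) N], and a positive definite k is nonnegative on P, by restriction to
   bounded sets; so [<<T t G, k>> >= 0]. *)
Require Import Defs.
From HB Require Import structures.
From mathcomp Require Import all_boot all_order all_algebra finmap.
From mathcomp Require Import all_classical all_reals all_analysis.
From mathcomp Require Import measurable_realfun ess_sup_inf ring lra.
Set Implicit Arguments.
Unset Strict Implicit.
Unset Printing Implicit Defensive.
Import Order.TTheory GRing.Theory Num.Theory.
Import numFieldNormedType.Exports.
Local Open Scope classical_set_scope.
Local Open Scope ring_scope.

(** * Sums over subsets of a finite set *)

(** The death rate is unbounded and births fall on an infinite volume, so no explicit step
    [1 + delta L] preserves nonnegative subset sums. Confining births to B and thinning beforehand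
    repairs both. The factor $(1-\delta)^{|\cdot|}$ inside the birth term makes the first moment
    finite for every G in L_C, and Bernoulli's inequality $(1+\delta n)(1-\delta)^n\le1$ lets deaths
    pay for births as soon as $z e^{CC_\phi}/C\le1$, that is $z\le Ce^{-CC_\phi}$. Using a distance
    avoids any product formula: no iterate of V is controlled. Dissipativity is an inequality stable
    under limits in u and in L u, and an implicit Euler comparison carries it along the orbit. The
    other obstacle is that L_C consists of classes modulo null sets, while subset sums are tested on
    every finite configuration. The exponential bound in P makes the birth integrals converge at
    each configuration; convergence almost everywhere is enough only for the norm estimates. *)

Section subset_sums.
Context (T : choiceType) (R : comNzRingType).
Implicit Types (f g : T -> R) (F G : {fset T} -> R) (H : {fset T} -> {fset T} -> R)
  (eta xi : {fset T}) (x y : T).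

Definition partition_sum H eta : R :=
  \sum_(xi <- fpowerset eta) H xi (eta `\` xi)%fset.

Definition fset_prod f eta : R := \prod_(x <- eta) f x.

Definition subset_sum f G : {fset T} -> R :=
  partition_sum (fun xi zeta => fset_prod f zeta * G xi).

Definition subset_scale f G : {fset T} -> R := fun eta => fset_prod f eta * G eta.

Lemma fset_prod0 f : fset_prod f fset0 = 1.
Proof. by rewrite /fset_prod big_seq_fset0. Qed.

Lemma fset_prodU1 f x eta : x \notin eta ->
  fset_prod f (x |` eta)%fset = f x * fset_prod f eta.
Proof. by move=> xe; rewrite /fset_prod big_fsetU1. Qed.

Definition fset_sum f eta : R := \sum_(x <- eta) f x.

Lemma fset_sum0 f : fset_sum f fset0 = 0.
Proof. by rewrite /fset_sum big_seq_fset0. Qed.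

Lemma fset_sumU1 f x eta : x \notin eta ->
  fset_sum f (x |` eta)%fset = f x + fset_sum f eta.
Proof. by move=> xe; rewrite /fset_sum big_fsetU1. Qed.

Lemma partition_sum0 H : partition_sum H fset0 = H fset0 fset0.
Proof. by rewrite /partition_sum fpowerset0 big_seq_fset1 fsetD0. Qed.

(** A fresh point belongs to exactly one of the two parts. This Leibniz-type rule is the recursion
    behind the algebraic identities below, the measurability of subset sums and their integrals. *)
Lemma partition_sumU1 H x eta : x \notin eta ->
  partition_sum H (x |` eta)%fset =
  partition_sum (fun xi zeta => H (x |` xi)%fset zeta) eta +
  partition_sum (fun xi zeta => H xi (x |` zeta)%fset) eta.
Proof.
move=> xe; rewrite /partition_sum.
have xNsub xi : (xi `<=` eta)%fset -> x \notin xi.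
  by move=> xie; apply: contra xe => /(fsubsetP xie).
rewrite (big_fsetID _ (fun xi : {fset T} => x \in xi))/=; congr +%R.
- rewrite (_ : [fset _ | _ in _ & _]%fset =
      ((fun xi => x |` xi)%fset @` fpowerset eta)%fset); last first.
    apply/fsetP => xi; rewrite !inE/= fpowersetE.
    apply/andP/imfsetP => [[xis xxi]|[zeta /=]].
      exists (xi `\ x)%fset; last by rewrite fsetD1K.
      by rewrite fpowersetE fsubDset.
    rewrite fpowersetE => zs ->; split; first exact: fsetUS.
    by rewrite !inE eqxx.
  rewrite big_imfset/=; last first.
    move=> xi zeta; rewrite !fpowersetE => /xNsub xxi /xNsub xzeta E.
    by rewrite -(fsetU1K xxi) E fsetU1K.
  apply: eq_big_seq => xi; rewrite fpowersetE => xie; congr H.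
  by apply/fsetP => y; rewrite !inE;
    case: eqP => //= ->; rewrite (negbTE xe) andbF.
- rewrite (_ : [fset _ | _ in _ & _]%fset = fpowerset eta); last first.
    apply/fsetP => xi; rewrite !inE/= !fpowersetE.
    apply/andP/idP => [[xis xxi]|xie].
      apply/fsubsetP => y yxi; move/fsubsetP : xis => /(_ _ yxi).
      by rewrite !inE => /orP[/eqP yx|//]; rewrite -yx yxi in xxi.
    split; first exact: fsubset_trans xie (fsubsetU1 _ _).
    exact: xNsub.
  apply: eq_big_seq => xi; rewrite fpowersetE => xie; congr H.
  apply/fsetP => y; rewrite !inE; case: eqP => //= ->.
  by rewrite xNsub.
Qed.

Lemma eq_partition_sum H1 H2 eta :
  (forall xi, (xi `<=` eta)%fset ->
     H1 xi (eta `\` xi)%fset = H2 xi (eta `\` xi)%fset) ->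
  partition_sum H1 eta = partition_sum H2 eta.
Proof.
move=> HH; rewrite /partition_sum; apply: eq_big_seq => xi.
by rewrite fpowersetE; exact: HH.
Qed.

Lemma partition_sumD H1 H2 eta :
  partition_sum (fun xi zeta => H1 xi zeta + H2 xi zeta) eta =
  partition_sum H1 eta + partition_sum H2 eta.
Proof. by rewrite /partition_sum big_split. Qed.

Lemma partition_sumZ (a : R) H eta :
  partition_sum (fun xi zeta => a * H xi zeta) eta = a * partition_sum H eta.
Proof. by rewrite /partition_sum mulr_sumr. Qed.

Lemma subset_sum0 f G : subset_sum f G fset0 = G fset0.
Proof. by rewrite /subset_sum partition_sum0 fset_prod0 mul1r. Qed.

Lemma subset_sumU1 f G x eta : x \notin eta ->
  subset_sum f G (x |` eta)%fset =
  subset_sum f (fun xi => G (x |` xi)%fset) eta + f x * subset_sum f G eta.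
Proof.
move=> xe; rewrite /subset_sum partition_sumU1// -partition_sumZ; congr +%R.
apply: eq_partition_sum => xi xis; rewrite fset_prodU1 ?mulrA//.
by rewrite inE (negbTE xe) andbF.
Qed.

Lemma eq_subset_sum f g F G eta :
  {in eta, f =1 g} -> (forall xi, (xi `<=` eta)%fset -> F xi = G xi) ->
  subset_sum f F eta = subset_sum g G eta.
Proof.
move=> fg FG; apply: eq_partition_sum => xi xis; rewrite FG//; congr *%R.
rewrite /fset_prod; apply: eq_big_seq => x; rewrite inE => /andP[_ xe].
exact: fg.
Qed.

Lemma subset_sumD f F G eta : subset_sum f (fun xi => F xi + G xi) eta =
  subset_sum f F eta + subset_sum f G eta.
Proof.
by rewrite -partition_sumD; apply: eq_partition_sum => xi _; rewrite mulrDr.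
Qed.

Lemma subset_sumZ f (a : R) G eta : subset_sum f (fun xi => a * G xi) eta =
  a * subset_sum f G eta.
Proof.
by rewrite -partition_sumZ; apply: eq_partition_sum => xi _; rewrite mulrCA.
Qed.

Lemma fset_ind_U1 (P : {fset T} -> Prop) : P fset0 ->
  (forall x eta, x \notin eta -> P eta -> P (x |` eta)%fset) ->
  forall eta, P eta.
Proof.
move=> P0 PU eta; elim: {eta}#|` eta| {-2}eta (erefl #|` eta|) => [|n IH] eta.
  by move=> /eqP; rewrite cardfs_eq0 => /eqP ->.
move=> en; have [eta0|[x xe]] := fset_0Vmem eta.
  by move: en; rewrite eta0 cardfs0.
rewrite -(fsetD1K xe); apply: PU; first by rewrite !inE eqxx.
by apply: IH; move: en; rewrite (cardfsD1 x) xe => -[].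
Qed.

(* [subset_sum f] is convolution with [fset_prod f], so these operators compose
   additively; [subset_sum 1] is the K-transform and [subset_sum (-1)] its
   inverse. *)
Lemma subset_sum_comp f g G eta :
  subset_sum f (subset_sum g G) eta = subset_sum (fun x => f x + g x) G eta.
Proof.
elim/fset_ind_U1: eta G => [|x eta xe IH] G; first by rewrite !subset_sum0.
rewrite !subset_sumU1// IH.
rewrite (@eq_subset_sum f f _ (fun xi => subset_sum g (fun zeta => G (x |` zeta)%fset) xi
    + g x * subset_sum g G xi))//.
  by rewrite subset_sumD subset_sumZ IH IH; ring.
move=> xi xie; rewrite subset_sumU1//; apply: contra xe => /(fsubsetP xie).
exact.
Qed.

Lemma subset_sum_eq0 G eta : subset_sum (fun=> 0) G eta = G eta.
Proof.
elim/fset_ind_U1: eta G => [|x eta xe IH] G; first by rewrite !subset_sum0.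
by rewrite subset_sumU1// IH mul0r addr0.
Qed.

(** [fset_prod g] is multiplicative over the partition of eta into a subset and its complement. With
    g constant this moves a weight $c^{|\cdot|}$ inside a convolution. *)
Lemma subset_scale_sum f g G eta :
  subset_scale g (subset_sum f G) eta =
  subset_sum (fun x => g x * f x) (subset_scale g G) eta.
Proof.
rewrite /subset_scale.
elim/fset_ind_U1: eta G => [|x eta xe IH] G.
  by rewrite !subset_sum0.
rewrite !subset_sumU1// fset_prodU1// -(IH G).
rewrite (@eq_subset_sum (fun x => g x * f x) (fun x => g x * f x) _ (fun xi => g x * (fset_prod g xi * G (x |` xi)%fset)))//.
  by rewrite subset_sumZ -(IH (fun xi => G (x |` xi)%fset)); ring.
move=> xi xie; rewrite fset_prodU1 ?mulrA//; apply: contra xe => /(fsubsetP xie).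
exact.
Qed.

Lemma fset_prod_subset_sum f eta : subset_sum f (fun=> 1) eta =
  fset_prod (fun x => 1 + f x) eta.
Proof.
elim/fset_ind_U1: eta => [|x eta xe IH].
  by rewrite subset_sum0 fset_prod0.
by rewrite subset_sumU1// fset_prodU1// IH mulrDl mul1r.
Qed.

End subset_sums.

(** * Joint measurability on the configuration space *)

Section configuration_measurability.
Context disp (T : measurableType disp).
Hypothesis diagonal_measurable : measurable [set p : T * T | p.1 = p.2].

Lemma fset_of_tuple_cons n (x : T) (s : n.-tuple T) :
  fset_of_tuple (Defs.cons_tuple (x, s)) = (x |` fset_of_tuple s)%fset.
Proof. by apply/fsetP => y; rewrite !inE. Qed.

Lemma fset_of_tuple0 (s : 0.-tuple T) : fset_of_tuple s = fset0.
Proof. by apply/fsetP => y; rewrite (tuple0 s) !inE. Qed.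

Lemma cons_tupleP n (t : n.+1.-tuple T) : t = Defs.cons_tuple (uncons_tuple t).
Proof. by apply/val_inj; rewrite {1}[t]tuple_eta. Qed.

(** Membership is a finite union of preimages of the diagonal, which is where the measurability of
    the diagonal enters. *)
Lemma measurable_mem_fset_of_tuple n :
  measurable_fun setT (fun p : T * n.-tuple T => p.1 \in fset_of_tuple p.2).
Proof.
apply: (measurable_fun_bool true); rewrite setTI.
rewrite (_ : _ @^-1` _ = \bigcup_(i in [set: 'I_n])
    ((fun p : T * n.-tuple T => (p.1, tnth p.2 i)) @^-1`
      [set p : T * T | p.1 = p.2])); last first.
  apply/seteqP; split => -[x s] /=.
    rewrite /fset_of_tuple inE => /tnthP[i ->]; by exists i.
  by move=> [i _ /= ->]; rewrite /fset_of_tuple inE; exact: mem_tnth.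
apply: fin_bigcup_measurable; first exact: finite_finset.
move=> i _; rewrite -[X in measurable X]setTI.
apply: (@measurable_fun_pair _ _ _ _ _ _ fst (fun p : T * n.-tuple T => tnth p.2 i)) => //.
exact: (measurableT_comp (measurable_tnth i) measurable_snd).
Qed.

(* Joint measurability in a parameter and a configuration, read on tuples so as
   to stay within product sigma-algebras. *)
Definition jointly_measurable dD (D : measurableType dD) dY (Y : measurableType dY)
    (F : D -> {fset T} -> Y) :=
  forall n, measurable_fun setT
    (fun p : D * n.-tuple T => F p.1 (fset_of_tuple p.2)).

(** The second configuration is frozen as a tuple inside the parameter, so that two configurations
    become an instance of the notion for one. *)
Definition jointly_measurable2 dD (D : measurableType dD) dY (Y : measurableType dY)
    (H : D -> {fset T} -> {fset T} -> Y) :=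
  forall m, jointly_measurable (fun (p : D * m.-tuple T) xi =>
    H p.1 xi (fset_of_tuple p.2)).

Section closure.
Context dD (D : measurableType dD).

Lemma jointly_measurable_comp dD' (D' : measurableType dD') dY (Y : measurableType dY)
    (h : D' -> D) (F : D -> {fset T} -> Y) :
  measurable_fun setT h -> jointly_measurable F ->
  jointly_measurable (fun d' => F (h d')).
Proof.
move=> mh mF n.
have mg : measurable_fun setT (fun p : D' * n.-tuple T => (h p.1, p.2)).
  by apply: measurable_fun_pair => //; exact: measurableT_comp.
exact: (measurableT_comp (mF n) mg).
Qed.

Lemma jointly_measurable_insert dY (Y : measurableType dY)
    (F : D -> {fset T} -> Y) : jointly_measurable F ->
  jointly_measurable (fun (p : D * T) xi => F p.1 (p.2 |` xi)%fset).
Proof.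
move=> mF n.
rewrite (_ : (fun _ => _) = (fun p : D * n.+1.-tuple T => F p.1 (fset_of_tuple p.2)) \o
   (fun p : (D * T) * n.-tuple T => (p.1.1, Defs.cons_tuple (p.1.2, p.2)))); last first.
  by apply/funext => -[[d x] s] /=; rewrite fset_of_tuple_cons.
have mg : measurable_fun setT (fun p : D * T * n.-tuple T => (p.1.2, p.2)).
  by apply: measurable_fun_pair => //; exact: measurableT_comp.
have mc := measurableT_comp (@measurable_cons_tuple _ T n) mg.
have m1 : measurable_fun setT (fun p : D * T * n.-tuple T => p.1.1).
  exact: measurableT_comp.
exact: (measurableT_comp (mF n.+1) (measurable_fun_pair m1 mc)).
Qed.

(* Splitting off the head of a tuple; the head may already occur in the tail,
   in which case it is redundant. *)
Lemma jointly_measurable_ind dY (Y : measurableType dY) (F : D -> {fset T} -> Y)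
  n (Fin : measurable_fun setT (fun p : D * n.-tuple T => F p.1 (fset_of_tuple p.2)))
  (G : D * T -> {fset T} -> Y)
  (Gin : measurable_fun setT (fun p : (D * T) * n.-tuple T => G p.1 (fset_of_tuple p.2)))
  (FG : forall d x eta, x \notin eta -> F d (x |` eta)%fset = G (d, x) eta) :
  measurable_fun setT (fun p : D * n.+1.-tuple T => F p.1 (fset_of_tuple p.2)).
Proof.
pose H (p : (D * T) * n.-tuple T) :=
  if p.1.2 \in fset_of_tuple p.2 then F p.1.1 (fset_of_tuple p.2)
  else G p.1 (fset_of_tuple p.2).
rewrite (_ : (fun _ => _) = H \o
    (fun p : D * n.+1.-tuple T => ((p.1, (uncons_tuple p.2).1), (uncons_tuple p.2).2))); last first.
  apply/funext => -[d t]; rewrite /H /= [in LHS](cons_tupleP t).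
  rewrite (surjective_pairing (uncons_tuple t)) fset_of_tuple_cons /=.
  case: ifPn => xs; last by rewrite FG.
  by congr F; apply/fsetUidPr; rewrite fsub1set.
have mu : measurable_fun setT (fun p : D * n.+1.-tuple T => uncons_tuple p.2).
  by apply: measurableT_comp => //; exact: measurable_uncons_tuple.
have /measurable_fun_pairP[mu1 mu2] := mu.
apply: measurableT_comp; last first.
  by apply: measurable_fun_pair => //; apply: measurable_fun_pair.
apply: measurable_fun_ifT => //.
- have mg : measurable_fun setT (fun p : D * T * n.-tuple T => (p.1.2, p.2)).
    by apply: measurable_fun_pair => //; exact: measurableT_comp.
  exact: (measurableT_comp (@measurable_mem_fset_of_tuple n) mg).
- have mg : measurable_fun setT (fun p : D * T * n.-tuple T => (p.1.1, p.2)).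
    by apply: measurable_fun_pair => //; exact: measurableT_comp.
  exact: (measurableT_comp Fin mg).
Qed.


Lemma jointly_measurableW dY (Y : measurableType dY) (F : {fset T} -> Y) :
  measurable_fun setT F -> jointly_measurable (fun _ : D => F).
Proof.
move=> mF n.
exact: (measurableT_comp mF (measurableT_comp (@measurable_fset_of_tuple _ T n) measurable_snd)).
Qed.

(** The sigma-algebra on configurations is final for the maps [fset_of_tuple], so a test on tuples
    of each length suffices. *)
Lemma jointly_measurable_fun dY (Y : measurableType dY) (F : D -> {fset T} -> Y) d :
  jointly_measurable F -> measurable_fun setT (F d).
Proof.
move=> mF _ B mB; rewrite setTI.
suff : fset_measurable (F d @^-1` B) by [].
move=> n; rewrite -[X in measurable X]setTI.
exact: (measurableT_comp (mF n) (pair1_measurable d)).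
Qed.

Lemma jointly_measurable_comp_fun dY (Y : measurableType dY) dY' (Y' : measurableType dY')
    (h : Y -> Y') (F : D -> {fset T} -> Y) :
  measurable_fun setT h -> jointly_measurable F ->
  jointly_measurable (fun d eta => h (F d eta)).
Proof. by move=> mh mF n; exact: (measurableT_comp mh (mF n)). Qed.

Section real_valued.
Context (R : realType).

Lemma jointly_measurableM (F G : D -> {fset T} -> R) :
  jointly_measurable F -> jointly_measurable G ->
  jointly_measurable (fun d eta => F d eta * G d eta).
Proof. by move=> mF mG n; apply: measurable_funM; [exact: mF|exact: mG]. Qed.

Lemma jointly_measurable_param (f : D -> R) : measurable_fun setT f ->
  jointly_measurable (fun d (_ : {fset T}) => f d).
Proof. by move=> mf n; exact: (measurableT_comp mf measurable_fst). Qed.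

Lemma jointly_measurable2_prod (F G : D -> {fset T} -> R) :
  jointly_measurable F -> jointly_measurable G ->
  jointly_measurable2 (fun d xi zeta => F d zeta * G d xi).
Proof.
move=> mF mG m n; apply: measurable_funM.
  exact: (measurableT_comp (mF m) measurable_fst).
have mg : measurable_fun setT (fun p : (D * m.-tuple T) * n.-tuple T => (p.1.1, p.2)).
  by apply: measurable_fun_pair => //; exact: measurableT_comp.
exact: (measurableT_comp (mG n) mg).
Qed.

End real_valued.

Lemma jointly_measurable2_insertl dY (Y : measurableType dY)
    (H : D -> {fset T} -> {fset T} -> Y) : jointly_measurable2 H ->
  jointly_measurable2 (fun (p : D * T) xi zeta => H p.1 (p.2 |` xi)%fset zeta).
Proof.
move=> mH m n.
have mg : measurable_fun setT (fun p : ((D * T) * m.-tuple T) * n.-tuple T =>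
    (p.1.1.2, p.2)).
  apply: measurable_fun_pair => //.
  exact: (measurableT_comp measurable_snd (measurableT_comp measurable_fst measurable_fst)).
have mc := measurableT_comp (@measurable_cons_tuple _ T n) mg.
have md : measurable_fun setT (fun p : ((D * T) * m.-tuple T) * n.-tuple T => (p.1.1.1, p.1.2)).
  apply: measurable_fun_pair; last exact: measurableT_comp.
  exact: (measurableT_comp measurable_fst (measurableT_comp measurable_fst measurable_fst)).
have := measurableT_comp (mH m n.+1) (measurable_fun_pair md mc).
by apply: eq_measurable_fun => -[[[d x] s] t] _ /=; rewrite fset_of_tuple_cons.
Qed.

Lemma jointly_measurable2_insertr dY (Y : measurableType dY)
    (H : D -> {fset T} -> {fset T} -> Y) : jointly_measurable2 H ->
  jointly_measurable2 (fun (p : D * T) xi zeta => H p.1 xi (p.2 |` zeta)%fset).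
Proof.
move=> mH m n.
have mg : measurable_fun setT (fun p : ((D * T) * m.-tuple T) * n.-tuple T =>
    (p.1.1.2, p.1.2)).
  apply: measurable_fun_pair; last exact: measurableT_comp.
  exact: (measurableT_comp measurable_snd (measurableT_comp measurable_fst measurable_fst)).
have mc := measurableT_comp (@measurable_cons_tuple _ T m) mg.
have md : measurable_fun setT (fun p : ((D * T) * m.-tuple T) * n.-tuple T => p.1.1.1).
  exact: (measurableT_comp measurable_fst (measurableT_comp measurable_fst measurable_fst)).
have := measurableT_comp (mH m.+1 n) (measurable_fun_pair (measurable_fun_pair md mc) measurable_snd).
by apply: eq_measurable_fun => -[[[d x] s] t] _ /=; rewrite fset_of_tuple_cons.
Qed.

End closure.

Lemma jointly_measurable_insert_fun dY (Y : measurableType dY) (F : {fset T} -> Y) :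
  measurable_fun setT F -> jointly_measurable (fun (x : T) xi => F (x |` xi)%fset).
Proof.
move=> mF.
have mh : measurable_fun setT (fun x : T => (tt, x)).
  by apply: measurable_fun_pair => //; exact: measurable_cst.
exact: (jointly_measurable_comp mh (jointly_measurable_insert (jointly_measurableW mF))).
Qed.

Section sums_and_products.
Context (R : realType).

(** Induction on the number of points, for all parameter spaces at once: by [partition_sumU1] the
    head of the tuple joins the first or the second part, as an additional parameter. *)
Lemma jointly_measurable_partition_sum dD (D : measurableType dD)
    (H : D -> {fset T} -> {fset T} -> R) : jointly_measurable2 H ->
  jointly_measurable (fun d => partition_sum (H d)).
Proof.
move=> mH n; elim: n dD D H mH => [|n IH] dD D H mH.
  have mg : measurable_fun setT (fun p : D * 0.-tuple T => ((p.1, [tuple] : 0.-tuple T), [tuple] : 0.-tuple T)).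
    apply: measurable_fun_pair; last exact: measurable_cst.
    by apply: measurable_fun_pair => //; exact: measurable_cst.
  have := measurableT_comp (mH 0 0) mg.
  apply: eq_measurable_fun => -[d t] _ /=.
  by rewrite !fset_of_tuple0 partition_sum0.
pose G (p : D * T) eta := partition_sum (fun xi zeta => H p.1 (p.2 |` xi)%fset zeta) eta +
  partition_sum (fun xi zeta => H p.1 xi (p.2 |` zeta)%fset) eta.
refine (@jointly_measurable_ind _ _ _ _ (fun d => partition_sum (H d)) _ (IH _ _ _ mH) G _ _).
  exact: (measurable_funD (IH _ _ _ (jointly_measurable2_insertl mH))
    (IH _ _ _ (jointly_measurable2_insertr mH))).
by move=> d x eta xe; rewrite partition_sumU1.
Qed.

Lemma jointly_measurable_fset_prod dD (D : measurableType dD) (f : D -> T -> R) :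
  measurable_fun setT (fun p : D * T => f p.1 p.2) ->
  jointly_measurable (fun d => fset_prod (f d)).
Proof.
move=> mf; elim=> [|n IH].
  rewrite (_ : (fun _ => _) = cst 1); first exact: measurable_cst.
  by apply/funext => -[d t] /=; rewrite fset_of_tuple0 fset_prod0.
refine (@jointly_measurable_ind _ _ _ _ (fun d => fset_prod (f d)) _ IH
  (fun (p : D * T) eta => f p.1 p.2 * fset_prod (f p.1) eta) _ _).
  have mf1 : measurable_fun setT (fun p : (D * T) * n.-tuple T => f p.1.1 p.1.2).
    exact: (measurableT_comp mf measurable_fst).
  have mg : measurable_fun setT (fun p : (D * T) * n.-tuple T => (p.1.1, p.2)).
    by apply: measurable_fun_pair => //; exact: measurableT_comp.
  exact: (measurable_funM mf1 (measurableT_comp IH mg)).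
by move=> d x eta xe; rewrite fset_prodU1.
Qed.

Lemma jointly_measurable_fset_sum dD (D : measurableType dD) (f : D -> T -> R) :
  measurable_fun setT (fun p : D * T => f p.1 p.2) ->
  jointly_measurable (fun d => fset_sum (f d)).
Proof.
move=> mf; elim=> [|n IH].
  rewrite (_ : (fun _ => _) = cst 0); first exact: measurable_cst.
  by apply/funext => -[d t] /=; rewrite fset_of_tuple0 fset_sum0.
refine (@jointly_measurable_ind _ _ _ _ (fun d => fset_sum (f d)) _ IH
  (fun (p : D * T) eta => f p.1 p.2 + fset_sum (f p.1) eta) _ _).
  have mf1 : measurable_fun setT (fun p : (D * T) * n.-tuple T => f p.1.1 p.1.2).
    exact: (measurableT_comp mf measurable_fst).
  have mg : measurable_fun setT (fun p : (D * T) * n.-tuple T => (p.1.1, p.2)).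
    by apply: measurable_fun_pair => //; exact: measurableT_comp.
  exact: (measurable_funD mf1 (measurableT_comp IH mg)).
by move=> d x eta xe; rewrite fset_sumU1.
Qed.

Lemma jointly_measurable_subset_sum dD (D : measurableType dD) (f : D -> T -> R)
    (G : D -> {fset T} -> R) :
  measurable_fun setT (fun p : D * T => f p.1 p.2) -> jointly_measurable G ->
  jointly_measurable (fun d => subset_sum (f d) (G d)).
Proof.
move=> mf mG; apply: jointly_measurable_partition_sum.
by apply: jointly_measurable2_prod => //; exact: jointly_measurable_fset_prod.
Qed.

Lemma measurable_subset_sum (f : T -> R) (G : {fset T} -> R) :
  measurable_fun setT f -> measurable_fun setT G ->
  measurable_fun setT (subset_sum f G).
Proof.
move=> mf mG; apply: (@jointly_measurable_fun _ unit _ _ (fun=> subset_sum f G) tt).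
apply: jointly_measurable_subset_sum; last exact: jointly_measurableW.
exact: (measurableT_comp mf measurable_snd).
Qed.

Lemma measurable_fset_prod (f : T -> R) :
  measurable_fun setT f -> measurable_fun setT (fset_prod f).
Proof.
move=> mf; apply: (@jointly_measurable_fun _ unit _ _ (fun=> fset_prod f) tt).
apply: jointly_measurable_fset_prod.
exact: (measurableT_comp mf measurable_snd).
Qed.

Lemma measurable_fset_sum (f : T -> R) :
  measurable_fun setT f -> measurable_fun setT (fset_sum f).
Proof.
move=> mf; apply: (@jointly_measurable_fun _ unit _ _ (fun=> fset_sum f) tt).
apply: jointly_measurable_fset_sum.
exact: (measurableT_comp mf measurable_snd).
Qed.

End sums_and_products.

Section integrals.
Context (R : realType) (mu : {sigma_finite_measure set T -> \bar R}).

Lemma jointly_measurable_integral dD (D : measurableType dD)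
    (F : D * T -> {fset T} -> \bar R) : (forall p eta, (0 <= F p eta)%E) ->
  jointly_measurable F ->
  jointly_measurable (fun d eta => (\int[mu]_x F (d, x) eta)%E).
Proof.
move=> F0 mF n.
have mg : measurable_fun setT (fun p : (D * n.-tuple T) * T => ((p.1.1, p.2), p.1.2)).
  apply: measurable_fun_pair; last exact: measurableT_comp.
  by apply: measurable_fun_pair => //; exact: measurableT_comp.
have := measurableT_comp (mF n) mg.
by move=> /(@measurable_fun_fubini_tonelli_F _ _ _ _ _ mu _); apply=> p /=.
Qed.

Lemma jointly_measurable_Rintegral dD (D : measurableType dD)
    (F : D * T -> {fset T} -> R) : jointly_measurable F ->
  jointly_measurable (fun d eta => \int[mu]_x F (d, x) eta).
Proof.
move=> mF; rewrite /Rintegral; apply: jointly_measurable_comp_fun => //.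
move=> n.
(* [Rintegral] is [fine] of the difference of the integrals of the positive and negative parts. Each
   of these is measurable in the parameter by Tonelli, also where it is infinite. *)
have max0 (F' : D * T -> {fset T} -> R) p eta :
  (0 <= Order.max (F' p eta)%:E 0)%E by rewrite le_max lexx orbT.
have mmax (F' : D * T -> {fset T} -> R) : jointly_measurable F' ->
    jointly_measurable (fun p eta => Order.max (F' p eta)%:E 0%E).
  move=> mF' m; apply: measurable_maxe; last exact: measurable_cst.
  by apply/measurable_EFinP; exact: mF'.
have mNF : jointly_measurable (fun p eta => - F p eta).
  by move=> m; apply: measurable_funN; exact: mF.
have := @jointly_measurable_integral _ _ (fun p eta => Order.max (F p eta)%:E 0%E)
    (max0 F) (mmax _ mF) n.
have := @jointly_measurable_integral _ _ (fun p eta => Order.max (- F p eta)%:E 0%E)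
  (max0 (fun p eta => - F p eta)) (mmax _ mNF) n.
move=> m1 m2; have := emeasurable_funB m2 m1.
apply: eq_measurable_fun => p _ /=; rewrite [in RHS]integralE.
by congr (_ - _)%E; apply: eq_integral => x _; rewrite ?funeposE ?funenegE/= ?EFinN.
Qed.

End integrals.
End configuration_measurability.

(** * Lebesgue-Poisson integrals *)

Section tuple_integral.
Context disp (T : measurableType disp) (R : realType).
Variable mu : {sigma_finite_measure set T -> \bar R}.
Local Open Scope ereal_scope.
Hypothesis diagonal_measurable : measurable [set p : T * T | p.1 = p.2].
Hypothesis mu_atomless : forall x, mu [set x] = 0.

Lemma ge0_integral_tuple_measureS n (f : n.+1.-tuple T -> \bar R) :
  (forall t, 0 <= f t) -> measurable_fun setT f ->
  \int[tuple_measure mu n.+1]_t f t =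
  \int[mu]_x \int[tuple_measure mu n]_s f (Defs.cons_tuple (x, s)).
Proof.
move=> f0 mf.
have mc := @measurable_cons_tuple _ T n.
transitivity (\int[pushforward (mu \x tuple_measure mu n) (@Defs.cons_tuple _ T n)]_t f t).
  by apply: eq_measure_integral => A mA _.
rewrite ge0_integral_pushforward//= preimage_setT.
rewrite fubini_tonelli1//; exact: measurableT_comp.
Qed.

Lemma integral_tuple_measure0 (f : 0.-tuple T -> \bar R) :
  measurable_fun setT f -> \int[tuple_measure mu 0]_t f t = f [tuple].
Proof. by move=> mf; rewrite integral_dirac// diracT mul1e. Qed.

Definition lp_term n (G : {fset T} -> \bar R) : \bar R :=
  (n`!%:R^-1)%:E * \int[tuple_measure mu n]_t G (fset_of_tuple t).

Local Notation LP := (lebesgue_poisson mu).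

Let invfact_ge0 n : 0 <= (n`!%:R^-1 : R)%:E.
Proof. by rewrite lee_fin invr_ge0. Qed.

Lemma measurable_fset_tuple (G : {fset T} -> \bar R) n : measurable_fun setT G ->
  measurable_fun setT (fun t : n.-tuple T => G (fset_of_tuple t)).
Proof. by move=> mG; exact: (measurableT_comp mG (@measurable_fset_of_tuple _ T n)). Qed.

Lemma lp_term_ge0 n G : (forall eta, 0 <= G eta) -> 0 <= lp_term n G.
Proof. by move=> G0; apply: mule_ge0 => //; exact: integral_ge0. Qed.

Lemma integral_lebesgue_poisson (G : {fset T} -> \bar R) :
  (forall eta, 0 <= G eta) -> measurable_fun setT G ->
  \int[LP]_eta G eta = \sum_(n <oo) lp_term n G.
Proof.
move=> G0 mG.
transitivity (\sum_(n <oo)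
  \int[mscale ((n`!%:R^-1)%:nng)%R (fset_image_measure mu n)]_eta G eta).
  by rewrite -(ge0_integral_measure_series
    (fun n => mscale ((n`!%:R^-1)%:nng)%R (fset_image_measure mu n))).
apply: eq_eseriesr => n _; rewrite ge0_integral_mscale//; congr (_ * _).
have := @ge0_integral_pushforward _ _ _ _ R _ (@measurable_fset_of_tuple _ T n)
  (tuple_measure mu n) setT G measurableT mG (fun eta _ => G0 eta).
by rewrite preimage_setT.
Qed.

Lemma lp_term0 G : measurable_fun setT G -> lp_term 0 G = G fset0.
Proof.
move=> mG; rewrite /lp_term fact0 invr1 mul1e integral_tuple_measure0.
  by rewrite fset_of_tuple0.
exact: measurable_fset_tuple.
Qed.

Lemma measurable_lp_term dD (D : measurableType dD) (F : D -> {fset T} -> \bar R) n :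
  (forall d eta, 0 <= F d eta) -> jointly_measurable F ->
  measurable_fun setT (fun d => lp_term n (F d)).
Proof.
move=> F0 mF; rewrite /lp_term; apply: measurable_funeM.
exact: (@measurable_fun_fubini_tonelli_F _ _ _ _ _ (tuple_measure mu n)
  (fun p : D * n.-tuple T => F p.1 (fset_of_tuple p.2)) (mF n) (fun p => F0 _ _)).
Qed.

Lemma measurable_point (x : T) : measurable [set x].
Proof.
have := measurable_xsection x diagonal_measurable.
rewrite (_ : xsection _ _ = [set x])//.
by apply/seteqP; split => y; rewrite /xsection/= inE/= => ->.
Qed.

Lemma fset_null (eta : {fset T}) : measurable [set` eta] /\ mu [set` eta] = 0.
Proof.
elim/fset_ind_U1: eta => [|x eta _ [meta eta0]].
  by rewrite set_fset0 measure0; split => //; exact: measurable0.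
rewrite set_fsetU1; split; first by apply: measurableU => //; exact: measurable_point.
by rewrite measureU0//; [exact: mu_atomless|exact: measurable_point].
Qed.

(** With the tuple fixed, its finitely many entries form a null set of points x, mu being atomless;
    Tonelli brings the integral over x inside to use this. *)
Lemma eq_integral_lp_term n (F1 F2 : T -> {fset T} -> \bar R) :
  (forall x eta, 0 <= F1 x eta) -> (forall x eta, 0 <= F2 x eta) ->
  jointly_measurable F1 -> jointly_measurable F2 ->
  (forall x eta, x \notin eta -> F1 x eta = F2 x eta) ->
  \int[mu]_x lp_term n (F1 x) = \int[mu]_x lp_term n (F2 x).
Proof.
move=> F10 F20 mF1 mF2 F12; rewrite /lp_term.
have mint (F : T -> {fset T} -> \bar R) : (forall x eta, 0 <= F x eta) -> jointly_measurable F ->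
    measurable_fun setT (fun x => \int[tuple_measure mu n]_t F x (fset_of_tuple t)).
  move=> F0 mF.
  exact: (@measurable_fun_fubini_tonelli_F _ _ _ _ _ (tuple_measure mu n)
    (fun p : T * n.-tuple T => F p.1 (fset_of_tuple p.2)) (mF n) (fun p => F0 _ _)).
rewrite !ge0_integralZl//; first last.
- by move=> x _; exact: integral_ge0.
- exact: mint.
- by move=> x _; exact: integral_ge0.
- exact: mint.
congr (_ * _).
rewrite (fubini_tonelli (fun p : T * n.-tuple T => F1 p.1 (fset_of_tuple p.2)))//; last exact: mF1.
rewrite (fubini_tonelli (fun p : T * n.-tuple T => F2 p.1 (fset_of_tuple p.2)))//; last exact: mF2.
apply: eq_integral => t _ /=.
have mpair (F : T -> {fset T} -> \bar R) : jointly_measurable F -> measurable_fun setT (fun x : T => F x (fset_of_tuple t) : \bar R).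
  by move=> mF; exact: (measurableT_comp (mF n) (pair2_measurable t)).
apply: ge0_ae_eq_integral => //; [exact: mpair|exact: mpair|].
have [mt t0] := fset_null (fset_of_tuple t).
exists [set` fset_of_tuple t]; split => //.
by move=> x /= /not_implyP[_]; apply: contra_notP => /negP; exact: F12.
Qed.

End tuple_integral.

(** * Mecke's identity and the exponential estimate for Lebesgue-Poisson integrals *)

Section lebesgue_poisson_integral.
Context disp (T : measurableType disp) (R : realType).
Variable mu : {sigma_finite_measure set T -> \bar R}.
Local Open Scope ereal_scope.
Hypothesis diagonal_measurable : measurable [set p : T * T | p.1 = p.2].
Hypothesis mu_atomless : forall x, mu [set x] = 0.

Local Notation LP := (lebesgue_poisson mu).
Local Notation lp_term := (lp_term mu).

Implicit Types (G : {fset T} -> \bar R) (w f : T -> R) (H : {fset T} -> R).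

Lemma lp_termD n G1 G2 : (forall eta, 0 <= G1 eta) -> (forall eta, 0 <= G2 eta) ->
  measurable_fun setT G1 -> measurable_fun setT G2 ->
  lp_term n (fun eta => G1 eta + G2 eta) = lp_term n G1 + lp_term n G2.
Proof.
move=> G10 G20 mG1 mG2; rewrite /lp_term ge0_integralD//; last 2 first.
- exact: measurable_fset_tuple.
- exact: measurable_fset_tuple.
by rewrite muleDr// ge0_adde_def// inE integral_ge0.
Qed.

Lemma lp_termZ n (c : R) G : (forall eta, 0 <= G eta) -> measurable_fun setT G ->
  (0 <= c)%R -> lp_term n (fun eta => c%:E * G eta) = c%:E * lp_term n G.
Proof.
move=> G0 mG c0; rewrite /lp_term ge0_integralZl//; first by rewrite muleCA.
exact: measurable_fset_tuple.
Qed.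

Lemma eq_lp_term n G1 G2 : G1 =1 G2 -> lp_term n G1 = lp_term n G2.
Proof. by move=> /funext ->. Qed.

(** $(n+1)/(n+1)! = 1/n!$: the factor n+1 differentiates the generating series of the terms, and on
    G this derivative is the insertion of a point. *)
Lemma lp_termS n G : (forall eta, 0 <= G eta) -> measurable_fun setT G ->
  (n.+1%:R)%:E * lp_term n.+1 G = \int[mu]_x lp_term n (fun eta => G (x |` eta)%fset).
Proof.
move=> G0 mG; rewrite /lp_term.
rewrite ge0_integral_tuple_measureS//; last exact: measurable_fset_tuple.
rewrite muleA -EFinM factS natrM invfM mulrA divff ?pnatr_eq0// mul1r.
under eq_integral do under eq_integral do rewrite fset_of_tuple_cons.
rewrite ge0_integralZl//; last by move=> x _; apply: integral_ge0.
exact: (@measurable_fun_fubini_tonelli_F _ _ _ _ _ (tuple_measure mu n)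
  (fun p : T * n.-tuple T => G (p.1 |` fset_of_tuple p.2)%fset)
  (@jointly_measurable_insert_fun _ T _ _ G mG n)).
Qed.


Let jm_insert dY (Y : measurableType dY) (G : {fset T} -> Y) : measurable_fun setT G ->
  jointly_measurable (fun (x : T) eta => G (x |` eta)%fset).
Proof. exact: jointly_measurable_insert_fun. Qed.

Let m_insert dY (Y : measurableType dY) (G : {fset T} -> Y) x : measurable_fun setT G ->
  measurable_fun setT (fun eta => G (x |` eta)%fset).
Proof. by move=> mG; exact: (jointly_measurable_fun x (jm_insert mG)). Qed.

Lemma mulEFin_injl (a : R) : (0 < a)%R -> injective ( *%E a%:E).
Proof.
move=> a0 x y E; apply/eqP; rewrite eq_le -(lee_pmul2l (x := a%:E))//.
by rewrite -[X in _ && X](lee_pmul2l (x := a%:E))// E lexx.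
Qed.

Lemma measurable_lp_term_insert n G : (forall eta, 0 <= G eta) ->
  measurable_fun setT G ->
  measurable_fun setT (fun x => lp_term n (fun eta => G (x |` eta)%fset)).
Proof. by move=> G0 mG; apply: measurable_lp_term => //; exact: jm_insert. Qed.

Let jm_weight (w : T -> R) n0 (mw : measurable_fun setT w) :
  measurable_fun setT (fun p : T * n0.-tuple T => w p.1).
Proof. exact: (measurableT_comp mw measurable_fst). Qed.

(** [fset_sum w] gains the value w x when x is inserted, except when x is already present, which is
    negligible. *)
Lemma lp_term_sumS n w H : (forall x, 0 <= w x)%R -> (forall eta, 0 <= H eta)%R ->
  measurable_fun setT w -> measurable_fun setT H ->
  (n.+1%:R)%:E * lp_term n.+1 (fun eta => (fset_sum w eta * H eta)%:E) =
  \int[mu]_x ((w x)%:E * lp_term n (fun eta => (H (x |` eta)%fset)%:E)) +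
  \int[mu]_x lp_term n (fun eta => (fset_sum w eta * H (x |` eta)%fset)%:E).
Proof.
move=> w0 H0 mw mH.
have sw0 eta : (0 <= fset_sum w eta)%R by apply: sumr_ge0.
have msw := measurable_fset_sum diagonal_measurable mw.
have mEH : measurable_fun setT (fun eta => (H eta)%:E) by exact/measurable_EFinP.
have mswH : measurable_fun setT (fun eta => (fset_sum w eta * H eta)%:E).
  by apply/measurable_EFinP; exact: measurable_funM.
have jHx := jm_insert mH.
have jEHx := jm_insert mEH.
have jsHx : jointly_measurable (fun x eta => (fset_sum w eta * H (x |` eta)%fset)%:E).
  move=> m; apply/measurable_EFinP; apply: measurable_funM; last exact: jHx.
  exact: (measurableT_comp msw (measurableT_comp (@measurable_fset_of_tuple _ T m) measurable_snd)).
have jwHx : jointly_measurable (fun x eta => (w x)%:E * (H (x |` eta)%fset)%:E).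
  move=> m; apply: emeasurable_funM; last exact: jEHx.
  by apply/measurable_EFinP; exact: jm_weight.
have wH0 x eta : 0 <= (w x)%:E * (H (x |` eta)%fset)%:E by rewrite -EFinM lee_fin mulr_ge0.
have sH0 x eta : 0 <= (fset_sum w eta * H (x |` eta)%fset)%:E by rewrite lee_fin mulr_ge0.
rewrite lp_termS; first last.
- exact: mswH.
- by move=> eta; rewrite lee_fin mulr_ge0.
rewrite (@eq_integral_lp_term _ _ _ mu diagonal_measurable mu_atomless n _
   (fun x eta => (w x)%:E * (H (x |` eta)%fset)%:E +
     (fset_sum w eta * H (x |` eta)%fset)%:E)); first last.
- by move=> x eta xe; rewrite fset_sumU1// mulrDl EFinD.
- by move=> m; apply: emeasurable_funD; [exact: jwHx|exact: jsHx].
- exact: (jm_insert mswH).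
- by move=> x eta; apply: adde_ge0.
- by move=> x eta; rewrite lee_fin mulr_ge0.
rewrite -ge0_integralD//; first last.
- by apply: measurable_lp_term.
- by move=> x _; apply: lp_term_ge0.
- apply: emeasurable_funM; first exact/measurable_EFinP.
  by apply: measurable_lp_term => //; move=> x eta; rewrite lee_fin.
- move=> x _; apply: mule_ge0; first by rewrite lee_fin.
  by apply: lp_term_ge0 => eta; rewrite lee_fin.
apply: eq_integral => x _; rewrite lp_termD//.
- rewrite lp_termZ//; last exact: (m_insert x mEH).
  by move=> eta; rewrite lee_fin.
- exact: (jointly_measurable_fun x jwHx).
- exact: (jointly_measurable_fun x jsHx).
Qed.

(** The n-point form of Mecke's identity. By the induction hypothesis for H with a point inserted,
    the second summand of [lp_term_sumS] is n+1 copies of the first, and 1 + (n+1) cancels the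
    factor n+2. *)
Lemma lp_term_mecke n w H : (forall x, 0 <= w x)%R -> (forall eta, 0 <= H eta)%R ->
  measurable_fun setT w -> measurable_fun setT H ->
  lp_term n.+1 (fun eta => (fset_sum w eta * H eta)%:E) =
  \int[mu]_x ((w x)%:E * lp_term n (fun eta => (H (x |` eta)%fset)%:E)).
Proof.
move=> w0 + mw; elim: n H => [|n IH] H H0 mH.
  apply: (@mulEFin_injl 1%:R) => //; rewrite lp_term_sumS//.
  rewrite [X in _ + X]integral0_eq ?adde0 ?mul1e// => x _.
  rewrite lp_term0 ?fset_sum0 ?mul0r//; apply/measurable_EFinP.
  by apply: measurable_funM; [exact: measurable_fset_sum|exact: m_insert].
apply: (@mulEFin_injl n.+2%:R) => //; rewrite lp_term_sumS//.
have mEH : measurable_fun setT (fun eta => (H eta)%:E) by exact/measurable_EFinP.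
have jEHx := jm_insert mEH.
rewrite [X in _ + X](_ : _ = (n.+1%:R)%:E * \int[mu]_x ((w x)%:E *
    lp_term n.+1 (fun eta => (H (x |` eta)%fset)%:E))).
  by rewrite -[X in X + _]mul1e -ge0_muleDl.
(* The two inserted points are exchanged by Tonelli, after which [lp_termS] absorbs the one that
   carries no weight. *)
transitivity (\int[mu]_x \int[mu]_y ((w y)%:E *
    lp_term n (fun eta => (H (x |` (y |` eta))%fset)%:E))).
  apply: eq_integral => x _; rewrite (IH (fun eta => H (x |` eta)%fset))//.
  exact: (jointly_measurable_fun x (jm_insert mH)).
have mlp : measurable_fun setT (fun p : T * T => lp_term n (fun eta => (H (p.1 |` (p.2 |` eta))%fset)%:E)).
  apply: measurable_lp_term; last exact: (jointly_measurable_insert jEHx).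
  by move=> p eta; rewrite lee_fin.
have lp0 m (H' : {fset T} -> R) : (forall eta, 0 <= H' eta)%R -> 0 <= lp_term m (fun eta => (H' eta)%:E).
  by move=> H'0; apply: lp_term_ge0 => eta; rewrite lee_fin.
rewrite (fubini_tonelli (fun p : T * T => (w p.2)%:E *
  lp_term n (fun eta => (H (p.1 |` (p.2 |` eta))%fset)%:E)))/=; first last.
- by move=> p; apply: mule_ge0; [rewrite lee_fin|exact: lp0].
- apply: emeasurable_funM => //; apply/measurable_EFinP.
  exact: (measurableT_comp mw measurable_snd).
rewrite -ge0_integralZl//; first last.
- by move=> x _; apply: mule_ge0; [rewrite lee_fin|exact: lp0].
- apply: emeasurable_funM; first exact/measurable_EFinP.
  by apply: (@measurable_lp_term_insert n.+1 (fun eta => (H eta)%:E)) => // eta; rewrite lee_fin.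
apply: eq_integral => y _.
rewrite ge0_integralZl//; first last.
- by rewrite lee_fin.
- by move=> x _; exact: lp0.
- exact: (measurableT_comp mlp (pair2_measurable y)).
rewrite [RHS]muleCA (@lp_termS n (fun eta => (H (y |` eta)%fset)%:E)); first last.
- exact: (m_insert y mEH).
- by move=> eta; rewrite lee_fin.
apply: (congr1 (fun u => (w y)%:E * u)).
by apply: eq_integral => x _; apply: eq_lp_term => eta; rewrite fsetUCA.
Qed.

Lemma subset_sum_ge0 f H eta : (forall x, 0 <= f x)%R -> (forall xi, 0 <= H xi)%R ->
  (0 <= subset_sum f H eta)%R.
Proof.
move=> f0 H0; apply: sumr_ge0 => xi _; apply: mulr_ge0 => //.
by apply: prodr_ge0.
Qed.

(** Leibniz's rule for $e^{cs}\sum_k b_k s^k$ at the coefficient of $s^n$: differentiation either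
    shifts b or brings down a factor c. *)
Lemma convolution_exp_rec (c : R) (b : nat -> \bar R) n : (0 <= c)%R ->
  (forall k, 0 <= b k) ->
  (n.+1%:R)%:E * (\sum_(k < n.+2) (exp_coeff c (n.+1 - k)%N)%:E * b k) =
  \sum_(k < n.+1) (exp_coeff c (n - k)%N)%:E * ((k.+1%:R)%:E * b k.+1) +
  c%:E * \sum_(k < n.+1) (exp_coeff c (n - k)%N)%:E * b k.
Proof.
move=> c0 b0.
have a0 m : (0 <= exp_coeff c m)%R by exact: exp_coeff_ge0.
have aS m : (m.+1%:R * exp_coeff c m.+1 = c * exp_coeff c m)%R.
  rewrite /exp_coeff/= factS natrM exprS; field.
  by rewrite nat1r !pnatr_eq0 -lt0n fact_gt0.
have ab0 k m : 0 <= (exp_coeff c m)%:E * b k by apply: mule_ge0; rewrite ?lee_fin.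
rewrite !ge0_sume_distrr; [|by move=> k _; exact: ab0..].
rewrite (eq_bigr (fun k : 'I_n.+2 =>
    (k%:R * exp_coeff c (n.+1 - k)%N)%:E * b k +
    ((n.+1 - k)%:R * exp_coeff c (n.+1 - k)%N)%:E * b k)); last first.
  move=> k _; rewrite -ge0_muleDl; [|by rewrite lee_fin mulr_ge0..].
  by rewrite muleA -EFinM -EFinD -mulrDl -natrD subnKC// -ltnS.
rewrite big_split/=; congr +%E.
  rewrite big_ord_recl/= mul0r mul0e add0e; apply: eq_bigr => k _.
  by rewrite /bump/= add1n subSS muleA -EFinM mulrC.
rewrite big_ord_recr/= subnn mul0r mul0e adde0; apply: eq_bigr => k _.
by rewrite subSn -1?ltnS// aS EFinM muleA.
Qed.

(** Convolution with [fset_prod f] multiplies the generating series of the terms by $e^{cs}$. Both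
    sides obey the recursion of [convolution_exp_rec]: inserting a point differentiates, and
    [subset_sumU1] is the product rule. *)
Lemma lp_term_subset_sum n f H c : (forall x, 0 <= f x)%R -> (forall eta, 0 <= H eta)%R ->
  measurable_fun setT f -> measurable_fun setT H -> \int[mu]_x (f x)%:E = c%:E ->
  lp_term n (fun eta => (subset_sum f H eta)%:E) =
  \sum_(k < n.+1) (exp_coeff c (n - k)%N)%:E * lp_term k (fun eta => (H eta)%:E).
Proof.
move=> f0 + mf + fc.
have c0 : (0 <= c)%R.
  by rewrite -lee_fin -fc; apply: integral_ge0 => x _; rewrite lee_fin.
elim: n H => [|n IH] H H0 mH.
  rewrite big_ord1 /exp_coeff/= expr0 fact0 divr1 mul1e !lp_term0 ?subset_sum0//.
    exact/measurable_EFinP.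
  by apply/measurable_EFinP; exact: measurable_subset_sum.
have lp0 m (H' : {fset T} -> R) : (forall eta, 0 <= H' eta)%R -> 0 <= lp_term m (fun eta => (H' eta)%:E).
  by move=> H'0; apply: lp_term_ge0 => eta; rewrite lee_fin.
have SH0 eta : (0 <= subset_sum f H eta)%R by exact: subset_sum_ge0.
have SHx0 x eta : (0 <= subset_sum f (fun xi => H (x |` xi)%fset) eta)%R.
  exact: subset_sum_ge0.
have mSH : measurable_fun setT (fun eta => (subset_sum f H eta)%:E).
  by apply/measurable_EFinP; exact: measurable_subset_sum.
have jSHx : jointly_measurable (fun x eta => (subset_sum f (fun xi => H (x |` xi)%fset) eta)%:E).
  move=> m; apply/measurable_EFinP.
  apply: (jointly_measurable_subset_sum diagonal_measurable (f := fun _ : T => f)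
    (G := fun x xi => H (x |` xi)%fset)).
    exact: (measurableT_comp mf measurable_snd).
  exact: jm_insert.
have jfSH : jointly_measurable (fun x eta => (f x)%:E * (subset_sum f H eta)%:E).
  move=> m; apply: emeasurable_funM.
    by apply/measurable_EFinP; exact: jm_weight.
  exact: (measurableT_comp mSH (measurableT_comp (@measurable_fset_of_tuple _ T m) measurable_snd)).
apply: (@mulEFin_injl n.+1%:R) => //.
rewrite (@convolution_exp_rec c (fun k => lp_term k (fun eta => (H eta)%:E)) n)//;
  last by move=> k; exact: lp0.
rewrite lp_termS//.
rewrite (@eq_integral_lp_term _ _ _ mu diagonal_measurable mu_atomless n _
   (fun x eta => (subset_sum f (fun xi => H (x |` xi)%fset) eta)%:E +
     (f x)%:E * (subset_sum f H eta)%:E)); first last.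
- by move=> x eta xe; rewrite subset_sumU1// EFinD EFinM.
- by move=> m; apply: emeasurable_funD; [exact: jSHx|exact: jfSH].
- exact: (jm_insert mSH).
- by move=> x eta; rewrite -EFinM -EFinD lee_fin addr_ge0// mulr_ge0.
- by move=> x eta; rewrite lee_fin.
transitivity (\int[mu]_x (lp_term n (fun eta => (subset_sum f (fun xi => H (x |` xi)%fset) eta)%:E)
    + (f x)%:E * lp_term n (fun eta => (subset_sum f H eta)%:E))).
  apply: eq_integral => x _; rewrite lp_termD//.
  - by rewrite lp_termZ.
  - by move=> eta; rewrite lee_fin.
  - by move=> eta; rewrite -EFinM lee_fin mulr_ge0.
  - exact: (jointly_measurable_fun x jSHx).
  - exact: (jointly_measurable_fun x jfSH).
rewrite ge0_integralD//; first last.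
- apply: emeasurable_funM; first exact/measurable_EFinP.
  exact: measurable_cst.
- by move=> x _; apply: mule_ge0; [rewrite lee_fin|exact: lp0].
- by apply: measurable_lp_term => // x eta; rewrite lee_fin.
- by move=> x _; exact: lp0.
have mlp k : measurable_fun setT (fun x => lp_term k (fun eta => (H (x |` eta)%fset)%:E)).
  apply: (@measurable_lp_term_insert k (fun eta => (H eta)%:E)).
    by move=> eta; rewrite lee_fin.
  exact/measurable_EFinP.
congr +%E.
  transitivity (\int[mu]_x \sum_(k < n.+1) (exp_coeff c (n - k)%N)%:E *
      lp_term k (fun eta => (H (x |` eta)%fset)%:E)).
    by apply: eq_integral => x _; rewrite IH//; exact: m_insert.
  rewrite ge0_integral_sum//; first last.
  - move=> k x _; apply: mule_ge0; last exact: lp0.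
    by rewrite lee_fin exp_coeff_ge0.
  - by move=> k; apply: measurable_funeM.
  apply: eq_bigr => k _; rewrite ge0_integralZl//; first last.
  - by rewrite lee_fin exp_coeff_ge0.
  - by move=> x _; exact: lp0.
  apply: (congr1 (fun u => _ * u)); rewrite (@lp_termS k (fun eta => (H eta)%:E))//.
    exact/measurable_EFinP.
rewrite ge0_integralZr//; first last.
- exact: lp0.
- by move=> x _; rewrite lee_fin.
- exact/measurable_EFinP.
by rewrite fc IH.
Qed.

(** Exchanging the triangular sum leaves in front of each $b_k$ a partial sum of the exponential
    series. *)
Lemma lee_convolution_exp (c : R) (b : nat -> \bar R) N : (0 <= c)%R ->
  (forall k, 0 <= b k) ->
  \sum_(n < N) \sum_(k < n.+1) (exp_coeff c (n - k)%N)%:E * b k <=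
  (expR c)%:E * \sum_(k < N) b k.
Proof.
move=> c0 b0.
have -> : \sum_(n < N) \sum_(k < n.+1) (exp_coeff c (n - k)%N)%:E * b k =
    \sum_(k < N) (series (exp_coeff c) (N - k)%N)%:E * b k.
  elim: N => [|N IH]; first by rewrite !big_ord0.
  rewrite big_ord_recr/= IH [in X in _ + X]big_ord_recr/= subnn.
  rewrite [RHS]big_ord_recr/= subSnn addeA; congr +%E; last first.
    by rewrite /series/= big_nat1.
  rewrite -big_split/=; apply: eq_bigr => k _.
  rewrite subSn ?(ltnW (ltn_ord k))// seriesSr EFinD ge0_muleDl//.
    by rewrite lee_fin sumr_ge0// => i _; exact: exp_coeff_ge0.
  by rewrite lee_fin exp_coeff_ge0.
rewrite ge0_sume_distrr; last by move=> k _; exact: b0.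
apply: lee_sum => k _; apply: lee_wpmul2r => //; rewrite lee_fin.
rewrite /expR; apply: nondecreasing_cvgn_le; last exact: is_cvg_series_exp_coeff.
by apply: nondecreasing_series => i _ _; exact: exp_coeff_ge0.
Qed.

Lemma integral_subset_sum_le f H c : (forall x, 0 <= f x)%R -> (forall eta, 0 <= H eta)%R ->
  measurable_fun setT f -> measurable_fun setT H -> \int[mu]_x (f x)%:E = c%:E ->
  \int[LP]_eta (subset_sum f H eta)%:E <= (expR c)%:E * \int[LP]_eta (H eta)%:E.
Proof.
move=> f0 H0 mf mH fc.
have c0 : (0 <= c)%R.
  by rewrite -lee_fin -fc; apply: integral_ge0 => x _; rewrite lee_fin.
rewrite !integral_lebesgue_poisson//; first last.
- by apply/measurable_EFinP; exact: measurable_subset_sum.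
- by move=> eta; rewrite lee_fin; exact: subset_sum_ge0.
- exact/measurable_EFinP.
rewrite (eq_eseriesr (fun n _ => lp_term_subset_sum n f0 H0 mf mH fc)).
apply: lime_le.
  apply: is_cvg_nneseries => n _ _; apply: sume_ge0 => k _; apply: mule_ge0.
    by rewrite lee_fin exp_coeff_ge0.
  by apply: lp_term_ge0 => eta; rewrite lee_fin.
apply: nearW => N; rewrite big_mkord.
have b0 k : 0 <= lp_term k (fun eta => (H eta)%:E).
  by apply: lp_term_ge0 => eta; rewrite lee_fin.
apply: (le_trans (lee_convolution_exp N c0 b0)).
apply: lee_wpmul2l; first by rewrite lee_fin; exact: expR_ge0.
rewrite -(big_mkord xpredT (fun k => lp_term k _)).
by apply: nneseries_lim_ge => k _ _; exact: b0.
Qed.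

(** Each term of the series defining the measure is an image of a product measure, and Tonelli
    applies term by term. *)
Lemma integral_lebesgue_poisson_swap (F : T -> {fset T} -> \bar R) :
  (forall x eta, 0 <= F x eta) -> jointly_measurable F ->
  \int[LP]_eta \int[mu]_x F x eta = \int[mu]_x \int[LP]_eta F x eta.
Proof.
move=> F0 mF.
have mint : measurable_fun setT (fun eta => \int[mu]_x F x eta).
  apply: (@jointly_measurable_fun _ _ _ unit _ _ (fun _ eta => \int[mu]_x F x eta) tt).
  apply: (@jointly_measurable_integral _ _ R mu _ _ (fun p eta => F p.2 eta)) => //.
  exact: (jointly_measurable_comp measurable_snd mF).
rewrite integral_lebesgue_poisson//; last by move=> eta; exact: integral_ge0.
transitivity (\int[mu]_x \sum_(n <oo) lp_term n (F x)).
  rewrite integral_nneseries//; first last.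
  - by move=> n x _; exact: lp_term_ge0.
  - by move=> n; exact: measurable_lp_term.
  apply: eq_eseriesr => n _; rewrite /Submission.lp_term.
  rewrite ge0_integralZl//; first last.
  - by move=> x _; exact: integral_ge0.
  - exact: (@measurable_fun_fubini_tonelli_F _ _ _ _ _ (tuple_measure mu n)
      (fun p : T * n.-tuple T => F p.1 (fset_of_tuple p.2)) (mF n) (fun p => F0 _ _)).
  apply: (congr1 (fun u => _ * u)).
  by rewrite (fubini_tonelli (fun p : T * n.-tuple T => F p.1 (fset_of_tuple p.2)))//;
    exact: mF.
apply: eq_integral => x _; rewrite integral_lebesgue_poisson//.
exact: (jointly_measurable_fun x mF).
Qed.

Lemma integral_mecke w H : (forall x, 0 <= w x)%R -> (forall eta, 0 <= H eta)%R ->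
  measurable_fun setT w -> measurable_fun setT H ->
  \int[mu]_x ((w x)%:E * \int[LP]_eta (H (x |` eta)%fset)%:E) =
  \int[LP]_eta (fset_sum w eta * H eta)%:E.
Proof.
move=> w0 H0 mw mH.
have mEH : measurable_fun setT (fun eta => (H eta)%:E) by exact/measurable_EFinP.
have sw0 eta : (0 <= fset_sum w eta)%R by apply: sumr_ge0.
have mswH : measurable_fun setT (fun eta => (fset_sum w eta * H eta)%:E).
  by apply/measurable_EFinP; apply: measurable_funM => //; exact: measurable_fset_sum.
rewrite integral_lebesgue_poisson//; last by move=> eta; rewrite lee_fin mulr_ge0.
have lp0 m (H' : {fset T} -> R) : (forall eta, 0 <= H' eta)%R -> 0 <= lp_term m (fun eta => (H' eta)%:E).
  by move=> H'0; apply: lp_term_ge0 => eta; rewrite lee_fin.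
(* The empty configuration contributes nothing, since [fset_sum w] vanishes there; the remaining
   series matches [lp_term_mecke] after a shift of the index by one. *)
rewrite nneseries_recl//; last by move=> n _; apply: lp0 => eta; rewrite mulr_ge0.
rewrite lp_term0// fset_sum0 mul0r add0e.
transitivity (\int[mu]_x \sum_(n <oo) ((w x)%:E * lp_term n (fun eta => (H (x |` eta)%fset)%:E))).
  apply: eq_integral => x _; rewrite integral_lebesgue_poisson//; first last.
  - exact: (m_insert x mEH).
  - by move=> eta; rewrite lee_fin.
  by rewrite nneseriesZl// => n _; exact: lp0.
rewrite integral_nneseries//; first last.
- by move=> n x _; apply: mule_ge0; [rewrite lee_fin|exact: lp0].
- move=> n; apply: emeasurable_funM; first exact/measurable_EFinP.
  apply: (@measurable_lp_term_insert n (fun eta => (H eta)%:E)) => // eta.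
rewrite -(@nneseries_addn _ (fun n => lp_term n (fun eta => (fset_sum w eta * H eta)%:E)) 1).
  by apply: eq_eseriesr => n _; rewrite addn1 lp_term_mecke.
by move=> n; apply: lp0 => eta; rewrite mulr_ge0.
Qed.

End lebesgue_poisson_integral.

(** * The Lebesgue measure on row vectors *)

Section row_measure.
Context (R : realType).

Local Notation leb := (@lebesgue_measure R).

Lemma measurable_row_coord d (i : 'I_d) :
  measurable_fun setT (fun x : 'rV[R]_d => x ord0 i).
Proof.
have := measurableT_comp (@measurable_tnth _ R d i) (@measurable_tuple_of_row _ R d).
by apply: eq_measurable_fun => x _ /=; rewrite tnth_mktuple.
Qed.

Lemma measurable_fun_rowP dD (D : measurableType dD) d (f : D -> 'rV[R]_d) :
  (forall i, measurable_fun setT (fun x => f x ord0 i)) -> measurable_fun setT f.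
Proof.
move=> mf.
have mt : measurable_fun setT (fun x => [tuple f x ord0 i | i < d]).
  apply/measurable_fun_tnthP => i; move: (mf i).
  by apply: eq_measurable_fun => x _ /=; rewrite tnth_mktuple.
have := measurableT_comp (@measurable_row_of_tuple _ R d) mt.
by apply: eq_measurable_fun => x _ /=; apply/rowP => i; rewrite !mxE tnth_mktuple.
Qed.

Lemma measurable_row_diagonal d : measurable [set p : 'rV[R]_d * 'rV[R]_d | p.1 = p.2].
Proof.
rewrite (_ : [set _ | _] = \bigcap_(i in [set: 'I_d])
    [set p : 'rV[R]_d * 'rV[R]_d | p.1 ord0 i == p.2 ord0 i]); last first.
  apply/seteqP; split => -[x y] /=; first by move=> -> i _ /=.
  by move=> xy; apply/rowP => i; apply/eqP; exact: (xy i).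
apply: fin_bigcap_measurable => // i _.
have m1 := measurableT_comp (measurable_row_coord i) (@measurable_fst _ _ 'rV[R]_d 'rV[R]_d).
have m2 := measurableT_comp (measurable_row_coord i) (@measurable_snd _ _ 'rV[R]_d 'rV[R]_d).
have := measurable_fun_eqr m1 m2 measurableT (Y := [set true]) (ltac:(by [])).
by rewrite setTI.
Qed.

Lemma measurable_tuple_set1 n (t : n.-tuple R) : measurable [set t].
Proof.
rewrite (_ : [set t] = \bigcap_(i in [set: 'I_n])
    ((fun s : n.-tuple R => tnth s i) @^-1` [set tnth t i])); last first.
  apply/seteqP; split => s /=; first by move=> -> i _.
  by move=> st; apply: eq_from_tnth => i; exact: (st i).
apply: fin_bigcap_measurable => // i _; rewrite -[X in measurable X]setTI.
exact: measurable_tnth.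
Qed.

Lemma tuple_measure_set1 n (t : n.+1.-tuple R) :
  tuple_measure leb n.+1 [set t] = 0%E.
Proof.
rewrite /= /tuple_measureS /= /image_measure /pushforward.
rewrite (_ : _ @^-1` _ = [set thead t] `*` [set (uncons_tuple t).2]); last first.
  apply/seteqP; split => -[x s] /=.
    by move=> <-; split => //; exact/val_inj.
  by move=> [-> ->]; rewrite [RHS](cons_tupleP t).
rewrite /sigma_finite_product product_measure1E//; last exact: measurable_tuple_set1.
by rewrite [X in (X * _)%E](lebesgue_measure_set1 (thead t)) mul0e.
Qed.

Lemma lebesgue_measure_translation (c : R) (A : set R) : measurable A ->
  pushforward (@lebesgue_measure R) ((fun x => x + c) : _ -> measurableTypeR R) A =
  lebesgue_measure A.
Proof.
have mc : measurable_fun setT ((fun x => x + c) : R -> measurableTypeR R).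
  by apply: measurable_funD.
move=> mA; apply/esym.
apply: (@lebesgue_measure_unique _
  (measure_function_pushforward__canonical__measure_function_Measure
    (@lebesgue_measure R) mc)) => //= _ [[a b]] _ <-.
rewrite /pushforward (_ : _ @^-1` _ = [set` `]a - c, b - c]]); last first.
  by apply/seteqP; split => x /=; rewrite !in_itv/= ltrBlDr lerBrDr.
rewrite !lebesgue_measure_itv/= !lte_fin ltrD2r.
by case: ifP => // _; rewrite -!EFinB opprB addrA subrK.
Qed.

Lemma ge0_integral_translation (c : R) (f : R -> \bar R) :
  measurable_fun setT f -> (forall x, 0 <= f x)%E ->
  (\int[leb]_x f (x + c)%R = \int[leb]_x f x)%E.
Proof.
move=> mf f0.
have mc : measurable_fun setT ((fun x => x + c) : R -> measurableTypeR R).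
  by apply: measurable_funD.
have := @ge0_integral_pushforward _ _ (measurableTypeR R) (measurableTypeR R) R _ mc leb setT f measurableT mf (fun x _ => f0 x).
rewrite preimage_setT => <-; apply: eq_measure_integral => A mA _.
exact: lebesgue_measure_translation.
Qed.

(** The shift is a sequence indexed by nat, not by the positions of the tuple: in the induction of
    [ge0_integral_tuple_shift], dropping the head of the tuple only shifts the sequence. *)
Definition tuple_shift n (a : nat -> R) (t : n.-tuple R) : n.-tuple R :=
  [tuple tnth t i + a i | i < n].

Lemma measurable_tuple_shift n a : measurable_fun setT (@tuple_shift n a).
Proof.
apply/measurable_fun_tnthP => i.
rewrite (_ : _ \o _ = (fun t : n.-tuple R => tnth t i + a i)); last first.
  by apply/funext => t /=; rewrite tnth_mktuple.
by apply: measurable_funD => //; exact: measurable_tnth.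
Qed.

Lemma tuple_shift_cons n a (x : R) (s : n.-tuple R) :
  tuple_shift a (@Defs.cons_tuple _ R n (x, s)) =
  Defs.cons_tuple (x + a 0%N, tuple_shift (fun i => a i.+1) s).
Proof.
apply: eq_from_tnth => i; rewrite tnth_mktuple.
by case: (unliftP ord0 i) => [j|] ->; rewrite ?tnth0// !tnthS/= tnth_mktuple.
Qed.

Lemma ge0_integral_tuple_shift n a (f : n.-tuple R -> \bar R) :
  measurable_fun setT f -> (forall x, 0 <= f x)%E ->
  (\int[tuple_measure leb n]_t f (tuple_shift a t) =
   \int[tuple_measure leb n]_t f t)%E.
Proof.
elim: n a f => [|n IH] a f mf f0.
  by congr integral; apply/funext => t; congr f; rewrite (tuple0 t) tuple0.
have mfs : measurable_fun setT (fun t => f (tuple_shift a t)).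
  exact: (measurableT_comp mf (measurable_tuple_shift a)).
rewrite !ge0_integral_tuple_measureS//.
have mfc : measurable_fun setT (fun p : R * n.-tuple R => f (Defs.cons_tuple p)).
  exact: (measurableT_comp mf (@measurable_cons_tuple _ R n)).
have mfx x : measurable_fun setT (fun s : n.-tuple R => f (Defs.cons_tuple (x, s))).
  exact: (measurableT_comp mfc (pair1_measurable x)).
pose g x := (\int[tuple_measure leb n]_s f (Defs.cons_tuple (x, s)))%E.
transitivity (\int[leb]_x g (x + a 0%N)%R)%E.
  apply: eq_integral => x _; rewrite /g -[RHS](IH (fun i => a i.+1))//; last exact: mfx.
  by apply: eq_integral => s _; rewrite tuple_shift_cons.
apply: (@ge0_integral_translation (a 0%N) g).
  exact: (@measurable_fun_fubini_tonelli_F _ _ _ _ _ (tuple_measure leb n)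
    (fun p : R * n.-tuple R => f (Defs.cons_tuple p)) mfc (fun p => f0 _)).
by move=> x; exact: integral_ge0.
Qed.

Lemma ge0_integral_row d (f : 'rV[R]_d -> \bar R) :
  measurable_fun setT f -> (forall x, 0 <= f x)%E ->
  (\int[lebesgue_measure_row R d]_x f x =
   \int[tuple_measure leb d]_t f (row_of_tuple t))%E.
Proof.
move=> mf f0.
have := @ge0_integral_pushforward _ _ (d.-tuple (measurableTypeR R)) 'rV[R]_d R
  (@row_of_tuple _ R d) (@measurable_row_of_tuple _ R d)
  (tuple_measure leb d) setT f measurableT mf (fun x _ => f0 x).
by rewrite preimage_setT.
Qed.

Lemma ge0_integral_row_shift d (a : 'rV[R]_d) (f : 'rV[R]_d -> \bar R) :
  measurable_fun setT f -> (forall x, 0 <= f x)%E ->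
  (\int[lebesgue_measure_row R d]_x f (x + a)%R = \int[lebesgue_measure_row R d]_x f x)%E.
Proof.
move=> mf f0.
have mD : measurable_fun setT (fun x : 'rV[R]_d => x + a).
  apply: measurable_fun_rowP => i; under eq_fun do rewrite mxE.
  by apply: measurable_funD => //; exact: measurable_row_coord.
rewrite !ge0_integral_row//; last exact: (measurableT_comp mf mD).
pose b (i : nat) := if insub i is Some j then a ord0 j else 0.
rewrite -(@ge0_integral_tuple_shift d b (f \o @row_of_tuple _ R d))//; first last.
- by move=> x; exact: f0.
- exact: (measurableT_comp mf (@measurable_row_of_tuple _ R d)).
apply: eq_integral => t _ /=; congr f; apply/rowP => i; rewrite !mxE tnth_mktuple.
by rewrite /b valK.
Qed.

(** For d = 0 the measure is a Dirac mass at the only row; positivity of d makes it atomless, so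
    that coincidences of points are negligible. *)
Lemma lebesgue_measure_row_set1 d (x : 'rV[R]_d) : (0 < d)%N ->
  lebesgue_measure_row R d [set x] = 0%E.
Proof.
case: d x => // d x _.
rewrite -[RHS](tuple_measure_set1 (tuple_of_row x)).
rewrite /lebesgue_measure_row /= /image_measure /pushforward; congr (_ _).
apply/seteqP; split => t /= => [<-|->]; first by rewrite row_of_tupleK.
by apply/rowP => i; rewrite mxE tnth_mktuple.
Qed.

End row_measure.

(** * Distance to a convex cone along a semigroup *)

Section distance_to_cone.
Context (R : realType) (X : Type).
Variables (S : set (X -> R)) (N : (X -> R) -> R) (P : set (X -> R)).
Hypothesis S_lin : forall a f g, S f -> S g -> S (fun x => a * f x + g x).
Hypothesis N_ge0 : forall f, S f -> 0 <= N f.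
Hypothesis N_triangle : forall f g, S f -> S g ->
  N (fun x => f x + g x) <= N f + N g.
Hypothesis N_scale : forall a f, S f -> N (fun x => a * f x) = `|a| * N f.
Hypothesis PS : P `<=` S.
Hypothesis P0 : P (fun=> 0).
Hypothesis P_add : forall f g, P f -> P g -> P (fun x => f x + g x).
Hypothesis P_scale : forall a f, 0 <= a -> P f -> P (fun x => a * f x).
Implicit Types (f g u v : X -> R).

Let S0 : S (fun=> 0). Proof. exact: PS. Qed.

Let S_scale a f : S f -> S (fun x => a * f x).
Proof.
move=> Sf; have := S_lin a Sf S0.
by rewrite (_ : (fun x => _ + 0) = (fun x => a * f x))//; apply/funext => x; rewrite addr0.
Qed.

Let S_add f g : S f -> S g -> S (fun x => f x + g x).
Proof.
move=> Sf Sg; have := S_lin 1 Sf Sg.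
by rewrite (_ : (fun x => 1 * f x + _) = (fun x => f x + g x))//; apply/funext => x; rewrite mul1r.
Qed.

Let S_sub f g : S f -> S g -> S (fun x => f x - g x).
Proof.
move=> Sf Sg; have := S_lin (-1) Sg Sf.
by rewrite (_ : (fun x => -1 * g x + _) = (fun x => f x - g x))//; apply/funext => x; rewrite mulN1r addrC.
Qed.

Definition cone_dist f : R := inf [set N (fun x => f x - g x) | g in P].

Let has_inf_dist f : S f -> has_inf [set N (fun x => f x - g x) | g in P].
Proof.
move=> Sf; split; first by exists (N (fun x => f x - 0)), (fun=> 0).
by exists 0 => _ [g Pg <-]; apply: N_ge0; apply: S_sub => //; exact: PS.
Qed.

Lemma cone_dist_le f g : S f -> P g -> cone_dist f <= N (fun x => f x - g x).
Proof.
move=> Sf Pg; apply: ge_inf; first by have [] := has_inf_dist Sf.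
by exists g.
Qed.

Lemma cone_dist_lt f e : S f -> 0 < e ->
  exists2 g, P g & N (fun x => f x - g x) < cone_dist f + e.
Proof.
move=> Sf e0; have [_ [g Pg <-] lt] := inf_adherent e0 (has_inf_dist Sf).
by exists g.
Qed.

Lemma cone_dist_leP f r : S f ->
  (forall e, 0 < e -> exists2 g, P g & N (fun x => f x - g x) <= r + e) ->
  cone_dist f <= r.
Proof.
move=> Sf H; apply/ler_addgt0Pr => e e0; have [g Pg] := H e e0.
exact/le_trans/cone_dist_le.
Qed.

Lemma cone_dist_lipschitz f f' : S f -> S f' ->
  cone_dist f <= cone_dist f' + N (fun x => f x - f' x).
Proof.
move=> Sf Sf'; apply: cone_dist_leP => // e e0.
have [g Pg gf'] := cone_dist_lt Sf' e0; exists g => //.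
rewrite (_ : (fun x => f x - g x) = (fun x => (f x - f' x) + (f' x - g x))).
  apply: (le_trans (N_triangle _ _)); [exact: S_sub|by apply: S_sub => //; exact: PS|lra].
by apply/funext => x; ring.
Qed.

Lemma cone_distD f f' : S f -> S f' ->
  cone_dist (fun x => f x + f' x) <= cone_dist f + cone_dist f'.
Proof.
move=> Sf Sf'; apply: cone_dist_leP; first exact: S_add.
move=> e e0; have e20 : 0 < e / 2 by rewrite divr_gt0.
have [g Pg gf] := cone_dist_lt Sf e20; have [g' Pg' gf'] := cone_dist_lt Sf' e20.
exists (fun x => g x + g' x); first exact: P_add.
rewrite (_ : (fun x => _) = (fun x => (f x - g x) + (f' x - g' x))).
  apply: (le_trans (N_triangle _ _)); [by apply: S_sub => //; exact: PS..|lra].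
by apply/funext => x; ring.
Qed.

Lemma cone_distZ a f : 0 < a -> S f -> cone_dist (fun x => a * f x) <= a * cone_dist f.
Proof.
move=> a0 Sf; apply: cone_dist_leP; first exact: S_scale.
move=> e e0; have ea0 : 0 < e / a by rewrite divr_gt0.
have [g Pg gf] := cone_dist_lt Sf ea0.
exists (fun x => a * g x); first by apply: P_scale => //; exact: ltW.
rewrite (_ : (fun x => _) = (fun x => a * (f x - g x))); last first.
  by apply/funext => x; ring.
rewrite N_scale; last by apply: S_sub => //; exact: PS.
rewrite gtr0_norm// (le_trans (ler_wpM2l (ltW a0) (ltW gf)))//.
by rewrite mulrDr mulrCA divff ?gt_eqF// mulr1.
Qed.

(** Contractivity is required only between a point of S and a point of the cone, the only
    differences that [cone_dist] sees. *)
Definition cone_contraction (V : (X -> R) -> X -> R) :=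
  [/\ forall u, S u -> S (V u), forall g, P g -> P (V g) &
    forall u g, S u -> P g ->
      N (fun x => V u x - V g x) <= N (fun x => u x - g x)].

Lemma cone_dist_contraction V u : cone_contraction V -> S u ->
  cone_dist (V u) <= cone_dist u.
Proof.
move=> [VS VP VN] Su; apply: cone_dist_leP; first exact: VS.
move=> e e0; have [g Pg gu] := cone_dist_lt Su e0.
exists (V g); first exact: VP.
exact/(le_trans (VN _ _ Su Pg))/ltW.
Qed.

(* A contraction preserving the cone does not increase the distance to it, so
   [(V - 1) / delta] is dissipative with respect to this distance. *)
Lemma cone_dist_dissipative V u delta h : cone_contraction V -> S u ->
  0 < delta -> 0 < h ->
  cone_dist u <= cone_dist (fun x => u x - h * (delta^-1 * (V u x - u x))).
Proof.
move=> Vc Su d0 h0; have [VS _ _] := Vc.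
set w := (fun x => u x - _); pose a := h / delta.
have a0 : 0 < a by rewrite divr_gt0.
have Sw : S w.
  apply: S_sub => //; apply: S_scale; apply: S_scale; apply: S_sub => //; exact: VS.
(* With a = h / delta, w = (1 + a) u - a V u, so u is the convex combination of w and V u with
   weights 1 / (1 + a) and a / (1 + a). *)
have E : u = (fun x => (1 + a)^-1 * (w x + a * V u x)).
  apply/funext => x; rewrite /w /a; field.
  by apply/andP; split; rewrite gt_eqF// addr_gt0.
have a10 : 0 < (1 + a)^-1 by rewrite invr_gt0 addr_gt0.
have SVu : S (V u) by exact: VS.
have := cone_distZ a10 (S_add Sw (S_scale a SVu)); rewrite -E => H1.
have := cone_distD Sw (S_scale a SVu) => H2.
have := cone_distZ a0 SVu => H3.
have H4 := cone_dist_contraction Vc Su.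
have : cone_dist u <= (1 + a)^-1 * (cone_dist w + a * cone_dist u).
  apply: (le_trans H1); rewrite ler_wpM2l ?(ltW a10)//; apply: (le_trans H2).
  by rewrite lerD2l (le_trans H3)// ler_wpM2l// ltW.
by rewrite mulrC ler_pdivlMr ?addr_gt0//; lra.
Qed.

Lemma cone_dist_dissipative_lim u v h : S u -> S v -> 0 < h ->
  (forall e, 0 < e -> exists V delta, [/\ cone_contraction V, 0 < delta &
    N (fun x => delta^-1 * (V u x - u x) - v x) <= e]) ->
  cone_dist u <= cone_dist (fun x => u x - h * v x).
Proof.
move=> Su Sv h0 H; apply/ler_addgt0Pr => e e0.
have [V [delta [Vc d0 VN]]] := H _ (divr_gt0 e0 h0).
apply: (le_trans (cone_dist_dissipative Vc Su d0 h0)).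
have [VS _ _] := Vc.
have SA : S (fun x => delta^-1 * (V u x - u x)).
  by apply: S_scale; apply: S_sub => //; exact: VS.
apply: (le_trans (cone_dist_lipschitz (f' := fun x => u x - h * v x) _ _)).
- by apply: S_sub => //; exact: S_scale.
- by apply: S_sub => //; exact: S_scale.
rewrite lerD2l (_ : (fun x => _) =
    (fun x => - h * (delta^-1 * (V u x - u x) - v x))); last first.
  by apply/funext => x; ring.
rewrite N_scale; last exact: S_sub.
by rewrite normrN gtr0_norm// mulrC -ler_pdivlMr.
Qed.

Lemma cone_dist_dissipative_closure u v h : S u -> S v -> 0 < h ->
  (forall e, 0 < e -> exists u' v', [/\ S u', S v',
     cone_dist u' <= cone_dist (fun x => u' x - h * v' x),
     N (fun x => u' x - u x) <= e & N (fun x => v' x - v x) <= e]) ->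
  cone_dist u <= cone_dist (fun x => u x - h * v x).
Proof.
move=> Su Sv h0 H; apply/ler_addgt0Pr => e e0.
(* The error in u enters twice, through the distances on both sides, and the error in v once with
   the factor h; hence the precision e / (2 + h). *)
have h20 : 0 < 2 + h by lra.
have [u' [v' [Su' Sv' uv' Nu Nv]]] := H _ (divr_gt0 e0 h20).
have L1 := cone_dist_lipschitz Su Su'.
have Suv' : S (fun x => u' x - h * v' x) by apply: S_sub => //; exact: S_scale.
have Suv : S (fun x => u x - h * v x) by apply: S_sub => //; exact: S_scale.
have L2 := cone_dist_lipschitz Suv' Suv.
have E1 : N (fun x => u x - u' x) = N (fun x => u' x - u x).
  rewrite -[RHS]mul1r -[X in X * _](normr1 R) -normrN -N_scale; last exact: S_sub.
  by congr N; apply/funext => x; ring.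
have L3 : N (fun x => u' x - h * v' x - (u x - h * v x)) <=
    N (fun x => u' x - u x) + h * N (fun x => v' x - v x).
  have -> : h * N (fun x => v' x - v x) = N (fun x => - h * (v' x - v x)).
    by rewrite N_scale ?normrN ?gtr0_norm//; exact: S_sub.
  rewrite (_ : (fun x => u' x - h * v' x - (u x - h * v x)) =
    (fun x => (u' x - u x) + - h * (v' x - v x))); last first.
    by apply/funext => x; ring.
  by apply: N_triangle; [exact: S_sub|apply: S_scale; exact: S_sub].
rewrite E1 in L1.
have L4 : h * N (fun x => v' x - v x) <= h * (e / (2 + h)) by rewrite ler_wpM2l// ltW.
have -> : e = (e / (2 + h)) + ((e / (2 + h)) + h * (e / (2 + h))) by field; rewrite gt_eqF.
lra.
Qed.

(** Implicit Euler: dissipativity at time s + h bounds the distance of T (s + h) by that of T (s +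
    h) - h A (s + h), which is close to T s up to e h, uniformly in s. Over n steps of length t / n
    the errors add up to e t. An explicit step would use dissipativity in the wrong direction. *)
Lemma cone_dist_flow (T : R -> X -> R) (A : R -> X -> R) :
  (forall t, 0 <= t -> S (T t)) -> (forall t, 0 <= t -> S (A t)) ->
  (forall t h, 0 <= t -> 0 < h ->
    cone_dist (T t) <= cone_dist (fun x => T t x - h * A t x)) ->
  (forall e, 0 < e -> exists2 h0, 0 < h0 & forall h s, 0 < h < h0 -> 0 <= s ->
    N (fun x => T (s + h) x - h * A (s + h) x - T s x) <= e * h) ->
  forall t, 0 <= t -> cone_dist (T t) <= cone_dist (T 0).
Proof.
move=> ST SA diss small t; rewrite le_eqVlt => /predU1P[<-//|t0].
apply/ler_addgt0Pr => e e0.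
have [h0 h00 Hh] := small _ (divr_gt0 e0 t0).
pose n := (Num.truncn (t / h0)).+1; pose h := t / n%:R.
have n0 : (0 : R) < n%:R by rewrite ltr0n.
have hh0 : 0 < h < h0.
  rewrite divr_gt0//= ltr_pdivrMr// mulrC -ltr_pdivrMr//.
  exact: truncnS_gt.
have [hgt0 _] := andP hh0.
have step k : cone_dist (T (k%:R * h)) <= cone_dist (T 0) + k%:R * (e / t * h).
  elim: k => [|k IH]; first by rewrite !mul0r addr0.
  have k0 : 0 <= k%:R * h by rewrite mulr_ge0// ltW.
  have E : k.+1%:R * h = k%:R * h + h by rewrite -natr1 mulrDl mul1r.
  have k1 : 0 <= k%:R * h + h by rewrite addr_ge0// ltW.
  rewrite E; apply: (le_trans (diss _ _ k1 hgt0)).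
  have Sd : S (fun x => T (k%:R * h + h) x - h * A (k%:R * h + h) x).
    by apply: S_sub; [exact: ST|apply: S_scale; exact: SA].
  have := cone_dist_lipschitz Sd (ST _ k0).
  have := Hh _ _ hh0 k0.
  rewrite -natr1 mulrDl mul1r; lra.
have := step n; rewrite /h mulrCA mulfV ?gt_eqF// mulr1.
by rewrite (_ : n%:R * (e / t * (t / n%:R)) = e)//; field; rewrite !gt_eqF.
Qed.

End distance_to_cone.

(** * The dual of L^1 *)

Section positive_integrable.
Context d (T : measurableType d) (R : realType).
Variable mu : {sigma_finite_measure set T -> \bar R}.
Local Open Scope ereal_scope.

Lemma exists_positive_integrable : exists f : T -> R,
  [/\ measurable_fun setT f, forall x, (0 < f x)%R &
      \int[mu]_x (f x)%:E < +oo].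
Proof.
have [F FT mF] := sigma_finiteT mu.
(* The powers of 2 and the normalisation by 1 + mu (F n) make both the sum of the c n and the sum of
   the c n mu (F n) at most 1: the first gives pointwise finiteness of g, the second its
   integrability. *)
pose c n : R := (1 / (2 ^ n.+1)%:R / (1 + fine (mu (F n))))%R.
have muF0 n : (0 <= fine (mu (F n)))%R by apply: fine_ge0.
have c0 n : (0 < c n)%R by rewrite /c !divr_gt0// ?ltr_pwDl// ltr0n expn_gt0.
have c1 n : (c n <= 1 / (2 ^ n.+1)%:R)%R.
  by rewrite /c ler_pdivrMr ?ltr_pwDl// ler_peMr ?divr_ge0// lerDl.
pose g x := \sum_(n <oo) (c n * \1_(F n) x)%:E.
have t0 n x : 0 <= (c n * \1_(F n) x)%:E by rewrite lee_fin mulr_ge0// ltW.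
have mt n : measurable_fun setT (fun x => (c n * \1_(F n) x)%:E).
  apply/measurable_EFinP; apply: measurable_funM => //.
  by apply: measurable_indic; have [] := mF n.
have mg : measurable_fun setT g by apply: ge0_emeasurable_sum => // n x _ _; exact: t0.
have gle x : g x <= 1.
  apply: (le_trans _ (@epsilon_trick0 R 1 xpredT ler01)).
  apply: lee_nneseries => n _; first by [].
  rewrite lee_fin -[leRHS]mulr1; apply: ler_pM => //; exact: ltW.
have g0 x : 0 < g x.
  have : setT x by []. rewrite FT => -[n _ Fnx].
  rewrite /g (@nneseriesD1 _ _ n xpredT)//.
  apply: (@lt_le_trans _ _ (c n * \1_(F n) x)%:E).
    by rewrite lte_fin indicE mem_set//= mulr1.
  by rewrite leeDl// nneseries_ge0.
have gfin x : g x \is a fin_num.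
  by rewrite ge0_fin_numE ?ltW// (le_lt_trans (gle x))// ltey.
exists (fine \o g); split => /=.
- exact: measurableT_comp.
- by move=> x; apply: fine_gt0; rewrite g0 (le_lt_trans (gle x))// ltey.
- under eq_integral do rewrite fineK//.
  rewrite integral_nneseries//.
  apply: (@le_lt_trans _ _ 1); last exact: ltey.
  apply: (le_trans _ (@epsilon_trick0 R 1 xpredT ler01)).
  apply: lee_nneseries => [n _ _|n _]; first by apply: integral_ge0.
  rewrite (_ : (fun x => _) = (fun x => (c n)%:E * (\1_(F n) x)%:E))//.
  have [mFn Fnoo] := mF n.
  rewrite ge0_integralZl//; last by rewrite lee_fin ltW.
  + rewrite integral_indic// setIT.
    rewrite -[X in _ * X]fineK ?ge0_fin_numE// -EFinM lee_fin /c.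
    by rewrite mulrAC ler_pdivrMr ?ltr_pwDl// ler_wpM2l ?divr_ge0// lerDr.
  + by apply/measurable_EFinP; exact: measurable_indic.
Qed.

End positive_integrable.

Section essential_bound.
Context d (T : measurableType d) (R : realType).
Variable mu : {measure set T -> \bar R}.
Local Open Scope ereal_scope.

(** Tested on A = {g < f}: the integral over A of the positive function f - g is at most 0, so A is
    null. *)
Lemma ae_le_of_integral_le (f g : T -> R) :
  mu.-integrable setT (EFin \o f) -> mu.-integrable setT (EFin \o g) ->
  (forall A, measurable A -> \int[mu]_(x in A) (f x)%:E <= \int[mu]_(x in A) (g x)%:E) ->
  \forall x \ae mu, (f x <= g x)%R.
Proof.
move=> fi gi fg.
have mf : measurable_fun setT f by apply/measurable_EFinP; exact: measurable_int fi.
have mg : measurable_fun setT g by apply/measurable_EFinP; exact: measurable_int gi.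
pose A := [set x | (g x < f x)%R].
have mA : measurable A.
  have := measurable_fun_ltr mg mf measurableT (Y := [set true]) (ltac:(by [])).
  by rewrite setTI.
have fiA := integrableS measurableT mA (@subsetT _ A) fi.
have giA := integrableS measurableT mA (@subsetT _ A) gi.
have h0 : \int[mu]_(x in A) `|(f x - g x)%:E| = 0.
  have E : \int[mu]_(x in A) `|(f x - g x)%:E| = \int[mu]_(x in A) ((f x)%:E - (g x)%:E).
    apply: eq_integral => x; rewrite inE => /= Ax; rewrite ger0_norm ?EFinB//.
    by rewrite subr_ge0 ltW.
  apply/eqP; rewrite eq_le integral_ge0// andbT E integralB//.
  rewrite leeBlDr ?add0e; first exact: fg.
  exact: (integrable_fin_num mA giA).
have mfg : measurable_fun A (fun x => (f x - g x)%:E).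
  apply/measurable_EFinP; apply: measurable_funB; exact: measurable_funTS.
have [N [mN N0 AN]] := (ae_eq_integral_abs mu mA mfg).1 h0.
exists N; split => // x /= /negP; rewrite -ltNge => gf; apply: AN => /=.
apply/not_implyP; split => //; case => /eqP; rewrite subr_eq0 => /eqP E.
by rewrite E ltxx in gf.
Qed.

End essential_bound.

Lemma measurable_fun_div_pos d (T : measurableType d) (R : realType) (f g : T -> R) :
  measurable_fun setT f -> measurable_fun setT g -> (forall x, 0 < g x) ->
  measurable_fun setT (fun x => f x / g x).
Proof.
move=> mf mg g0; rewrite (_ : (fun x => _) = (fun x => f x * expR (- ln (g x)))).
  apply: measurable_funM => //; apply: measurableT_comp; first exact: measurable_expR.
  apply: measurable_funN; apply: measurableT_comp => //; exact: measurable_ln.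
by apply/funext => x; rewrite expRN lnK ?posrE.
Qed.

(** * Representation of bounded functionals on L^1 by bounded functions *)

Section riesz.
Import HBNNSimple.
Context d (T : measurableType d) (R : realType).
Variable mu : {sigma_finite_measure set T -> \bar R}.
Local Open Scope ereal_scope.

Local Notation L1 := (fun g : T -> R => mu.-integrable setT (EFin \o g)).
Implicit Types (f g : T -> R) (A : set T).

Variables (phi : (T -> R) -> R) (M : R).
Hypothesis M0 : (0 <= M)%R.
Hypothesis phi_lin : forall a f g, L1 f -> L1 g ->
  phi (fun x => a * f x + g x)%R = (a * phi f + phi g)%R.
Hypothesis phi_bound : forall g, L1 g ->
  (`|phi g|)%:E <= M%:E * \int[mu]_x (`|g x|)%:E.
Variable w : T -> R.
Hypotheses (mw : measurable_fun setT w) (w0 : forall x, (0 < w x)%R)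
  (wi : \int[mu]_x (w x)%:E < +oo).

Let L10 : L1 (fun=> 0%R). Proof. exact: integrable0. Qed.

Let phi0 : phi (fun=> 0%R) = 0%R.
Proof.
have := phi_bound L10; rewrite integral0_eq ?mule0; last by move=> x _; rewrite normr0.
by rewrite lee_fin normr_le0 => /eqP.
Qed.

(** An indicator need not be integrable for a sigma-finite measure; multiplied by the positive
    integrable w it is, and phi yields a finite charge to which Radon-Nikodym applies. *)
Definition weighted_charge A : \bar R := (phi (fun x => w x * \1_A x)%R)%:E.

Let mwA A : measurable A -> measurable_fun setT (fun x => w x * \1_A x)%R.
Proof. by move=> mA; apply: measurable_funM => //; exact: measurable_indic. Qed.

Let wA_int A : \int[mu]_x (w x * \1_A x)%:E = \int[mu]_(x in A) (w x)%:E.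
Proof.
rewrite [RHS]integral_mkcond; apply: eq_integral => x _.
by rewrite patchE indicE; case: ifP => _; rewrite ?mulr1 ?mulr0.
Qed.

Let L1w A : measurable A -> L1 (fun x => w x * \1_A x)%R.
Proof.
move=> mA; apply/integrableP; split; first by apply/measurable_EFinP; exact: mwA.
apply: le_lt_trans wi; apply: ge0_le_integral => //=.
- by apply/measurable_EFinP; apply: measurableT_comp => //; exact: mwA.
- exact/measurable_EFinP.
- move=> x _; rewrite lee_fin ger0_norm; last by rewrite mulr_ge0// ltW.
  by rewrite ler_piMr ?(ltW (w0 x))// indicE; case: (_ \in _).
Qed.

Let phi_bound_w A : measurable A ->
  `|weighted_charge A| <= M%:E * \int[mu]_(x in A) (w x)%:E.
Proof.
move=> mA; apply: (le_trans (phi_bound (L1w mA))).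
rewrite lee_wpmul2l ?lee_fin// -wA_int le_eqVlt; apply/orP; left; apply/eqP.
by apply: eq_integral => x _; rewrite ger0_norm// mulr_ge0// ltW.
Qed.

Let charge0 : weighted_charge set0 = 0.
Proof.
rewrite /weighted_charge -[RHS]/(0%R%:E) -phi0; congr (phi _)%:E.
by apply/funext => x; rewrite indic0 mulr0.
Qed.

Let charge_fin A : measurable A -> weighted_charge A \is a fin_num.
Proof. by []. Qed.

Let chargeU A B : measurable A -> measurable B -> [disjoint A & B] ->
  weighted_charge (A `|` B) = weighted_charge A + weighted_charge B.
Proof.
move=> mA mB /disj_setPS AB; rewrite /weighted_charge -EFinD; congr EFin.
rewrite -[X in (X + _)%R]mul1r -phi_lin; [|exact: L1w..].
congr phi; apply/funext => x; rewrite !indicE in_setU.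
have [xA|xA] := boolP (x \in A); have [xB|xB] := boolP (x \in B); rewrite /= ?mulr1 ?mulr0 ?addr0 ?add0r ?mul1r//.
by have : set0 x by apply: AB; split; exact: set_mem.
Qed.

Let wi1 : L1 w.
Proof.
apply/integrableP; split; first exact/measurable_EFinP.
by under eq_integral do rewrite /= ger0_norm ?(ltW (w0 _))//.
Qed.

Let L1w_cvg0 (F : (set T)^nat) : (forall n, measurable (F n)) ->
  (forall x, \forall n \near \oo, ~ F n x) ->
  \int[mu]_(x in F n) (w x)%:E @[n --> \oo] --> 0.
Proof.
move=> mF F0.
have h1 n : measurable_fun setT (fun x => (w x * \1_(F n) x)%:E).
  by apply/measurable_EFinP; exact: mwA.
have h2 : {ae mu, forall x, setT x -> (w x * \1_(F n) x)%:E @[n --> \oo] --> 0}.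
  apply: aeW => x _; apply: cvg_near_cst; near=> n.
  by rewrite indicE memNset ?mulr0//; near: n; exact: F0.
have h3 : {ae mu, forall x n, setT x -> `|(w x * \1_(F n) x)%:E| <= (w x)%:E}.
  apply: aeW => x n _; rewrite lee_fin ger0_norm; last by rewrite mulr_ge0// ltW.
  by rewrite ler_piMr ?(ltW (w0 x))// indicE; case: (_ \in _).
have [_ _] := dominated_convergence measurableT h1 (@measurable_cst _ _ _ _ _ 0) h2 wi1 h3.
by rewrite integral0; under eq_fun do rewrite wA_int.
Unshelve. all: by end_near. Qed.

Let charge_sigma_additive : semi_sigma_additive weighted_charge.
Proof.
move=> F mF tF mUF.
pose tail n := \bigcup_(i in [set i | (n <= i)%N]) F i.
have mtail n : measurable (tail n) by apply: bigcup_measurable => i _.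
have tailS n : tail n = F n `|` tail n.+1.
  apply/seteqP; split => x.
    move=> [i /= +  Fix]; rewrite leq_eqVlt => /predU1P[ni|ni]; last by right; exists i.
    by left; rewrite ni.
  by move=> [Fnx|[i /= ni Fix]]; [exists n => /=|exists i => //=; exact: ltnW].
(* Partial sums telescope against the tails, so sigma-additivity reduces to the charge of the tails
   tending to 0; the bound by M and dominated convergence give this. *)
have sumE n : \sum_(0 <= i < n) weighted_charge (F i) =
    weighted_charge (\bigcup_i F i) - weighted_charge (tail n).
  elim: n => [|n IH].
    rewrite big_geq// (_ : tail 0%N = \bigcup_i F i) ?subee//.
    by rewrite /tail; apply: eq_bigcup.
  rewrite big_nat_recr//= IH tailS chargeU//.
    by rewrite /weighted_charge -!EFinD; congr EFin; ring.
  apply/disj_setPS => x [Fnx [i /= ni Fix]].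
  have E : n = i by apply: tF => //; exists x.
  by rewrite -E ltnn in ni.
under eq_fun do rewrite sumE.
suff t0 : weighted_charge (tail n) @[n --> \oo] --> 0.
  have := cvgeB _ (@cvg_cst _ (weighted_charge (\bigcup_i F i)) _ \oo _) t0.
  by rewrite sube0; apply.
apply/cvg_abse0P.
apply: (@squeeze_cvge _ _ _ _ (cst 0) _ (fun n => M%:E * \int[mu]_(x in tail n) (w x)%:E)).
- by apply: nearW => n; rewrite abse_ge0/= phi_bound_w.
- exact: cvg_cst.
- rewrite -[X in _ --> X](mule0 M%:E); apply: cvgeZl => //; apply: L1w_cvg0 => // x.
  have [[k Fkx]|nF] := pselect (exists k, F k x).
    exists k.+1 => // n /= kn [i /= ni Fix].
    have ik : i = k by apply: tF => //; exists x.
    by move: (leq_trans kn ni); rewrite ik ltnn.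
  by apply: nearW => n [i _ Fix]; apply: nF; exists i.
Qed.

HB.instance Definition _ := isCharge.Build _ _ _ weighted_charge
  charge0 charge_fin charge_sigma_additive.

Let charge_dominated : weighted_charge `<< mu.
Proof.
move=> A Anull B mB BA.
have muB : mu B = 0 by exact: Anull.
have := phi_bound_w mB; rewrite null_set_integral//; last first.
  by apply/measurable_EFinP; exact: measurable_funTS.
by rewrite mule0 /weighted_charge/= lee_fin normr_le0 => /eqP ->.
Qed.

Let Mw_int A : measurable A -> \int[mu]_(x in A) (M * w x)%:E = M%:E * \int[mu]_(x in A) (w x)%:E.
Proof.
move=> mA; rewrite -ge0_integralZl//.
- by apply/measurable_EFinP; exact: measurable_funTS.
- by move=> x _; rewrite lee_fin ltW.
Qed.

Let L1M (g m : T -> R) : L1 g -> measurable_fun setT m -> (forall x, `|m x| <= M)%R ->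
  L1 (fun x => g x * m x)%R /\
  (`| (\int[mu]_x (g x * m x))%R |%R)%:E <= M%:E * \int[mu]_x (`|g x|)%:E.
Proof.
move=> gi mm mM.
have mg : measurable_fun setT g by apply/measurable_EFinP; exact: measurable_int gi.
have mgm : measurable_fun setT (fun x => g x * m x)%R by exact: measurable_funM.
have gmi : L1 (fun x => g x * m x)%R.
  apply: (le_integrable measurableT _ _ (integrableZl measurableT M gi)) => /=.
    exact/measurable_EFinP.
  move=> x _; rewrite lee_fin !normrM (ger0_norm M0) mulrC.
  by rewrite ler_wpM2r.
split => //; rewrite EFin_normr_Rintegral//.
apply: (le_trans (le_abse_integral _ _ _)) => //; first exact/measurable_EFinP.
rewrite -ge0_integralZl//; first last.
  by apply/measurable_EFinP; exact: measurableT_comp.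
apply: ge0_le_integral => //=.
- by apply/measurable_EFinP; exact: measurableT_comp.
- by apply: measurable_funeM; apply/measurable_EFinP; exact: measurableT_comp.
- by move=> x _; rewrite -EFinM lee_fin normrM mulrC ler_wpM2r.
Qed.

Let density : exists m : T -> R, [/\ measurable_fun setT m,
  (forall x, `|m x| <= M)%R &
  forall A, measurable A -> phi (fun x => w x * \1_A x)%R = (\int[mu]_x (w x * \1_A x * m x))%R].
Proof.
pose nu : {charge set T -> \bar R} := weighted_charge.
have numu : nu `<< mu := charge_dominated.
pose f : T -> R := fine \o Radon_Nikodym nu mu.
have fE x : (f x)%:E = Radon_Nikodym nu mu x.
  by rewrite /f/= fineK// Radon_Nikodym_fin_num.
have fi : L1 f.
  by apply: eq_integrable (Radon_Nikodym_integrable numu) => // x _; rewrite /= fE.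
have mf : measurable_fun setT f by apply/measurable_EFinP; exact: measurable_int fi.
have fA A : measurable A -> weighted_charge A = \int[mu]_(x in A) (f x)%:E.
  move=> mA; rewrite (Radon_Nikodym_integral numu mA).
  by apply: eq_integral => x _; rewrite fE.
have Mwi : L1 (fun x => M * w x)%R.
  by apply: eq_integrable (integrableZl measurableT M wi1).
have f1 : \forall x \ae mu, (f x <= M * w x)%R.
  apply: ae_le_of_integral_le => // A mA.
  by rewrite Mw_int// -fA// (le_trans (lee_abs _))// phi_bound_w.
have f2 : \forall x \ae mu, (- f x <= M * w x)%R.
  have Nfi : L1 (fun x => - f x)%R.
    rewrite (_ : EFin \o _ = -%E \o (EFin \o f)); last by apply/funext.
    exact: integrableN.
  apply: (ae_le_of_integral_le Nfi Mwi).
  move=> A mA; rewrite Mw_int//.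
  have -> : \int[mu]_(x in A) (- f x)%:E = - weighted_charge A.
    rewrite fA// -integralN; first exact: eq_integral.
    by apply: integrable_add_def => //; exact: integrableS fi.
  by apply: (le_trans _ (phi_bound_w mA)); rewrite -abseN; exact: lee_abs.
(* The density f of the charge satisfies |f| <= M w almost everywhere; clipping f / w to [-M, M]
   alters it on a null set only and makes the bound hold everywhere. *)
pose m x : R := Order.max (- M)%R (Order.min M (f x / w x)%R).
have mm : measurable_fun setT m.
  apply: measurable_maxr; first exact: measurable_cst.
  apply: measurable_minr; first exact: measurable_cst.
  exact: measurable_fun_div_pos.
have wm : {ae mu, forall x, (w x * m x = f x)%R}.
  near=> x.
  have h1 : (f x <= M * w x)%R by near: x.
  have h2 : (- f x <= M * w x)%R by near: x.
  rewrite /m min_r ?ler_pdivrMr// max_r; last by rewrite ler_pdivlMr// mulNr lerNl.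
  by rewrite mulrCA divff ?mulr1// gt_eqF.
have bm x : (`|m x| <= M)%R.
  rewrite /m ler_norml le_max lexx/= ge_max ge_min lexx/= andbT.
  by rewrite (le_trans _ M0)// oppr_le0.
exists m; split => // A mA; apply: EFin_inj; rewrite -/(weighted_charge A) fA//.
rewrite /Rintegral fineK.
  rewrite [LHS]integral_mkcond; apply: ae_eq_integral => //.
  - apply/measurable_restrict => //; rewrite setTI.
    by apply/measurable_EFinP; exact: measurable_funTS.
  - by apply/measurable_EFinP; apply: measurable_funM => //; exact: mwA.
  - apply: filterS wm => x wm _; rewrite patchE indicE; case: ifP => xA.
      by rewrite mulr1 wm.
    by rewrite mulr0 mul0r.
by apply: integrable_fin_num => //; have [] := L1M (L1w mA) mm bm.
Unshelve. all: by end_near. Qed.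

Let L1_fin g : L1 g -> \int[mu]_x (`|g x|)%:E \is a fin_num.
Proof. by move=> gi; apply: integrable_fin_num => //; exact: integrable_norm. Qed.

Let phi_sum (m : T -> R) (s : seq (R * set T)) :
  (forall A, measurable A -> phi (fun x => w x * \1_A x)%R = (\int[mu]_x (w x * \1_A x * m x))%R) ->
  measurable_fun setT m -> (forall x, `|m x| <= M)%R ->
  (forall p, p \in s -> measurable p.2) ->
  L1 (fun x => \sum_(p <- s) p.1 * (w x * \1_(p.2) x))%R /\
  phi (fun x => \sum_(p <- s) p.1 * (w x * \1_(p.2) x))%R =
  (\int[mu]_x ((\sum_(p <- s) p.1 * (w x * \1_(p.2) x)) * m x))%R.
Proof.
move=> phim mm bm; elim: s => [_|[a A] s IH ms].
  under eq_fun do rewrite big_nil; split => //.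
  by under eq_Rintegral do rewrite big_nil mul0r; rewrite phi0 Rintegral_cst// mul0r.
have [iS ES] := IH (fun p ps => ms p (mem_behead (s := _ :: _) ps)).
have mA : measurable A by apply: (ms (a, A)); rewrite mem_head.
have iA := L1w mA.
under eq_fun do rewrite big_cons/=.
split.
  have := integrableD measurableT (integrableZl measurableT a iA) iS.
  exact: eq_integrable.
rewrite phi_lin// ES phim//.
under [RHS]eq_Rintegral do rewrite big_cons/= mulrDl -mulrA.
have [iAm _] := L1M iA mm bm; have [iSm _] := L1M iS mm bm.
rewrite RintegralD//; first by rewrite RintegralZl.
exact: (integrableZl measurableT a iAm).
Qed.

Let phi_ge0 (m : T -> R) g :
  (forall A, measurable A -> phi (fun x => w x * \1_A x)%R = (\int[mu]_x (w x * \1_A x * m x))%R) ->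
  measurable_fun setT m -> (forall x, `|m x| <= M)%R ->
  L1 g -> (forall x, 0 <= g x)%R -> phi g = (\int[mu]_x (g x * m x))%R.
Proof.
move=> phim mm bm gi g0.
have mg : measurable_fun setT g by apply/measurable_EFinP; exact: measurable_int gi.
(* Simple functions are taken below g / w rather than below g: w times a simple function is a
   combination of the functions w 1_A, on which phi is known, even if level sets have infinite
   measure. *)
pose h x := (g x / w x)%R.
have mh : measurable_fun setT (EFin \o h).
  by apply/measurable_EFinP; exact: measurable_fun_div_pos.
have h0 x : setT x -> 0 <= (EFin \o h) x by move=> _; rewrite lee_fin divr_ge0// ltW.
have wh x : (w x * h x = g x)%R by rewrite /h mulrCA divff ?mulr1// gt_eqF.
pose s n := nnsfun_approx measurableT mh n.
pose u n x : R := (w x * s n x)%R.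
have uE n : u n = (fun x => \sum_(p <- [seq (y, s n @^-1` [set y]) | y <- fset_set (range (s n))]) p.1 * (w x * \1_(p.2) x))%R.
  apply/funext => x; rewrite /u (fimfunE (s n)) fsbig_finite//= big_map mulr_sumr.
  by apply: eq_bigr => y _; rewrite mulrCA.
have ui n : L1 (u n) /\ phi (u n) = (\int[mu]_x (u n x * m x))%R.
  rewrite uE; apply: phi_sum => // p /mapP[y _ ->] /=.
  exact: measurable_funPTI.
have ule n x : (0 <= u n x <= g x)%R.
  rewrite /u mulr_ge0 ?(ltW (w0 x))//= -wh ler_wpM2l ?(ltW (w0 x))//.
  by rewrite -lee_fin /s nnsfun_approxE; exact: le_approx.
have mu_ n : measurable_fun setT (u n).
  by apply/measurable_EFinP; have [ui1 _] := ui n; exact: measurable_int ui1.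
have ucvg : \int[mu]_x `|(u n x)%:E - (g x)%:E| @[n --> \oo] --> 0.
  have h1 n : measurable_fun setT (fun x => (u n x)%:E) by exact/measurable_EFinP.
  have h2 : {ae mu, forall x, setT x -> (u n x)%:E @[n --> \oo] --> (g x)%:E}.
    apply: aeW => x _; rewrite -wh EFinM.
    under eq_fun do rewrite /u EFinM.
    by apply: cvgeZl => //; exact: (cvg_nnsfun_approx measurableT mh h0).
  have h3 : {ae mu, forall x n, setT x -> `|(u n x)%:E| <= (g x)%:E}.
    by apply: aeW => x n _; have /andP[u0 ug] := ule n x; rewrite lee_fin ger0_norm.
  have mEg : measurable_fun setT (fun x => (g x)%:E) by exact/measurable_EFinP.
  by have [] := dominated_convergence measurableT h1 mEg h2 gi h3.
(* phi and integration against m are both M-Lipschitz on L^1 and agree at u n; hence the constant 2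
   M. *)
have dif n : (`|phi g - (\int[mu]_x (g x * m x))%R|%R)%:E <= (2 * M)%:E * \int[mu]_x `|(u n x)%:E - (g x)%:E|.
  have [ui1 uphi] := ui n.
  have ugi : L1 (fun x => -1 * u n x + g x)%R.
    exact: (integrableD measurableT (integrableZl measurableT (-1) ui1) gi).
  have -> : \int[mu]_x `|(u n x)%:E - (g x)%:E| = \int[mu]_x (`|-1 * u n x + g x|%R)%:E.
    by apply: eq_integral => x _; rewrite -EFinB abse_EFin distrC mulN1r addrC.
  have := phi_bound ugi; rewrite phi_lin// uphi => B1.
  have [iug B2] := L1M ugi mm bm.
  have [ium _] := L1M ui1 mm bm; have [igm _] := L1M gi mm bm.
  have E : (\int[mu]_x ((-1 * u n x + g x) * m x) =
      -1 * \int[mu]_x (u n x * m x) + \int[mu]_x (g x * m x))%R.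
    under eq_Rintegral do rewrite mulrDl -mulrA.
    rewrite RintegralD//; first by rewrite RintegralZl.
    exact: (integrableZl measurableT (-1) ium).
  rewrite E in B2.
  move: B1 B2; rewrite -(fineK (L1_fin ugi)) -!EFinM !lee_fin => B1 B2.
  set a := (\int[mu]_x (u n x * m x))%R in B1 B2 *.
  set b := (\int[mu]_x (g x * m x))%R in B1 B2 *.
  rewrite (_ : phi g - b = (-1 * a + phi g) - (-1 * a + b))%R; last by ring.
  by apply: (le_trans (ler_normB _ _)); rewrite -mulrA mulr_natl mulr2n lerD.
have : (`|phi g - (\int[mu]_x (g x * m x))%R|%R)%:E <= 0.
  have cv : (2 * M)%:E * \int[mu]_x `|(u n x)%:E - (g x)%:E| @[n --> \oo] --> 0.
    by rewrite -[X in _ --> X](mule0 (2 * M)%:E); exact: cvgeZl.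
  rewrite -(cvg_lim _ cv)//; apply: lime_ge; first by apply/cvg_ex; exists 0.
  exact: nearW.
by rewrite lee_fin normr_le0 subr_eq0 => /eqP.
Qed.

Lemma riesz_L1 : exists m : T -> R, [/\ measurable_fun setT m,
  (forall x, `|m x| <= M)%R & forall g, L1 g -> phi g = (\int[mu]_x (g x * m x))%R].
Proof.
have [m [mm mM phim]] := density; exists m; split => // g gi.
have mg : measurable_fun setT g by apply/measurable_EFinP; exact: measurable_int gi.
have gp : L1 (fun x => Order.max (g x) 0)%R.
  apply: le_integrable gi => //=; first by apply/measurable_EFinP; exact: measurable_maxr.
  by move=> x _; rewrite lee_fin /Order.max; case: ifP => _; rewrite ?normr0.
have gn : L1 (fun x => Order.max (- g x) 0)%R.
  apply: le_integrable gi => //=.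
    by apply/measurable_EFinP; apply: measurable_maxr => //; exact: measurable_funN.
  by move=> x _; rewrite lee_fin /Order.max; case: ifP => _; rewrite ?normrN ?normr0.
have gE : g = (fun x => -1 * Order.max (- g x) 0 + Order.max (g x) 0)%R.
  by apply/funext => x; rewrite /Order.max; case: ifPn; case: ifPn; lra.
have max0 (f : T -> R) x : (0 <= Order.max (f x) 0)%R by rewrite le_max lexx orbT.
rewrite gE phi_lin// !(phi_ge0 phim mm mM)//; last exact: (max0 (fun x => - g x)%R).
have [i1 _] := L1M gn mm mM; have [i2 _] := L1M gp mm mM.
under [RHS]eq_Rintegral do rewrite mulrDl -mulrA.
rewrite RintegralD//; first by rewrite RintegralZl.
exact: (integrableZl measurableT (-1) i1).
Qed.

End riesz.

(** * The spaces L_c and K_c and their pairing *)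

Section finite_products.
Context (T : choiceType) (R : realType).
Implicit Types (f g : T -> R) (eta xi : {fset T}).

Lemma fset_prod_cst (c : R) eta : fset_prod (fun=> c) eta = c ^+ #|` eta|.
Proof.
elim/fset_ind_U1: eta => [|x eta xe IH]; first by rewrite fset_prod0 cardfs0 expr0.
by rewrite fset_prodU1// IH cardfsU1 xe exprS.
Qed.

Lemma fset_sum1 eta : fset_sum (fun=> 1 : R) eta = #|` eta|%:R.
Proof.
elim/fset_ind_U1: eta => [|x eta xe IH]; first by rewrite fset_sum0 cardfs0.
by rewrite fset_sumU1// IH cardfsU1 xe natrD.
Qed.

Lemma fset_prod_ge0 f eta : (forall x, 0 <= f x) -> 0 <= fset_prod f eta.
Proof. by move=> f0; apply: prodr_ge0. Qed.

Lemma fset_prod_le f g eta : (forall x, 0 <= f x <= g x) ->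
  fset_prod f eta <= fset_prod g eta.
Proof. by move=> fg; apply: ler_prod => x _; exact: fg. Qed.

Lemma fset_prod_le1 f eta : (forall x, 0 <= f x <= 1) -> fset_prod f eta <= 1.
Proof.
move=> f1; have := fset_prod_le eta f1.
by rewrite fset_prod_cst expr1n.
Qed.

Lemma normr_fset_prod f eta : `|fset_prod f eta| = fset_prod (fun x => `|f x|) eta.
Proof. by rewrite /fset_prod normr_prod. Qed.

Lemma fset_prodM f g eta : fset_prod (fun x => f x * g x) eta =
  fset_prod f eta * fset_prod g eta.
Proof. by rewrite /fset_prod big_split. Qed.

Lemma eq_fset_prod f g eta : {in eta, f =1 g} -> fset_prod f eta = fset_prod g eta.
Proof. by move=> fg; apply: eq_big_seq. Qed.

Lemma fset_prod_indic (B : set T) eta :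
  fset_prod \1_B eta = (`[< [set` eta] `<=` B >])%:R :> R.
Proof.
elim/fset_ind_U1: eta => [|x eta xe IH].
  by rewrite fset_prod0 (_ : `[< _ >] = true)//; apply/asboolP => x /=; rewrite inE.
rewrite fset_prodU1// IH indicE -natrM mulnb; congr (nat_of_bool _)%:R.
apply/andP/asboolP => [[/set_mem Bx /asboolP eB] y /=|xeB].
  by rewrite !inE => /orP[/eqP ->//|]; exact: eB.
split; first by apply/mem_set/xeB => /=; rewrite !inE eqxx.
by apply/asboolP => y ye; apply: xeB; rewrite /= !inE ye orbT.
Qed.

Lemma normr_subset_sum_le f g (F G : {fset T} -> R) eta :
  (forall x, `|f x| <= g x) -> (forall xi, `|F xi| <= G xi) ->
  `|subset_sum f F eta| <= subset_sum g G eta.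
Proof.
move=> fg FG; rewrite /subset_sum /partition_sum (le_trans (ler_norm_sum _ _ _))//.
apply: ler_sum => xi _; rewrite normrM ler_pM// normr_fset_prod.
by apply: fset_prod_le => x; rewrite normr_ge0 fg.
Qed.

(** The indicator of the empty configuration is the unit of the convolution. *)
Lemma subset_sum_empty f eta :
  subset_sum f (fun xi => (xi == fset0)%:R) eta = fset_prod f eta :> R.
Proof.
elim/fset_ind_U1: eta => [|x eta xe IH]; first by rewrite subset_sum0 fset_prod0 eqxx.
rewrite subset_sumU1// IH fset_prodU1//.
rewrite (_ : subset_sum _ _ _ = 0) ?add0r//.
apply: big1_seq => xi _; rewrite (_ : _ == fset0 = false) ?mulr0//.
by apply/negbTE/fset0Pn; exists x; rewrite !inE eqxx.
Qed.

End finite_products.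

Section spaces_theory.
Context (R : realType) (d : nat).
Local Notation conf := {fset 'rV[R]_d}.
Local Notation lam := (lambda R d).
Implicit Types (c : R) (G H k : conf -> R).

Lemma measurable_card_power c : measurable_fun setT (fun eta : conf => c ^+ #|` eta|).
Proof.
rewrite (_ : (fun _ => _) = fset_prod (fun=> c)); last first.
  by apply/funext => eta; rewrite fset_prod_cst.
by apply: (measurable_fset_prod (@measurable_row_diagonal R d)); exact: measurable_cst.
Qed.

Lemma measurable_card : measurable_fun setT (fun eta : conf => #|` eta|%:R : R).
Proof.
rewrite (_ : (fun _ => _) = fset_sum (fun=> 1)); last first.
  by apply/funext => eta; rewrite fset_sum1.
by apply: (measurable_fset_sum (@measurable_row_diagonal R d)); exact: measurable_cst.
Qed.

Lemma normLE c G : 0 <= c ->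
  normL c G = (\int[lam]_eta (c ^+ #|` eta| * `|G eta|)%:E)%E.
Proof.
move=> c0; rewrite /normL Lnorm1; apply: eq_integral => eta _ /=.
by rewrite /weightL normrM ger0_norm// exprn_ge0.
Qed.

Lemma spaceLP c G : 0 < c ->
  spaceL c G <-> measurable_fun setT G /\ (normL c G < +oo)%E.
Proof.
move=> c0; rewrite /spaceL /= inE; split => [/andP[/[!inE]/= mG Gfin]|[mG Gfin]].
  split => //; rewrite (_ : G = fun eta => c^-1 ^+ #|` eta| * weightL c G eta).
    by apply: measurable_funM => //; exact: measurable_card_power.
  apply/funext => eta; rewrite /weightL mulrA -exprMn mulVf ?gt_eqF//.
  by rewrite expr1n mul1r.
apply/andP; rewrite !inE/=; split => //.
by apply: measurable_funM => //; exact: measurable_card_power.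
Qed.

(** [fine] sends an infinite norm to 0, so a bound on [nrmL] says something only on [spaceL]; in
    return the distance to the cone is a real infimum. *)
Definition nrmL c G : R := fine (normL c G).

Lemma nrmLE c G : 0 < c -> spaceL c G -> normL c G = (nrmL c G)%:E.
Proof.
move=> c0 /spaceLP-/(_ c0)[_ Gfin]; rewrite /nrmL fineK// ge0_fin_numE//.
exact: Lnorm_ge0.
Qed.

Lemma nrmL_ge0 c G : 0 <= nrmL c G.
Proof. by apply: fine_ge0; exact: Lnorm_ge0. Qed.

Lemma measurable_weighted_norm c G : measurable_fun setT G ->
  measurable_fun setT (fun eta : conf => (c ^+ #|` eta| * `|G eta|)%:E).
Proof.
move=> mG; apply/measurable_EFinP; apply: measurable_funM.
  exact: measurable_card_power.
exact: measurableT_comp.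
Qed.

Lemma le_normL c G H : 0 <= c -> measurable_fun setT G -> measurable_fun setT H ->
  {ae lam, forall eta, `|G eta| <= `|H eta|} -> (normL c G <= normL c H)%E.
Proof.
move=> c0 mG mH GH; rewrite !normLE//; apply: ae_ge0_le_integral => //.
- by move=> eta _; rewrite lee_fin mulr_ge0// exprn_ge0.
- exact: measurable_weighted_norm.
- by move=> eta _; rewrite lee_fin mulr_ge0// exprn_ge0.
- exact: measurable_weighted_norm.
- by apply: filterS GH => eta GH _; rewrite lee_fin ler_wpM2l// exprn_ge0.
Qed.

Lemma normLD c G H : 0 <= c -> measurable_fun setT G -> measurable_fun setT H ->
  (normL c (fun eta => G eta + H eta)%R <= normL c G + normL c H)%E.
Proof.
move=> c0 mG mH; rewrite !normLE// -ge0_integralD//; first last.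
- exact: measurable_weighted_norm.
- by move=> eta _; rewrite lee_fin mulr_ge0// exprn_ge0.
- exact: measurable_weighted_norm.
- by move=> eta _; rewrite lee_fin mulr_ge0// exprn_ge0.
apply: ge0_le_integral => //.
- by move=> eta _; rewrite lee_fin mulr_ge0// exprn_ge0.
- by apply: measurable_weighted_norm; exact: measurable_funD.
- by apply: emeasurable_funD; exact: measurable_weighted_norm.
- move=> eta _; rewrite -EFinD lee_fin -mulrDr ler_wpM2l ?exprn_ge0//.
  exact: ler_normD.
Qed.

Lemma normLZ c a G : 0 <= c -> measurable_fun setT G ->
  normL c (fun eta => a * G eta)%R = (`|a|%:E * normL c G)%E.
Proof.
move=> c0 mG; rewrite !normLE// -ge0_integralZl//; first last.
- by move=> eta _; rewrite lee_fin mulr_ge0// exprn_ge0.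
- exact: measurable_weighted_norm.
by apply: eq_integral => eta _; rewrite -EFinM normrM mulrCA.
Qed.

Lemma spaceL_lin c a G H : 0 < c -> spaceL c G -> spaceL c H ->
  spaceL c (fun eta => a * G eta + H eta).
Proof.
move=> c0 /spaceLP-/(_ c0)[mG Gfin] /spaceLP-/(_ c0)[mH Hfin].
have maG : measurable_fun setT (fun eta => a * G eta) by apply: measurable_funM.
apply/spaceLP => //; split; first exact: measurable_funD.
apply: (le_lt_trans (normLD (ltW c0) maG mH)).
by rewrite normLZ ?(ltW c0)// lte_add_pinfty// lte_mul_pinfty.
Qed.

Lemma spaceL0 c : 0 < c -> @spaceL R d c (fun=> 0).
Proof.
move=> c0; apply/spaceLP => //; split; first exact: measurable_cst.
rewrite normLE ?(ltW c0)// integral0_eq// => eta _.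
by rewrite normr0 mulr0.
Qed.

Lemma nrmLD c G H : 0 < c -> spaceL c G -> spaceL c H ->
  nrmL c (fun eta => G eta + H eta) <= nrmL c G + nrmL c H.
Proof.
move=> c0 sG sH; have [mG _] := (spaceLP G c0).1 sG; have [mH _] := (spaceLP H c0).1 sH.
have sGH : spaceL c (fun eta => G eta + H eta).
  have := spaceL_lin 1 c0 sG sH.
  by rewrite (_ : (fun eta => 1 * _ + _) = fun eta => G eta + H eta)//; apply/funext => eta; rewrite mul1r.
by rewrite -lee_fin EFinD -!nrmLE// normLD// ltW.
Qed.

Lemma nrmLZ c a G : 0 < c -> spaceL c G ->
  nrmL c (fun eta => a * G eta) = `|a| * nrmL c G.
Proof.
move=> c0 sG; have [mG _] := (spaceLP G c0).1 sG.
by rewrite /nrmL normLZ ?(ltW c0)// nrmLE.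
Qed.

Lemma spaceL_le c G H : 0 < c -> measurable_fun setT G -> spaceL c H ->
  {ae lam, forall eta, `|G eta| <= `|H eta|} -> spaceL c G.
Proof.
move=> c0 mG /spaceLP-/(_ c0)[mH Hfin] GH; apply/spaceLP => //; split => //.
by apply: le_lt_trans Hfin; apply: le_normL => //; exact: ltW.
Qed.

Lemma le_spaceL c c' : 0 < c -> c <= c' -> (spaceL c' : set (conf -> R)) `<=` spaceL c.
Proof.
move=> c0 cc' G /spaceLP-/(_ (lt_le_trans c0 cc'))[mG Gfin].
apply/spaceLP => //; split => //; apply: le_lt_trans Gfin.
rewrite !normLE; [|lra..]; apply: ge0_le_integral => //.
- by move=> eta _; rewrite lee_fin mulr_ge0// exprn_ge0// ltW.
- exact: measurable_weighted_norm.
- exact: measurable_weighted_norm.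
- by move=> eta _; rewrite lee_fin ler_wpM2r// lerXn2r// nnegrE ltW// (lt_le_trans c0).
Qed.

Lemma normL_ae_eq c G H : 0 <= c -> measurable_fun setT G -> measurable_fun setT H ->
  G = H %[ae lam] -> normL c G = normL c H.
Proof.
move=> c0 mG mH GH; apply/eqP; rewrite eq_le !le_normL//.
  by apply: filterS GH => eta /(_ I) ->.
by apply: filterS GH => eta /(_ I) ->.
Qed.

End spaces_theory.

(** * Duality between L_c and K_c *)

Section duality.
Context (R : realType) (d : nat) (d_gt0 : (0 < d)%N).
Local Notation conf := {fset 'rV[R]_d}.
Local Notation lam := (lambda R d).
Local Notation mu := (lebesgue_measure_row R d).
Implicit Types (c M : R) (G H k : conf -> R).

Let diag := @measurable_row_diagonal R d.
Let atomless : forall x, mu [set x] = 0%E.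
Proof. by move=> x; exact: lebesgue_measure_row_set1. Qed.

Definition bounded_by c k M := {ae lam, forall eta, `|k eta| <= M * c ^+ #|` eta|}.

Lemma normK_leP c k M : 0 < c -> 0 <= M ->
  (normK c k <= M%:E)%E <-> bounded_by c k M.
Proof.
move=> c0 M0; rewrite /normK unlock /Lnorm.
have E eta : (`|weightK c k eta| <= M) = (`|k eta| <= M * c ^+ #|` eta|).
  rewrite /weightK normrM normfV normrX (gtr0_norm c0).
  by rewrite [X in _ = (_ <= X)]mulrC ler_pdivrMl ?exprn_gt0.
(* At exponent +oo the norm is 0 by convention when the whole space is null; every bound then holds
   almost everywhere. *)
case: ifPn => [_|lam0].
  split => [/ess_supP H|H].
    by apply: filterS H => eta /=; rewrite lee_fin E.
  by apply/ess_supP; apply: filterS H => eta; rewrite /= lee_fin E.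
split => // _; exists setT; split => //; apply/eqP; move: lam0.
by rewrite -leNgt measure_le0.
Qed.

Lemma spaceKP c k : 0 < c ->
  spaceK c k <-> measurable_fun setT k /\ exists2 M, 0 <= M & bounded_by c k M.
Proof.
move=> c0; have mc := @measurable_card_power R d.
rewrite /spaceK /= inE; split => [/andP[/[!inE]/= mk kfin]|[mk [M M0 kM]]].
  split.
    rewrite (_ : k = fun eta => c ^+ #|` eta| * weightK c k eta).
      by apply: measurable_funM => //; exact: mc.
    by apply/funext => eta; rewrite /weightK mulrA mulfV ?mul1r// expf_neq0// gt_eqF.
  have N0 : (0 <= normK c k)%E by exact: Lnorm_ge0.
  exists (fine (normK c k)); first exact: fine_ge0.
  by apply/normK_leP => //; rewrite ?fine_ge0// fineK// ge0_fin_numE.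
apply/andP; rewrite !inE/=; split.
  apply: measurable_funM => //.
  rewrite (_ : (fun eta : conf => c ^- #|` eta|) = (fun eta => c^-1 ^+ #|` eta|)).
    exact: mc.
  by apply/funext => eta; rewrite exprVn.
have /(normK_leP k c0 M0) := kM; rewrite /finite_norm => H.
by apply: le_lt_trans H _; rewrite ltey.
Qed.

Lemma pairing_integrable c G k M : 0 < c -> spaceL c G -> measurable_fun setT k ->
  bounded_by c k M -> lam.-integrable setT (fun eta => (G eta * k eta)%:E).
Proof.
move=> c0 sG mk kM; have [mG Gfin] := (spaceLP G c0).1 sG.
have mGk : measurable_fun setT (fun eta => G eta * k eta) by exact: measurable_funM.
apply/integrableP; split; first exact/measurable_EFinP.
apply: (@le_lt_trans _ _ (`|M|%:E * normL c G)%E); last first.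
  by rewrite (nrmLE c0 sG) -EFinM ltey.
rewrite normLE ?(ltW c0)// -ge0_integralZl//; first last.
- by move=> eta _; rewrite lee_fin mulr_ge0// exprn_ge0// ltW.
- exact: measurable_weighted_norm.
apply: ae_ge0_le_integral => //.
- by apply: measurableT_comp => //; exact/measurable_EFinP.
- by move=> eta _; rewrite -EFinM lee_fin !mulr_ge0// exprn_ge0// ltW.
- by apply: measurable_funeM; exact: measurable_weighted_norm.
apply: filterS kM => eta kM _ /=; rewrite -EFinM lee_fin normrM.
apply: (le_trans (ler_wpM2l (normr_ge0 _) kM)).
rewrite (_ : `|G eta| * (M * c ^+ #|` eta|) = M * (c ^+ #|` eta| * `|G eta|)); last by ring.
by rewrite ler_wpM2r ?ler_norm// mulr_ge0// exprn_ge0// ltW.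
Qed.

Lemma pairing_le c G k M : 0 < c -> 0 <= M -> spaceL c G -> measurable_fun setT k ->
  bounded_by c k M -> `|pairing G k| <= M * nrmL c G.
Proof.
move=> c0 M0 sG mk kM; have [mG Gfin] := (spaceLP G c0).1 sG.
have iGk := pairing_integrable c0 sG mk kM.
rewrite -lee_fin EFin_normr_Rintegral// EFinM -nrmLE//.
apply: (le_trans (le_abse_integral _ _ _)) => //.
  by apply/measurable_EFinP; exact: measurable_funM.
rewrite normLE ?(ltW c0)// -ge0_integralZl//; first last.
- by move=> eta _; rewrite lee_fin mulr_ge0// exprn_ge0// ltW.
- exact: measurable_weighted_norm.
apply: ae_ge0_le_integral => //.
- by apply/measurable_EFinP; apply: measurableT_comp => //; exact: measurable_funM.
- by move=> eta _; rewrite -EFinM lee_fin !mulr_ge0// exprn_ge0// ltW.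
- by apply: measurable_funeM; exact: measurable_weighted_norm.
apply: filterS kM => eta kM _ /=; rewrite -EFinM lee_fin normrM.
apply: (le_trans (ler_wpM2l (normr_ge0 _) kM)).
by rewrite (_ : `|G eta| * (M * c ^+ #|` eta|) = M * (c ^+ #|` eta| * `|G eta|))//; ring.
Qed.

Lemma pairing_linl c a G H k : 0 < c -> spaceL c G -> spaceL c H -> spaceK c k ->
  pairing (fun eta => a * G eta + H eta) k = a * pairing G k + pairing H k.
Proof.
move=> c0 sG sH /(spaceKP k c0)[mk [M M0 kM]].
have iG := pairing_integrable c0 sG mk kM; have iH := pairing_integrable c0 sH mk kM.
rewrite /pairing; under eq_Rintegral do rewrite mulrDl -mulrA.
rewrite RintegralD//; first by rewrite RintegralZl.
exact: (integrableZl measurableT a iG).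
Qed.

Lemma pairing_linr c a G k l : 0 < c -> spaceL c G -> spaceK c k -> spaceK c l ->
  pairing G (fun eta => a * k eta + l eta) = a * pairing G k + pairing G l.
Proof.
move=> c0 sG /(spaceKP k c0)[mk [M M0 kM]] /(spaceKP l c0)[ml [M' M'0 lM]].
have ik := pairing_integrable c0 sG mk kM; have il := pairing_integrable c0 sG ml lM.
rewrite /pairing; under eq_Rintegral do rewrite mulrDr mulrCA.
rewrite RintegralD//; first by rewrite RintegralZl.
exact: (integrableZl measurableT a ik).
Qed.

Lemma eq_pairing_ae G H k : measurable_fun setT G -> measurable_fun setT H ->
  measurable_fun setT k -> G = H %[ae lam] -> pairing G k = pairing H k.
Proof.
move=> mG mH mk GH; rewrite /pairing /Rintegral; congr fine.
apply: ae_eq_integral => //.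
- by apply/measurable_EFinP; exact: measurable_funM.
- by apply/measurable_EFinP; exact: measurable_funM.
- by apply: filterS GH => eta GH _; rewrite GH.
Qed.

(** The exponential formula $\int e_\lambda(f)\,d\lambda = e^{\int f}$, as an upper bound:
    [fset_prod f] is the convolution applied to the indicator H of the empty configuration, whose
    integral comes from the 0-point term alone. *)
Lemma integral_fset_prod_le (f : 'rV[R]_d -> R) a : measurable_fun setT f ->
  (forall x, 0 <= f x) -> (\int[mu]_x (f x)%:E = a%:E)%E ->
  (\int[lam]_eta (fset_prod f eta)%:E <= (expR a)%:E)%E.
Proof.
move=> mf f0 fa; pose H (eta : conf) : R := (eta == fset0)%:R.
have mH : measurable_fun setT H.
  rewrite (_ : H = fset_prod (fun=> 0)); first exact: (measurable_fset_prod diag).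
  apply/funext => eta; rewrite fset_prod_cst expr0n /H cardfs_eq0.
  by case: eqP.
have H0 eta : 0 <= H eta by [].
have := integral_subset_sum_le diag atomless f0 H0 mf mH fa.
rewrite (_ : (fun eta => (subset_sum f H eta)%:E) = (fun eta => (fset_prod f eta)%:E)); last first.
  by apply/funext => eta; rewrite subset_sum_empty.
move=> /le_trans; apply; rewrite -[leRHS]mule1 lee_wpmul2l ?lee_fin ?expR_ge0//.
rewrite integral_lebesgue_poisson//; last exact/measurable_EFinP.
rewrite nneseries_recl//; last first.
  by move=> n _; apply: lp_term_ge0 => eta; rewrite lee_fin.
rewrite lp_term0; last exact/measurable_EFinP.
rewrite /H eqxx -[leRHS]adde0 leeD2l// eseries0// => n n0 _.
rewrite /lp_term integral0_eq ?mule0// => t _; rewrite (_ : _ == fset0 = false)//.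
apply/negbTE/fset0Pn; case: n t n0 => // n t _; exists (thead t).
by rewrite /fset_of_tuple inE; exact: mem_tnth.
Qed.


Lemma exists_lambda_weight : exists w : conf -> R, [/\ measurable_fun setT w,
  forall eta, 0 < w eta & (\int[lam]_eta (w eta)%:E < +oo)%E].
Proof.
have [f [mf f0 fi]] := exists_positive_integrable mu.
exists (fset_prod f); split.
- exact: (measurable_fset_prod diag).
- by move=> eta; apply: prodr_gt0.
- have f0' x : 0 <= f x by exact: ltW.
  have fE : (\int[mu]_x (f x)%:E = (fine (\int[mu]_x (f x)%:E))%:E)%E.
    by rewrite fineK// ge0_fin_numE// integral_ge0// => x _; rewrite lee_fin.
  by apply: (le_lt_trans (integral_fset_prod_le mf f0' fE)); rewrite ltey.
Qed.

(** The superlevel sets of a positive integrable weight exhaust the space and have finite measure by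
    Markov's inequality. *)
Lemma lambda_sigma_finite : sigma_finite setT lam.
Proof.
have [w [mw w0 wi]] := exists_lambda_weight.
have mEw : measurable_fun setT (EFin \o w) by exact/measurable_EFinP.
exists (fun n => [set eta | (n.+1%:R^-1%:E <= `|(w eta)%:E|)%E]).
  apply/esym; rewrite -subTset => eta _; exists (Num.truncn (w eta)^-1) => //=.
  rewrite lee_fin gtr0_norm// invf_ple ?posrE//.
  by rewrite ltW// truncnS_gt.
move=> n; have mF : measurable [set eta | (n.+1%:R^-1%:E <= `|(w eta)%:E|)%E].
  have := measurable_fun_lee (@measurable_cst _ _ _ _ setT (n.+1%:R^-1%:E : \bar R))
    (measurableT_comp (@abse_measurable R setT) mEw) measurableT (Y := [set true]) (ltac:(by [])).
  by rewrite setTI.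
split => //.
have n0 : 0 < n.+1%:R^-1 :> R by rewrite invr_gt0.
have := le_integral_abse lam measurableT mEw n0; rewrite setTI => H.
rewrite -(@lte_pmul2l _ (n.+1%:R^-1)%:E)// (le_lt_trans H)// gt0_muley ?lte_fin//.
apply: le_lt_trans wi; rewrite le_eqVlt; apply/orP; left; apply/eqP.
by apply: eq_integral => eta _ /=; rewrite gtr0_norm.
Qed.

(** [sc], multiplication by $c^{-|\cdot|}$, is an isometry of $L^1(\lambda)$ onto L_c. The
    representation on L^1 is transported along it, and the density picks up the factor
    $c^{|\cdot|}$. *)
Lemma dual_repr c (phi : (conf -> R) -> R) M : 0 < c -> 0 <= M ->
  (forall a G H, spaceL c G -> spaceL c H ->
     phi (fun eta => a * G eta + H eta) = a * phi G + phi H) ->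
  (forall G, spaceL c G -> `|phi G| <= M * nrmL c G) ->
  exists m, [/\ measurable_fun setT m, bounded_by c m M &
    forall G, spaceL c G -> phi G = pairing G m].
Proof.
move=> c0 M0 phi_lin phi_bd.
pose lamS : {sigma_finite_measure set conf -> \bar R} :=
  HB.pack (lebesgue_poisson mu) (Measure_isSigmaFinite.Build _ _ _ (lebesgue_poisson mu) lambda_sigma_finite).
have [w [mw w0 wi]] := exists_lambda_weight.
pose sc (g : conf -> R) : conf -> R := fun eta => c^-1 ^+ #|` eta| * g eta.
have scK g eta : c ^+ #|` eta| * sc g eta = g eta.
  by rewrite /sc mulrA -exprMn mulfV ?gt_eqF// expr1n mul1r.
have scL g : lam.-integrable setT (EFin \o g) -> spaceL c (sc g) /\
    normL c (sc g) = (\int[lam]_eta (`|g eta|)%:E)%E.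
  move=> gi; have mg : measurable_fun setT g by apply/measurable_EFinP; exact: measurable_int gi.
  have E : normL c (sc g) = (\int[lam]_eta (`|g eta|)%:E)%E.
    rewrite normLE ?(ltW c0)//; apply: eq_integral => eta _.
    by rewrite -[X in X * _]ger0_norm ?exprn_ge0 ?(ltW c0)// -normrM scK.
  split => //; apply/spaceLP => //; split.
    by apply: measurable_funM => //; exact: measurable_card_power.
  by rewrite E; have /integrableP[_] := gi.
have phi_lin' a f g : lam.-integrable setT (EFin \o f) -> lam.-integrable setT (EFin \o g) ->
    phi (sc (fun x => a * f x + g x)) = a * phi (sc f) + phi (sc g).
  move=> fi gi; rewrite -phi_lin; [|exact: (scL _ fi).1|exact: (scL _ gi).1].
  by congr phi; apply/funext => eta; rewrite /sc; ring.
have phi_bd' g : lam.-integrable setT (EFin \o g) ->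
    ((`|phi (sc g)|)%:E <= M%:E * \int[lam]_eta (`|g eta|)%:E)%E.
  move=> gi; have [sg E] := scL _ gi.
  by rewrite -E nrmLE// -EFinM lee_fin phi_bd.
have [m [mm mM phim]] := @riesz_L1 _ _ _ lamS (phi \o sc) M M0 phi_lin' phi_bd' w mw w0 wi.
exists (fun eta => c ^+ #|` eta| * m eta); split.
- by apply: measurable_funM => //; exact: measurable_card_power.
- apply: aeW => eta; rewrite normrM ger0_norm ?exprn_ge0 ?(ltW c0)// mulrC.
  by rewrite ler_wpM2r// exprn_ge0// ltW.
- move=> G sG; have iG : lam.-integrable setT (EFin \o (fun eta => c ^+ #|` eta| * G eta)).
    have [mG Gfin] := (spaceLP G c0).1 sG.
    apply/integrableP; split.
      apply/measurable_EFinP; apply: measurable_funM => //.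
      exact: measurable_card_power.
    rewrite normLE ?(ltW c0)// in Gfin; apply: le_lt_trans Gfin.
    rewrite le_eqVlt; apply/orP; left; apply/eqP; apply: eq_integral => eta _ /=.
    by rewrite normrM ger0_norm// exprn_ge0// ltW.
  rewrite -[RHS](_ : phi (sc (fun eta => c ^+ #|` eta| * G eta)) = _).
    congr phi; apply/funext => eta; rewrite /sc mulrA -exprMn mulVf ?gt_eqF//.
    by rewrite expr1n mul1r.
  rewrite [LHS](phim _ iG) /pairing; apply: eq_Rintegral => eta _ /=.
  by ring.
Qed.

(** Converse of [pairing_le]. With $v = c^{-|\cdot|} w$ the norm of v 1_A in L_c is the integral of
    w over A, so the bound on the functional localises to every measurable A and yields an
    inequality almost everywhere. *)
Lemma dual_norm c m M : 0 < c -> 0 <= M -> spaceK c m ->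
  (forall G, spaceL c G -> `|pairing G m| <= M * nrmL c G) -> bounded_by c m M.
Proof.
move=> c0 M0 sm bd; have [mm [M' M'0 mM']] := (spaceKP m c0).1 sm.
have [w [mw w0 wi]] := exists_lambda_weight.
have wint : lam.-integrable setT (EFin \o w).
  apply/integrableP; split; first exact/measurable_EFinP.
  by under eq_integral do rewrite /= gtr0_norm//.
pose v (eta : conf) := c^-1 ^+ #|` eta| * w eta.
have mv : measurable_fun setT v.
  by apply: measurable_funM => //; exact: measurable_card_power.
have cv eta : c ^+ #|` eta| * v eta = w eta.
  by rewrite /v mulrA -exprMn mulfV ?gt_eqF// expr1n mul1r.
have v0 eta : 0 < v eta by rewrite mulr_gt0// exprn_gt0// invr_gt0.
have vA A : measurable A -> spaceL c (fun eta => v eta * \1_A eta) /\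
    (normL c (fun eta => v eta * \1_A eta)%R = \int[lam]_(eta in A) (w eta)%:E)%E.
  move=> mA; have E : (normL c (fun eta => v eta * \1_A eta)%R = \int[lam]_(eta in A) (w eta)%:E)%E.
    rewrite normLE ?(ltW c0)// [RHS]integral_mkcond; apply: eq_integral => eta _.
    have vA0 : 0 <= v eta * \1_A eta by rewrite mulr_ge0// ltW.
    rewrite (ger0_norm vA0) mulrA cv patchE indicE.
    by case: ifP => _; rewrite ?mulr1 ?mulr0.
  split => //; apply/spaceLP => //; split.
    by apply: measurable_funM => //; exact: measurable_indic.
  rewrite E; apply: le_lt_trans wi; apply: ge0_subset_integral => //.
    exact/measurable_EFinP.
  by move=> eta _; rewrite lee_fin ltW.
have sv : spaceL c v.
  have [+ _] := vA _ measurableT.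
  by rewrite (_ : (fun eta => v eta * \1_setT eta) = v)//; apply/funext => eta; rewrite indicT mulr1.
have ivm : lam.-integrable setT (EFin \o (fun eta => v eta * m eta)).
  exact: pairing_integrable c0 sv mm mM'.
have iNvm : lam.-integrable setT (EFin \o (fun eta => - (v eta * m eta))).
  rewrite (_ : EFin \o _ = -%E \o (EFin \o (fun eta => v eta * m eta)%R))%E; last by apply/funext.
  exact: integrableN.
have iMw : lam.-integrable setT (EFin \o (fun eta => M * w eta)).
  exact: (integrableZl measurableT M wint).
have Mw A : measurable A -> (\int[lam]_(eta in A) (M * w eta)%:E = (M * nrmL c (fun eta => v eta * \1_A eta)%R)%:E)%E.
  move=> mA; have [sA EA] := vA _ mA; rewrite EFinM -nrmLE// EA -ge0_integralZl//.
    by apply/measurable_EFinP; exact: measurable_funTS.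
  by move=> eta _; rewrite lee_fin ltW.
have pA A : measurable A -> (\int[lam]_(eta in A) (v eta * m eta)%:E = (pairing (fun eta => v eta * \1_A eta) m)%:E)%E.
  move=> mA; have [sA _] := vA _ mA.
  rewrite /pairing /Rintegral fineK; last first.
    by apply: integrable_fin_num => //; exact: pairing_integrable c0 sA mm mM'.
  rewrite [LHS]integral_mkcond; apply: eq_integral => eta _; rewrite patchE indicE.
  by case: ifP => _; rewrite ?mulr1 ?mulr0 ?mul0r.
have le1 : {ae lam, forall eta, v eta * m eta <= M * w eta}.
  apply: ae_le_of_integral_le => // A mA; rewrite pA// Mw// lee_fin.
  exact/(le_trans (ler_norm _))/bd/(vA _ mA).1.
have le2 : {ae lam, forall eta, - (v eta * m eta) <= M * w eta}.
  apply: ae_le_of_integral_le => // A mA; rewrite Mw//.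
  have -> : (\int[lam]_(eta in A) (- (v eta * m eta))%:E = - \int[lam]_(eta in A) (v eta * m eta)%:E)%E.
    rewrite -integralN; first exact: eq_integral.
    by apply: integrable_add_def => //; exact: integrableS ivm.
  rewrite pA// -EFinN lee_fin; apply: (le_trans _ (bd _ (vA _ mA).1)).
  by rewrite -normrN ler_norm.
apply: filterS2 le1 le2 => eta; rewrite -cv => l1 l2.
rewrite -(ler_pM2l (v0 eta)) -[X in X * `|_|]gtr0_norm// -normrM ler_norml.
rewrite (_ : v eta * (M * c ^+ #|` eta|) = M * (c ^+ #|` eta| * v eta)); last by ring.
by rewrite l1 andbT lerNl.
Qed.

End duality.

(** * The birth operator *)

(** The coincidence of x with a point of eta is negligible term by term in the number of points. *)
Lemma eq_integral_lebesgue_poisson disp (T : measurableType disp) (R : realType)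
    (mu : {sigma_finite_measure set T -> \bar R}) (F1 F2 : T -> {fset T} -> \bar R) :
  measurable [set p : T * T | p.1 = p.2] -> (forall x, mu [set x] = 0%E) ->
  (forall x eta, 0 <= F1 x eta)%E -> (forall x eta, 0 <= F2 x eta)%E ->
  jointly_measurable F1 -> jointly_measurable F2 ->
  (forall x eta, x \notin eta -> F1 x eta = F2 x eta) ->
  (\int[mu]_x \int[lebesgue_poisson mu]_eta F1 x eta =
   \int[mu]_x \int[lebesgue_poisson mu]_eta F2 x eta)%E.
Proof.
move=> diag atomless F10 F20 mF1 mF2 F12.
have E F : (forall x eta, 0 <= F x eta)%E -> jointly_measurable F ->
    (\int[mu]_x \int[lebesgue_poisson mu]_eta F x eta =
     \sum_(n <oo) \int[mu]_x lp_term mu n (F x))%E.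
  move=> F0 mF; rewrite -integral_nneseries//.
  - apply: eq_integral => x _; rewrite integral_lebesgue_poisson//.
    exact: (jointly_measurable_fun x mF).
  - by move=> n; exact: measurable_lp_term.
  - by move=> n x _; exact: lp_term_ge0.
apply: (etrans (E F1 F10 mF1)); apply: (etrans _ (esym (E F2 F20 mF2))).
apply: eq_eseriesr => n _.
exact: (@eq_integral_lp_term _ _ _ mu diag atomless n F1 F2 F10 F20 mF1 mF2 F12).
Qed.

Lemma jointly_measurable_slice disp (T : measurableType disp) dD (D : measurableType dD)
    dY (Y : measurableType dY) (F : D -> {fset T} -> Y) eta :
  jointly_measurable F -> measurable_fun setT (fun d => F d eta).
Proof.
move=> mF; rewrite (_ : eta = fset_of_tuple (in_tuple eta)).
  have mg : measurable_fun setT (fun d : D => (d, in_tuple eta)).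
    by apply: measurable_fun_pair => //; exact: measurable_cst.
  exact: (measurableT_comp (mF (size eta)) mg).
by apply/fsetP => y; rewrite !inE.
Qed.

Lemma measurable_integral_lebesgue_poisson disp (T : measurableType disp) (R : realType)
    (mu : {sigma_finite_measure set T -> \bar R}) dD (D : measurableType dD)
    (F : D -> {fset T} -> \bar R) :
  (forall x eta, 0 <= F x eta)%E -> jointly_measurable F ->
  measurable_fun setT (fun x => \int[lebesgue_poisson mu]_eta F x eta)%E.
Proof.
move=> F0 mF; rewrite (_ : (fun _ => _) = (fun x => \sum_(n <oo) lp_term mu n (F x))%E).
  apply: ge0_emeasurable_sum; first by move=> n x _ _; exact: lp_term_ge0.
  by move=> n _; exact: measurable_lp_term.
by apply/funext => x; rewrite integral_lebesgue_poisson//; exact: jointly_measurable_fun.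
Qed.

Section birth_operator.
Context (R : realType) (d : nat) (d_gt0 : (0 < d)%N).
Local Notation conf := {fset 'rV[R]_d}.
Local Notation lam := (lambda R d).
Local Notation mu := (lebesgue_measure_row R d).
Variable phi : 'rV[R]_d -> R.
Hypotheses (mphi : measurable_fun setT phi) (phi_ge0 : forall x, 0 <= phi x)
  (phi_even : forall x, phi (- x) = phi x) (Cphi_fin : (C_phi phi < +oo)%E).
Implicit Types (G H : conf -> R) (w : 'rV[R]_d -> R) (x y : 'rV[R]_d) (eta xi : conf).

Let diag := @measurable_row_diagonal R d.
Let atomless : forall x, mu [set x] = 0%E.
Proof. by move=> x; exact: lebesgue_measure_row_set1. Qed.

Definition boltzmann x y : R := expR (- phi (x - y)).

(** Minus the Mayer function. It is nonnegative for a nonnegative potential, and by translation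
    invariance and evenness its integral over y is [cphi] for every x. *)
Definition mayer x y : R := 1 - boltzmann x y.

Let bz_ge0 x y : 0 <= boltzmann x y. Proof. exact: expR_ge0. Qed.

Let bz_le1 x y : boltzmann x y <= 1.
Proof. by rewrite -expR0 ler_expR oppr_le0. Qed.

Let my_ge0 x y : 0 <= mayer x y. Proof. by rewrite subr_ge0. Qed.

Lemma measurable_boltzmann :
  measurable_fun setT (fun p : 'rV[R]_d * 'rV[R]_d => boltzmann p.1 p.2).
Proof.
have mB : measurable_fun setT (fun p : 'rV[R]_d * 'rV[R]_d => p.1 - p.2).
  apply: measurable_fun_rowP => i; under eq_fun do rewrite !mxE.
  apply: measurable_funB.
    exact: (measurableT_comp (measurable_row_coord i) measurable_fst).
  exact: (measurableT_comp (measurable_row_coord i) measurable_snd).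
apply: measurableT_comp; first exact: measurable_expR.
exact: measurable_funN (measurableT_comp mphi mB).
Qed.

Lemma measurable_mayer :
  measurable_fun setT (fun p : 'rV[R]_d * 'rV[R]_d => mayer p.1 p.2).
Proof.
by apply: measurable_funB; [exact: measurable_cst|exact: measurable_boltzmann].
Qed.

Definition cphi : R := fine (C_phi phi).

Lemma integral_mayer x : (\int[mu]_y (mayer x y)%:E = cphi%:E)%E.
Proof.
have mf : measurable_fun setT (fun y : 'rV[R]_d => (1 - expR (- phi y))%:E).
  apply/measurable_EFinP; apply: measurable_funB; first exact: measurable_cst.
  by apply: measurableT_comp; [exact: measurable_expR|exact: measurable_funN].
have f0 y : (0 <= (1 - expR (- phi y))%:E)%E.
  by rewrite lee_fin subr_ge0 -expR0 ler_expR oppr_le0.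
rewrite /cphi fineK; last by rewrite ge0_fin_numE//; exact: integral_ge0.
rewrite /C_phi -(ge0_integral_row_shift (- x) mf f0); apply: eq_integral => y _.
by rewrite /mayer /boltzmann -(phi_even (x - y)) opprB.
Qed.

Definition birth_integrand G x xi zeta : R :=
  expR (- rel_energy phi x xi) * G (x |` xi)%fset *
    e_lambda (fun y => expR (- phi (x - y)) - 1) zeta.

Lemma birth_integrandE G x xi zeta : birth_integrand G x xi zeta =
  fset_prod (boltzmann x) xi * G (x |` xi)%fset *
  fset_prod (fun y => boltzmann x y - 1) zeta.
Proof.
rewrite /birth_integrand; congr (_ * _ * _).
rewrite /rel_energy /fset_prod -sumrN (big_morph expR (id1 := 1) (op1 := *%R))//.
  by move=> a b; rewrite expRD.
exact: expR0.
Qed.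

(** w weights the location of the new point: the constant 1 gives the birth part of [hatL], the
    indicator of a cube the truncated births of the discrete step. *)
Definition birth w G eta : R :=
  \sum_(xi <- fpowerset eta)
    \int[mu]_x (w x * birth_integrand G x xi (eta `\` xi)%fset).

(** The sum of the absolute values of the birth integrands at eta ([sum_norm_birth_integrand]). Its
    integrability against w is absolute convergence of [birth], and as a [subset_sum] it falls under
    the exponential estimate. *)
Definition birth_density G x eta : R :=
  subset_sum (mayer x) (fun xi => fset_prod (boltzmann x) xi * `|G (x |` xi)%fset|) eta.

Lemma birth_density_ge0 G x eta : 0 <= birth_density G x eta.
Proof.
by apply: subset_sum_ge0 => // xi; rewrite mulr_ge0//; exact: fset_prod_ge0.
Qed.

Lemma sum_norm_birth_integrand G x eta :
  \sum_(xi <- fpowerset eta) `|birth_integrand G x xi (eta `\` xi)%fset| =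
  birth_density G x eta.
Proof.
apply: eq_bigr => xi _; rewrite birth_integrandE !normrM !normr_fset_prod mulrC.
congr (_ * (_ * _)); apply: eq_bigr => y _.
  by rewrite distrC; exact: ger0_norm (my_ge0 x y).
exact: ger0_norm.
Qed.

Lemma jointly_measurable_birth_integrand dD (D : measurableType dD)
    (h : D -> 'rV[R]_d) n (s : D -> n.-tuple 'rV[R]_d) G :
  measurable_fun setT h -> measurable_fun setT s -> measurable_fun setT G ->
  jointly_measurable (fun d xi => birth_integrand G (h d) xi (fset_of_tuple (s d))).
Proof.
move=> mh ms mG.
have j1 : jointly_measurable (fun d => fset_prod (boltzmann (h d))).
  apply: (jointly_measurable_fset_prod diag (f := fun d => boltzmann (h d))).
  have mp : measurable_fun setT (fun p : D * 'rV[R]_d => (h p.1, p.2)).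
    by apply: measurable_fun_pair => //; exact: measurableT_comp.
  exact: (measurableT_comp measurable_boltzmann mp).
have j2 : jointly_measurable (fun d xi => G (h d |` xi)%fset).
  exact: (jointly_measurable_comp mh (jointly_measurable_insert_fun mG)).
have m3 : measurable_fun setT (fun d => fset_prod (fun y => boltzmann (h d) y - 1) (fset_of_tuple (s d))).
  have j : jointly_measurable (fun x : 'rV[R]_d => fset_prod (fun y => boltzmann x y - 1)).
    apply: (jointly_measurable_fset_prod diag (f := fun x y => boltzmann x y - 1)).
    by apply: measurable_funB; [exact: measurable_boltzmann|exact: measurable_cst].
  exact: (measurableT_comp (j n) (measurable_fun_pair mh ms)).
have := jointly_measurableM (jointly_measurableM j1 j2) (jointly_measurable_param m3).
rewrite (_ : (fun d xi => birth_integrand _ _ _ _) = (fun d xi => fset_prod (boltzmann (h d)) xi *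
    G (h d |` xi)%fset * fset_prod (fun y => boltzmann (h d) y - 1) (fset_of_tuple (s d)))) //.
by apply/funext => p; apply/funext => xi; rewrite birth_integrandE.
Qed.

Lemma measurable_birth w G : measurable_fun setT w -> measurable_fun setT G ->
  measurable_fun setT (birth w G).
Proof.
move=> mw mG.
apply: (@jointly_measurable_fun _ _ _ unit _ _ (fun=> birth w G) tt).
apply: (jointly_measurable_partition_sum diag
  (H := fun _ xi zeta => \int[mu]_x (w x * birth_integrand G x xi zeta))) => m.
apply: (jointly_measurable_Rintegral mu
  (F := fun (p : (unit * m.-tuple 'rV[R]_d) * 'rV[R]_d) xi =>
     w p.2 * birth_integrand G p.2 xi (fset_of_tuple p.1.2))).
apply: jointly_measurableM.
  apply: jointly_measurable_param; exact: (measurableT_comp mw measurable_snd).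
apply: (jointly_measurable_birth_integrand (h := snd)
  (s := fun p : (unit * m.-tuple 'rV[R]_d) * 'rV[R]_d => p.1.2)) => //.
exact: (measurableT_comp measurable_snd measurable_fst).
Qed.

Lemma jointly_measurable_birth_density G : measurable_fun setT G ->
  jointly_measurable (birth_density G).
Proof.
move=> mG; apply: (jointly_measurable_subset_sum diag measurable_mayer).
apply: jointly_measurableM.
  exact: (jointly_measurable_fset_prod diag measurable_boltzmann).
apply: (jointly_measurable_insert_fun (F := fun xi => `|G xi|)).
exact: measurableT_comp.
Qed.

(** Origin of $e^{cC_\phi}/c$: convolution with [c * mayer x] costs the exponential of its integral
    $cC_\phi$. Mecke's identity then turns the integral over x into [fset_sum w], where $c^{|\eta|}$
    falls short of $c^{|\eta\cup x|}$ by one factor c. *)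
Lemma integral_birth_density_le c w G : 1 <= c -> (forall x, 0 <= w x) ->
  measurable_fun setT w -> measurable_fun setT G ->
  (\int[lam]_eta ((c ^+ #|` eta|)%:E * \int[mu]_x (w x * birth_density G x eta)%:E) <=
   (expR (c * cphi) / c)%:E *
   \int[lam]_eta (fset_sum w eta * (c ^+ #|` eta| * `|G eta|))%:E)%E.
Proof.
move=> c1 w0 mw mG; have c0 : 0 < c by lra.
have cn0 (eta : conf) : 0 <= c ^+ #|` eta| by rewrite exprn_ge0// ltW.
have jbd := jointly_measurable_birth_density mG.
have mc := @measurable_card_power R d c.
have jw : jointly_measurable (fun x (eta : conf) => w x) by exact: jointly_measurable_param.
have jc : jointly_measurable (fun (x : 'rV[R]_d) (eta : conf) => c ^+ #|` eta|).
  exact: jointly_measurableW.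
have bd0 x eta := birth_density_ge0 G x eta.
pose cG eta := c ^+ #|` eta| * `|G eta|.
have mcG : measurable_fun setT cG by apply: measurable_funM => //; exact: measurableT_comp.
have cG0 eta : 0 <= cG eta by rewrite mulr_ge0.
pose F x eta := (w x * (c ^+ #|` eta| * birth_density G x eta))%:E.
have jF : jointly_measurable F.
  move=> n; apply/measurable_EFinP.
  exact: (jointly_measurableM jw (jointly_measurableM jc jbd)).
have F0 x eta : (0 <= F x eta)%E by rewrite lee_fin !mulr_ge0.
have jcGx : jointly_measurable (fun x eta => c ^+ #|` eta| * `|G (x |` eta)%fset|).
  apply: jointly_measurableM => //.
  by apply: (jointly_measurable_insert_fun (F := fun xi => `|G xi|)); exact: measurableT_comp.
(* [c^|.| S_f D_g = S_(cf) D_g c^|.|], and the Boltzmann factor is at most 1 *)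
have step x : (\int[lam]_eta (c ^+ #|` eta| * birth_density G x eta)%:E <=
    (expR (c * cphi))%:E * \int[lam]_eta (c ^+ #|` eta| * `|G (x |` eta)%fset|)%:E)%E.
  have mfx : measurable_fun setT (fun y => c * mayer x y).
    apply: measurable_funM => //.
    exact: (measurableT_comp measurable_mayer (pair1_measurable x)).
  have mH : measurable_fun setT (fun eta => c ^+ #|` eta| * `|G (x |` eta)%fset|).
    exact: (jointly_measurable_fun x jcGx).
  have H0 eta : 0 <= c ^+ #|` eta| * `|G (x |` eta)%fset| by rewrite mulr_ge0.
  have f0 y : 0 <= c * mayer x y by rewrite mulr_ge0// ltW.
  have fint : (\int[mu]_y (c * mayer x y)%:E = (c * cphi)%:E)%E.
    rewrite EFinM -(integral_mayer x) -ge0_integralZl//.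
    - by apply/measurable_EFinP; exact: (measurableT_comp measurable_mayer (pair1_measurable x)).
    - by move=> y _; rewrite lee_fin.
    - by rewrite lee_fin ltW.
  apply: (le_trans _ (integral_subset_sum_le diag atomless f0 H0 mfx mH fint)).
  apply: ge0_le_integral => //.
  - by move=> eta _; rewrite lee_fin mulr_ge0.
  - by apply/measurable_EFinP; apply: measurable_funM => //; exact: (jointly_measurable_fun x jbd).
  - by apply/measurable_EFinP; exact: (measurable_subset_sum diag).
  - move=> eta _; rewrite lee_fin -fset_prod_cst.
    rewrite -[leLHS]/(subset_scale _ _ _) subset_scale_sum.
    apply: ler_sum => xi _; apply: ler_wpM2l.
      by apply: fset_prod_ge0 => y; rewrite mulr_ge0// ltW.
    rewrite /subset_scale fset_prod_cst ler_wpM2l// -[leRHS]mul1r ler_wpM2r//.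
    by apply: fset_prod_le1 => y; rewrite bz_ge0 bz_le1.
have -> : (\int[lam]_eta ((c ^+ #|` eta|)%:E * \int[mu]_x (w x * birth_density G x eta)%:E) =
    \int[mu]_x \int[lam]_eta F x eta)%E.
  rewrite -integral_lebesgue_poisson_swap//; apply: eq_integral => eta _.
  rewrite -ge0_integralZl//.
  - by apply: eq_integral => x _; rewrite -EFinM mulrCA.
  - apply/measurable_EFinP; apply: measurable_funM => //.
    exact: (jointly_measurable_slice eta jbd).
  - by move=> x _; rewrite lee_fin mulr_ge0.
  - by rewrite lee_fin.
have mjx x : measurable_fun setT (fun eta : conf => (c ^+ #|` eta| * `|G (x |` eta)%fset|)%:E).
  by apply/measurable_EFinP; exact: (jointly_measurable_fun x jcGx).
have {step} [I [I0 mI IE step]] : exists I : 'rV[R]_d -> \bar R,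
    [/\ forall x, (0 <= I x)%E, measurable_fun setT I,
      forall x, I x = (\int[lam]_eta (c ^+ #|` eta| * `|G (x |` eta)%fset|)%:E)%E &
      forall x, (\int[lam]_eta (c ^+ #|` eta| * birth_density G x eta)%:E <=
        (expR (c * cphi))%:E * I x)%E].
  exists (fun x => \int[lam]_eta (c ^+ #|` eta| * `|G (x |` eta)%fset|)%:E)%E; split => //.
    by move=> x; apply: integral_ge0 => e _; rewrite lee_fin mulr_ge0.
  apply: measurable_integral_lebesgue_poisson => [x e|n]; first by rewrite lee_fin mulr_ge0.
  by apply/measurable_EFinP; exact: jcGx.
have mwE : measurable_fun setT (EFin \o w) by exact/measurable_EFinP.
have wI0 x : (0 <= (w x)%:E * I x)%E by rewrite mule_ge0// lee_fin.
have mwI : measurable_fun setT (fun x => (w x)%:E * I x)%E by exact: emeasurable_funM.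
have pullmu b : 0 <= b ->
    (b%:E * \int[mu]_x ((w x)%:E * I x) = \int[mu]_x (b%:E * ((w x)%:E * I x)))%E.
  by move=> b0; rewrite ge0_integralZl// lee_fin.
have Eint : (\int[mu]_x \int[lam]_eta F x eta <= (expR (c * cphi))%:E * \int[mu]_x ((w x)%:E * I x))%E.
  rewrite pullmu ?expR_ge0//.
  apply: (@ge0_le_integral _ _ _ mu setT measurableT).
    - by move=> x _; exact: integral_ge0.
    - exact: measurable_integral_lebesgue_poisson.
    - exact: measurable_funeM.
    - move=> x _; rewrite /F; under eq_integral do rewrite EFinM.
      rewrite ge0_integralZl//.
      + by rewrite muleCA; apply: lee_wpmul2l; [rewrite lee_fin|exact: step].
      + by apply/measurable_EFinP; apply: measurable_funM => //; exact: (jointly_measurable_fun x jbd).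
      + by move=> eta _; rewrite lee_fin mulr_ge0.
      + by rewrite lee_fin.
apply: (le_trans Eint).
have jcG : jointly_measurable (fun x eta => cG (x |` eta)%fset) by exact: jointly_measurable_insert_fun.
have mcGx x : measurable_fun setT (fun eta : conf => cG (x |` eta)%fset).
  exact: (jointly_measurable_fun x jcG).
have pull b (h : conf -> R) : 0 <= b -> (forall eta, 0 <= h eta) -> measurable_fun setT h ->
    (\int[lam]_eta (b * h eta)%:E = b%:E * \int[lam]_eta (h eta)%:E)%E.
  move=> b0 h0 mh; rewrite -(@ge0_integralZl _ _ _ lam setT measurableT (fun eta => (h eta)%:E)).
  - by apply: eq_integral => eta _; rewrite !EFinM.
  - exact/measurable_EFinP.
  - by move=> eta _; rewrite lee_fin.
  - by rewrite lee_fin.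
have E : (c%:E * \int[mu]_x ((w x)%:E * I x) =
    \int[lam]_eta (fset_sum w eta * cG eta)%:E)%E.
  apply: (etrans _ (integral_mecke diag atomless w0 cG0 mw mcG)).
  rewrite pullmu ?(ltW c0)//.
  transitivity (\int[mu]_x \int[lam]_eta (c * (w x * (c ^+ #|` eta| * `|G (x |` eta)%fset|)))%:E)%E.
    apply: eq_integral => x _; rewrite pull ?(ltW c0)//.
    + rewrite pull//; first by rewrite IE.
      * by move=> e; rewrite mulr_ge0.
      * exact: (jointly_measurable_fun x jcGx).
    + by move=> e; rewrite !mulr_ge0.
    + by apply: measurable_funM => //; exact: (jointly_measurable_fun x jcGx).
  transitivity (\int[mu]_x \int[lam]_eta (w x * cG (x |` eta)%fset)%:E)%E.
    apply: (eq_integral_lebesgue_poisson diag atomless).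
    - by move=> x eta; rewrite lee_fin !mulr_ge0// ltW.
    - by move=> x eta; rewrite lee_fin !mulr_ge0.
    - move=> n; apply/measurable_EFinP; apply: measurable_funM => //.
      exact: (jointly_measurableM jw jcGx).
    - by move=> n; apply/measurable_EFinP; exact: (jointly_measurableM jw jcG).
    - by move=> x eta xe; rewrite /cG cardfsU1 xe exprS mulrCA !mulrA.
  by apply: eq_integral => x _; rewrite pull.
rewrite [leRHS](_ : _ = (expR (c * cphi) / c)%:E * (c%:E * \int[mu]_x ((w x)%:E * I x)))%E; last first.
  by rewrite E.
by rewrite muleA -EFinM mulfVK// gt_eqF.
Qed.

End birth_operator.

Section birth_estimates.
Context (R : realType) (d : nat) (d_gt0 : (0 < d)%N).
Local Notation conf := {fset 'rV[R]_d}.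
Local Notation lam := (lambda R d).
Local Notation mu := (lebesgue_measure_row R d).
Variable phi : 'rV[R]_d -> R.
Hypotheses (mphi : measurable_fun setT phi) (phi_ge0 : forall x, 0 <= phi x)
  (phi_even : forall x, phi (- x) = phi x) (Cphi_fin : (C_phi phi < +oo)%E).
Implicit Types (G H : conf -> R) (w : 'rV[R]_d -> R) (x y : 'rV[R]_d) (eta xi : conf).

Let diag := @measurable_row_diagonal R d.
Local Notation birth_integrand := (birth_integrand phi).
Local Notation birth_density := (birth_density phi).
Local Notation birth := (birth phi).
Local Notation cphi := (cphi phi).

(** [birth] gives divergent integrals a real value by convention, so its linearity in G and in w is
    asserted only at configurations with this property. *)
Definition birth_finite w G eta :=
  (\int[mu]_x (w x * birth_density G x eta)%:E < +oo)%E.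

Let bd0 G x eta : 0 <= birth_density G x eta.
Proof. exact: birth_density_ge0. Qed.

Lemma norm_birth_integrand_le G x eta xi : xi \in fpowerset eta ->
  `|birth_integrand G x xi (eta `\` xi)%fset| <= birth_density G x eta.
Proof.
move=> xe; rewrite -sum_norm_birth_integrand// (big_fsetD1 xi)//=.
by rewrite lerDl sumr_ge0.
Qed.

Lemma measurable_birth_integrand G xi zeta : measurable_fun setT G ->
  measurable_fun setT (fun x => birth_integrand G x xi zeta).
Proof.
move=> mG; rewrite (_ : zeta = fset_of_tuple (in_tuple zeta)); last first.
  by apply/fsetP => y; rewrite !inE.
apply: (jointly_measurable_slice xi (F := fun x xi => birth_integrand G x xi _)).
apply: (jointly_measurable_birth_integrand mphi (h := id) (s := cst (in_tuple zeta))) => //.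
Qed.

Lemma measurable_birth_density G eta : measurable_fun setT G ->
  measurable_fun setT (fun x => birth_density G x eta).
Proof.
move=> mG; apply: (jointly_measurable_slice eta (F := birth_density G)).
exact: jointly_measurable_birth_density.
Qed.

Lemma birth_integrable w G eta xi : (forall x, 0 <= w x) -> measurable_fun setT w ->
  measurable_fun setT G -> birth_finite w G eta -> xi \in fpowerset eta ->
  mu.-integrable setT (fun x => (w x * birth_integrand G x xi (eta `\` xi)%fset)%:E).
Proof.
move=> w0 mw mG fin xe.
have mi : measurable_fun setT (fun x => w x * birth_integrand G x xi (eta `\` xi)%fset).
  by apply: measurable_funM => //; exact: measurable_birth_integrand.
apply/integrableP; split; first exact/measurable_EFinP.
apply: le_lt_trans fin; apply: ge0_le_integral => //.
- by apply: measurableT_comp => //; exact/measurable_EFinP.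
- by apply/measurable_EFinP; apply: measurable_funM => //; exact: measurable_birth_density.
- move=> x _; rewrite /= lee_fin normrM ger0_norm// ler_wpM2l//.
  exact: norm_birth_integrand_le.
Qed.

Lemma birth_lin w a G H eta : (forall x, 0 <= w x) -> measurable_fun setT w ->
  measurable_fun setT G -> measurable_fun setT H ->
  birth_finite w G eta -> birth_finite w H eta ->
  birth w (fun xi => a * G xi + H xi) eta = a * birth w G eta + birth w H eta.
Proof.
move=> w0 mw mG mH fG fH; rewrite /birth mulr_sumr -big_split/=.
apply: eq_big_seq => xi xe.
have iG := birth_integrable w0 mw mG fG xe; have iH := birth_integrable w0 mw mH fH xe.
rewrite -RintegralZl// -RintegralD//; last first.
  exact: (integrableZl measurableT a iG).
by apply: eq_Rintegral => x _; rewrite !birth_integrandE; ring.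
Qed.

Lemma birth_weightD w1 w2 G eta : (forall x, 0 <= w1 x) -> measurable_fun setT w1 ->
  (forall x, 0 <= w2 x) -> measurable_fun setT w2 -> measurable_fun setT G ->
  birth_finite w1 G eta -> birth_finite w2 G eta ->
  birth (fun x => w1 x + w2 x) G eta = birth w1 G eta + birth w2 G eta.
Proof.
move=> w10 mw1 w20 mw2 mG f1 f2; rewrite /birth -big_split/=.
apply: eq_big_seq => xi xe.
rewrite -RintegralD//; [|exact: birth_integrable..].
by apply: eq_Rintegral => x _; rewrite mulrDl.
Qed.

Lemma norm_birth_le w G eta : (forall x, 0 <= w x) -> measurable_fun setT w ->
  measurable_fun setT G ->
  (`|birth w G eta|%:E <= \int[mu]_x (w x * birth_density G x eta)%:E)%E.
Proof.
move=> w0 mw mG.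
have mB xi : measurable_fun setT (fun x => `|w x * birth_integrand G x xi (eta `\` xi)%fset|%:E).
  apply/measurable_EFinP; apply: measurableT_comp => //.
  by apply: measurable_funM => //; exact: measurable_birth_integrand.
(* If the right-hand side is infinite the bound is trivial; otherwise each integral in [birth]
   converges absolutely. *)
have [fin|] := boolP (`[< birth_finite w G eta >]); last first.
  by move=> /asboolPn; rewrite /birth_finite ltey => /negP; rewrite negbK => /eqP ->; rewrite leey.
have {}fin := asboolW fin.
have -> : (\int[mu]_x (w x * birth_density G x eta)%:E = \sum_(xi <- fpowerset eta)
    \int[mu]_x (`|w x * birth_integrand G x xi (eta `\` xi)%fset|)%:E)%E.
  rewrite -ge0_integral_sum//.
  apply: eq_integral => x _.
  rewrite -(@sum_norm_birth_integrand _ _ _ phi_ge0 G x eta).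
  rewrite mulr_sumr.
  rewrite sumEFin; congr EFin.
  by apply: eq_bigr => xi _; rewrite [RHS]normrM (ger0_norm (w0 x)).
rewrite (le_trans (_ : _ <= (\sum_(xi <- fpowerset eta)
  `|\int[mu]_x (w x * birth_integrand G x xi (eta `\` xi)%fset)|)%:E)%E)//.
  by rewrite lee_fin ler_norm_sum.
rewrite -sumEFin big_seq [in leRHS]big_seq; apply: lee_sum => xi xe.
have ib := birth_integrable w0 mw mG fin xe.
rewrite EFin_normr_Rintegral//; apply: le_abse_integral => //.
by case/integrableP : ib.
Qed.

Lemma measurable_integral_birth_density w G : (forall x, 0 <= w x) ->
  measurable_fun setT w -> measurable_fun setT G ->
  measurable_fun setT (fun eta => \int[mu]_x (w x * birth_density G x eta)%:E)%E.
Proof.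
move=> w0 mw mG.
pose F (p : unit * 'rV[R]_d) eta := (w p.2 * birth_density G p.2 eta)%:E.
apply: (jointly_measurable_fun (F := fun u eta => (\int[mu]_x F (u, x) eta)%E) tt).
apply: (jointly_measurable_integral mu (F := F)) => [p eta|n].
  by rewrite lee_fin mulr_ge0.
have j1 : jointly_measurable (fun (p : unit * 'rV[R]_d) (_ : conf) => w p.2).
  exact: (jointly_measurable_param (measurableT_comp mw measurable_snd)).
have j2 : jointly_measurable (fun (p : unit * 'rV[R]_d) => birth_density G p.2).
  apply: (jointly_measurable_comp (F := birth_density G) (h := snd)) => //.
  exact: jointly_measurable_birth_density.
by apply/measurable_EFinP; exact: (jointly_measurableM j1 j2).
Qed.

Lemma normL_birth_le c w G : 1 <= c -> (forall x, 0 <= w x) ->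
  measurable_fun setT w -> measurable_fun setT G ->
  (normL c (birth w G) <= (expR (c * cphi) / c)%:E *
   \int[lam]_eta (fset_sum w eta * (c ^+ #|` eta| * `|G eta|))%:E)%E.
Proof.
move=> c1 w0 mw mG; have c0 : 0 < c by lra.
apply: le_trans (integral_birth_density_le d_gt0 mphi phi_ge0 phi_even Cphi_fin c1 w0 mw mG).
rewrite normLE ?(ltW c0)//; apply: ge0_le_integral => //.
- by move=> eta _; rewrite lee_fin mulr_ge0// exprn_ge0// ltW.
- by apply: measurable_weighted_norm; exact: measurable_birth.
- apply: emeasurable_funM.
    by apply/measurable_EFinP; exact: measurable_card_power.
  exact: measurable_integral_birth_density.
- move=> eta _; rewrite EFinM; apply: lee_wpmul2l; last exact: norm_birth_le.
  by rewrite lee_fin exprn_ge0// ltW.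
Qed.

Lemma birth_finite_ae c w G : 1 <= c -> (forall x, 0 <= w x) ->
  measurable_fun setT w -> measurable_fun setT G ->
  (\int[lam]_eta (fset_sum w eta * (c ^+ #|` eta| * `|G eta|))%:E < +oo)%E ->
  {ae lam, forall eta, birth_finite w G eta}.
Proof.
move=> c1 w0 mw mG fin; have c0 : 0 < c by lra.
have I0 eta : (0 <= \int[mu]_x (w x * birth_density G x eta)%:E)%E.
  by apply: integral_ge0 => x _; rewrite lee_fin mulr_ge0.
have Fint : lam.-integrable setT (fun eta => (c ^+ #|` eta|)%:E *
    \int[mu]_x (w x * birth_density G x eta)%:E)%E.
  apply/integrableP; split.
    apply: emeasurable_funM; last exact: measurable_integral_birth_density.
    by apply/measurable_EFinP; exact: measurable_card_power.
  under eq_integral => eta _.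
    rewrite gee0_abs; first over.
    by rewrite mule_ge0// lee_fin exprn_ge0// ltW.
  apply: (le_lt_trans (integral_birth_density_le d_gt0 mphi phi_ge0 phi_even Cphi_fin c1 w0 mw mG)).
  by rewrite lte_mul_pinfty// lee_fin divr_ge0// ?expR_ge0// ltW.
have := integrable_ae measurableT Fint; apply: filterS => eta /(_ I).
rewrite /birth_finite; case: (\int[mu]_x _)%E (I0 eta) => [r _ _||//]; first exact: ltry.
by rewrite gt0_muley// lte_fin exprn_gt0.
Qed.

End birth_estimates.

(** * Discrete-time birth-and-death steps *)

Section birth_death_step.
Context (R : realType) (d : nat) (d_gt0 : (0 < d)%N).
Local Notation conf := {fset 'rV[R]_d}.
Local Notation lam := (lambda R d).
Local Notation mu := (lebesgue_measure_row R d).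
Variable phi : 'rV[R]_d -> R.
Hypotheses (mphi : measurable_fun setT phi) (phi_ge0 : forall x, 0 <= phi x)
  (phi_even : forall x, phi (- x) = phi x) (Cphi_fin : (C_phi phi < +oo)%E).
Variables (z C : R).
Hypotheses (z_ge0 : 0 <= z) (C_ge1 : 1 <= C) (zC : z * (expR (C * cphi phi) / C) <= 1).
Implicit Types (G H : conf -> R) (w : 'rV[R]_d -> R) (x y : 'rV[R]_d) (eta xi : conf).

Local Notation birth := (birth phi).
Local Notation cphi := (cphi phi).
Local Notation birth_finite := (birth_finite phi).

Let C_gt0 : 0 < C. Proof. exact: lt_le_trans C_ge1. Qed.

Let Cn_ge0 (eta : conf) : 0 <= C ^+ #|` eta|.
Proof. by rewrite exprn_ge0// ltW. Qed.

(** Independent thinning with survival probability 1 - delta, as it acts on inverse K-transforms;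
    compare [subset_positive_damp]. *)
Definition damp (delta : R) G eta : R := (1 - delta) ^+ #|` eta| * G eta.

Definition bd_step delta w G eta :=
  damp delta G eta + delta * z * birth w (damp delta G) eta.

(** By induction: $(1+\delta(n+1))(1-\delta) = 1+\delta n-\delta^2(n+1) \le 1+\delta n$. *)
Lemma bernoulli_damp (delta : R) n : 0 <= delta <= 1 ->
  (1 + delta * n%:R) * (1 - delta) ^+ n <= 1.
Proof.
move=> /andP[d0 d1]; elim: n => [|n IH]; first by rewrite mulr0 addr0 mulr1.
have p0 : 0 <= (1 - delta) ^+ n by rewrite exprn_ge0// subr_ge0.
apply: le_trans IH; rewrite exprS mulrA ler_wpM2r// -natr1.
have := ler0n R n; nra.
Qed.

Lemma measurable_damp delta G : measurable_fun setT G ->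
  measurable_fun setT (damp delta G).
Proof. by move=> mG; apply: measurable_funM => //; exact: measurable_card_power. Qed.

Lemma fset_sum_le_card w eta : (forall x, w x <= 1) -> fset_sum w eta <= #|` eta|%:R.
Proof. by move=> w1; rewrite -(fset_sum1 R); apply: ler_sum. Qed.

Lemma fset_sum_ge0 w eta : (forall x, 0 <= w x) -> 0 <= fset_sum w eta.
Proof. by move=> w0; apply: sumr_ge0. Qed.

Lemma measurable_damp_moment delta w G : measurable_fun setT w -> measurable_fun setT G ->
  measurable_fun setT (fun eta => fset_sum w eta * (C ^+ #|` eta| * `|damp delta G eta|)).
Proof.
move=> mw mG; apply: measurable_funM.
  by apply: measurable_fset_sum mw; exact: measurable_row_diagonal.
apply: measurable_funM; first exact: measurable_card_power.
by apply: measurableT_comp => //; exact: measurable_damp.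
Qed.

(* Bernoulli: the mass lost by thinning pays for the births. *)
Lemma damp_moment delta w G : 0 <= delta <= 1 -> (forall x, 0 <= w x <= 1) ->
  measurable_fun setT w -> measurable_fun setT G ->
  (normL C (damp delta G) + delta%:E *
    \int[lam]_eta (fset_sum w eta * (C ^+ #|` eta| * `|damp delta G eta|))%:E <=
   normL C G)%E.
Proof.
move=> d01 w01 mw mG; have /andP[d0 d1] := d01.
have w0 x : 0 <= w x by have /andP[] := w01 x.
have s0 eta : 0 <= fset_sum w eta by exact: fset_sum_ge0.
have mm := measurable_damp_moment delta mw mG.
rewrite -ge0_integralZl//; first last.
- by move=> eta _; rewrite lee_fin !mulr_ge0.
- exact/measurable_EFinP.
rewrite !normLE ?(ltW C_gt0)// -ge0_integralD//; first last.
- by apply: measurable_funeM; exact/measurable_EFinP.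
- by move=> eta _; rewrite -EFinM lee_fin !mulr_ge0.
- by apply: measurable_weighted_norm; exact: measurable_damp.
- by move=> eta _; rewrite lee_fin !mulr_ge0.
apply: ge0_le_integral => //.
- by move=> eta _; rewrite -EFinM -EFinD lee_fin addr_ge0// !mulr_ge0.
- apply: emeasurable_funD; first by apply: measurable_weighted_norm; exact: measurable_damp.
  by apply: measurable_funeM; exact/measurable_EFinP.
- exact: measurable_weighted_norm.
- move=> eta _; rewrite -EFinM -EFinD lee_fin.
  have p0 : 0 <= (1 - delta) ^+ #|` eta| by rewrite exprn_ge0// subr_ge0.
  rewrite /damp normrM (ger0_norm p0).
  rewrite (_ : _ + _ = (1 + delta * fset_sum w eta) * (1 - delta) ^+ #|` eta| *
    (C ^+ #|` eta| * `|G eta|)); last by ring.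
  rewrite -[leRHS]mul1r ler_wpM2r ?mulr_ge0//.
  apply: le_trans (bernoulli_damp #|` eta| d01).
  rewrite ler_wpM2r// lerD2l ler_wpM2l//.
  by apply: fset_sum_le_card => x; have /andP[] := w01 x.
Qed.

(** For delta > 0, [damp_moment] bounds delta times the moment by the norm: thinning gives every G
    in L_C a finite first moment, so the births of the step converge almost everywhere on all of
    L_C. *)
Lemma damp_moment_fin delta w G : 0 < delta <= 1 -> (forall x, 0 <= w x <= 1) ->
  measurable_fun setT w -> spaceL C G ->
  (\int[lam]_eta (fset_sum w eta * (C ^+ #|` eta| * `|damp delta G eta|))%:E < +oo)%E.
Proof.
move=> /andP[d0 d1] w01 mw /spaceLP-/(_ C_gt0)[mG Gfin].
have d01 : 0 <= delta <= 1 by rewrite ltW.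
have := le_lt_trans (damp_moment d01 w01 mw mG) Gfin.
have w0 x : 0 <= w x by have /andP[] := w01 x.
have I0 : (0 <= \int[lam]_eta (fset_sum w eta * (C ^+ #|` eta| * `|damp delta G eta|))%:E)%E.
  by apply: integral_ge0 => eta _; rewrite lee_fin !mulr_ge0//; exact: fset_sum_ge0.
case: (\int[lam]_eta _)%E I0 => [r _ _||//]; first exact: ltry.
by rewrite gt0_muley ?lte_fin// addey// gt_eqF// (lt_le_trans (ltNyr 0))//; exact: Lnorm_ge0.
Qed.

Lemma measurable_bd_step delta w G : measurable_fun setT w -> measurable_fun setT G ->
  measurable_fun setT (bd_step delta w G).
Proof.
move=> mw mG; apply: measurable_funD; first exact: measurable_damp.
by apply: measurable_funM => //; apply: measurable_birth => //; exact: measurable_damp.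
Qed.

(** The births cost at most $\delta z e^{CC_\phi}/C$ times the first moment of the thinned function;
    by the smallness of z this is at most the loss recorded in [damp_moment]. *)
Lemma normL_bd_step delta w G : 0 <= delta <= 1 -> (forall x, 0 <= w x <= 1) ->
  measurable_fun setT w -> measurable_fun setT G ->
  (normL C (bd_step delta w G) <= normL C G)%E.
Proof.
move=> d01 w01 mw mG; have /andP[d0 d1] := d01.
have w0 x : 0 <= w x by have /andP[] := w01 x.
have mdG := measurable_damp delta mG.
have mb : measurable_fun setT (birth w (damp delta G)) by exact: measurable_birth.
apply: (le_trans (normLD _ mdG (measurable_funM (measurable_cst _) mb))); first exact: ltW.
apply: le_trans (damp_moment d01 w01 mw mG); apply: leeD => //.
rewrite normLZ ?(ltW C_gt0)// ger0_norm ?mulr_ge0// EFinM -muleA.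
apply: lee_wpmul2l; first by rewrite lee_fin.
have := normL_birth_le d_gt0 mphi phi_ge0 phi_even Cphi_fin C_ge1 w0 mw mdG.
move=> /(lee_wpmul2l (x := z%:E)); rewrite lee_fin => /(_ z_ge0) /le_trans; apply.
rewrite muleA -EFinM -[leRHS]mul1e; apply: lee_wpmul2r; last by rewrite lee_fin.
by apply: integral_ge0 => eta _; rewrite lee_fin !mulr_ge0//; exact: fset_sum_ge0.
Qed.

Lemma spaceL_bd_step delta w G : 0 <= delta <= 1 -> (forall x, 0 <= w x <= 1) ->
  measurable_fun setT w -> spaceL C G -> spaceL C (bd_step delta w G).
Proof.
move=> d01 w01 mw /spaceLP-/(_ C_gt0)[mG Gfin]; apply/spaceLP => //; split.
  exact: measurable_bd_step.
exact: le_lt_trans (normL_bd_step d01 w01 mw mG) Gfin.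
Qed.

(** [bd_step] is additive wherever the birth integrals converge, hence almost everywhere, and the
    norm sees no more; the norm bound for the difference then applies. *)
Lemma bd_step_contraction delta w u g : 0 < delta <= 1 -> (forall x, 0 <= w x <= 1) ->
  measurable_fun setT w -> spaceL C u -> spaceL C g ->
  nrmL C (fun eta => bd_step delta w u eta - bd_step delta w g eta) <=
  nrmL C (fun eta => u eta - g eta).
Proof.
move=> d01' w01 mw su sg; have /andP[d0 d1] := d01'.
have d01 : 0 <= delta <= 1 by rewrite ltW.
have w0 x : 0 <= w x by have /andP[] := w01 x.
have [mu_ _] := (spaceLP u C_gt0).1 su; have [mg _] := (spaceLP g C_gt0).1 sg.
have mug : measurable_fun setT (fun eta => u eta - g eta) by exact: measurable_funB.
have ssub f f' : spaceL C f -> spaceL C f' -> spaceL C (fun eta => f eta - f' eta).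
  move=> sf sf'; have := spaceL_lin (-1) C_gt0 sf' sf.
  by rewrite (_ : (fun eta => -1 * _ + _) = fun eta => f eta - f' eta)//;
    apply/funext => eta; rewrite mulN1r addrC.
have fin f : spaceL C f -> {ae lam, forall eta, birth_finite w (damp delta f) eta}.
  move=> sf; have [mf _] := (spaceLP f C_gt0).1 sf.
  apply: (birth_finite_ae d_gt0 mphi phi_ge0 phi_even Cphi_fin C_ge1 w0 mw).
    exact: measurable_damp.
  exact: damp_moment_fin.
have sVug : spaceL C (fun eta => bd_step delta w u eta - bd_step delta w g eta).
  by apply: ssub; exact: spaceL_bd_step.
rewrite -lee_fin -(nrmLE C_gt0 sVug) -(nrmLE C_gt0 (ssub _ _ su sg)).
apply: le_trans (normL_bd_step d01 w01 mw mug); apply: le_normL.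
- exact: ltW.
- by apply: measurable_funB; exact: measurable_bd_step.
- exact: measurable_bd_step.
- have := fin u su; have := fin g sg; apply: filterS2 => eta fg fu.
  rewrite /bd_step (_ : damp delta (fun eta => u eta - g eta) =
    (fun eta => -1 * damp delta g eta + damp delta u eta)); last first.
    by apply/funext => e; rewrite /damp; ring.
  rewrite (birth_lin mphi phi_ge0)//; [|exact: measurable_damp..].
  by rewrite le_eqVlt; apply/orP; left; apply/eqP; congr `|_|; ring.
Qed.

End birth_death_step.

Lemma subset_sum_prod (T : choiceType) (R : comNzRingType) (f g : T -> R) eta :
  subset_sum f (fset_prod g) eta = fset_prod (fun x => f x + g x) eta.
Proof.
elim/fset_ind_U1: eta => [|x eta xe IH]; first by rewrite subset_sum0 !fset_prod0.
rewrite subset_sumU1// fset_prodU1// -IH mulrDl addrC; congr +%R.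
rewrite -subset_sumZ; apply: eq_subset_sum => // xi xis; rewrite fset_prodU1//.
by apply: contra xe; exact: (fsubsetP xis).
Qed.

(** * Discrete steps and the positivity of subset sums *)

Section positivity_cone.
Context (R : realType) (d : nat) (d_gt0 : (0 < d)%N).
Local Notation conf := {fset 'rV[R]_d}.
Local Notation lam := (lambda R d).
Local Notation mu := (lebesgue_measure_row R d).
Variable phi : 'rV[R]_d -> R.
Hypotheses (mphi : measurable_fun setT phi) (phi_ge0 : forall x, 0 <= phi x).
Implicit Types (G H : conf -> R) (w : 'rV[R]_d -> R) (x y : 'rV[R]_d) (eta xi : conf).

Let atomless : forall x, mu [set x] = 0%E.
Proof. by move=> x; exact: lebesgue_measure_row_set1. Qed.

Local Notation birth := (birth phi).
Local Notation birth_integrand := (birth_integrand phi).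
Local Notation boltzmann := (boltzmann phi).

(** Pointwise and not almost everywhere: [subset_positive] inspects every configuration, and the
    birth integrals must converge at each. The base b is free because births enlarge it to 1 + b. *)
Definition exp_bounded G := exists A b : R, [/\ 0 <= A, 1 <= b &
  forall eta, `|G eta| <= A * b ^+ #|` eta|].

Definition subset_positive G := forall eta, 0 <= subset_sum (fun=> 1) G eta.

Let bz01 x y : 0 <= boltzmann x y <= 1.
Proof. by rewrite expR_ge0/= -expR0 ler_expR oppr_le0. Qed.

Lemma exp_boundedD G H : exp_bounded G -> exp_bounded H ->
  exp_bounded (fun eta => G eta + H eta).
Proof.
move=> [A [b [A0 b1 GA]]] [A' [b' [A'0 b'1 HA]]].
exists (A + A'), (Num.max b b'); split; [exact: addr_ge0|by rewrite le_max b1|].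
move=> eta; have pw c : 1 <= c -> c <= Num.max b b' -> c ^+ #|` eta| <= Num.max b b' ^+ #|` eta|.
  by move=> c1 cm; rewrite lerXn2r// nnegrE; lra.
apply: (le_trans (ler_normD _ _)); rewrite mulrDl lerD//.
  by apply: (le_trans (GA eta)); rewrite ler_wpM2l// pw// le_max lexx.
by apply: (le_trans (HA eta)); rewrite ler_wpM2l// pw// le_max lexx orbT.
Qed.

Lemma exp_boundedZ a G : exp_bounded G -> exp_bounded (fun eta => a * G eta).
Proof.
move=> [A [b [A0 b1 GA]]]; exists (`|a| * A), b; split => //; first exact: mulr_ge0.
by move=> eta; rewrite normrM -mulrA ler_wpM2l.
Qed.

Lemma exp_bounded_damp delta G : 0 <= delta <= 1 -> exp_bounded G ->
  exp_bounded (damp delta G).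
Proof.
move=> /andP[d0 d1] [A [b [A0 b1 GA]]]; exists A, b; split => // xi.
apply: le_trans (GA xi); rewrite normrM -[leRHS]mul1r ler_wpM2r//.
by rewrite ger0_norm ?exprn_ge0 ?subr_ge0// exprn_ile1 ?subr_ge0// gerBl.
Qed.

(** With K the subset sum, K of the thinned G at eta is
    $\sum_{\xi\subset\eta}\delta^{|\eta\setminus\xi|}(1-\delta)^{|\xi|}(KG)(\xi)$, the mean of K G
    over a random thinning of eta. *)
Lemma subset_positive_damp delta G : 0 <= delta <= 1 -> subset_positive G ->
  subset_positive (damp delta G).
Proof.
move=> /andP[d0 d1] G0 eta.
have E : subset_sum (fun=> delta) (subset_scale (fun=> 1 - delta) (subset_sum (fun=> 1) G)) eta =
    subset_sum (fun=> 1) (damp delta G) eta.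
  rewrite (@eq_subset_sum _ _ _ (fun=> delta) _ (subset_sum (fun=> (1 - delta) * 1)
    (subset_scale (fun=> 1 - delta) G))) => [|//|xi _]; last exact: subset_scale_sum.
  rewrite subset_sum_comp; apply: eq_subset_sum => [y _|xi _]; first by ring.
  by rewrite /subset_scale /damp fset_prod_cst.
rewrite -E; apply: subset_sum_ge0 => // xi; rewrite mulr_ge0//.
by apply: fset_prod_ge0 => y; rewrite subr_ge0.
Qed.

Section weight.
Variables (w : 'rV[R]_d -> R) (m : R).
Hypotheses (w_ge0 : forall x, 0 <= w x) (mw : measurable_fun setT w)
  (wm : (\int[mu]_x (w x)%:E = m%:E)%E).

Let m_ge0 : 0 <= m.
Proof. by rewrite -lee_fin -wm integral_ge0// => x _; rewrite lee_fin. Qed.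

Let iw : mu.-integrable setT (fun x => (w x)%:E).
Proof.
apply/integrableP; split; first exact/measurable_EFinP.
by under eq_integral => x _ do rewrite gee0_abs ?lee_fin//; rewrite wm ltry.
Qed.

Lemma norm_birth_integrand_bounded A b H x xi zeta : 0 <= A -> 1 <= b ->
  (forall eta, `|H eta| <= A * b ^+ #|` eta|) ->
  `|birth_integrand H x xi zeta| <= A * b ^+ #|` xi|.+1.
Proof.
move=> A0 b1 HA; rewrite birth_integrandE !normrM.
have p01 f z0 : (forall y, `|f y| <= 1) -> `|fset_prod f z0| <= 1 :> R.
  by move=> f1; rewrite normr_fset_prod fset_prod_le1// => y; rewrite normr_ge0 f1.
have h1 : `|fset_prod (boltzmann x) xi| <= 1.
  by apply: p01 => y; have /andP[? ?] := bz01 x y; rewrite ger0_norm.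
have h2 : `|fset_prod (fun y => boltzmann x y - 1) zeta| <= 1.
  by apply: p01 => y; have /andP[? ?] := bz01 x y; rewrite ler_norml; lra.
have h3 : `|H (x |` xi)%fset| <= A * b ^+ #|` xi|.+1.
  apply: (le_trans (HA _)); rewrite ler_wpM2l// ler_weXn2l//.
  by rewrite cardfsU1; case: (x \notin xi).
rewrite -[leRHS]mulr1 ler_pM ?mulr_ge0// -[leRHS]mul1r.
by rewrite ler_pM.
Qed.

Lemma bounded_birth_integrable H xi zeta : measurable_fun setT H -> exp_bounded H ->
  mu.-integrable setT (fun x => (w x * birth_integrand H x xi zeta)%:E).
Proof.
move=> mH [A [b [A0 b1 HA]]].
apply: (le_integrable _ _ _ (integrableZl measurableT (A * b ^+ #|` xi|.+1) iw)) => //.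
  apply/measurable_EFinP; apply: measurable_funM => //.
  exact: measurable_birth_integrand.
move=> x _; rewrite /= lee_fin normrM [leRHS]normrM [leRHS]mulrC ler_wpM2l//.
apply: le_trans (ler_norm _); exact: norm_birth_integrand_bounded.
Qed.

Lemma exp_bounded_birth H : measurable_fun setT H -> exp_bounded H ->
  exp_bounded (birth w H).
Proof.
move=> mH bH; have [A [b [A0 b1 HA]]] := bH; have b0 : 0 <= b by lra.
(* The new base comes from $\sum_{\xi\subset\eta} b^{|\xi|} = (1+b)^{|\eta|}$; the extra factor b
   accounts for the inserted point. *)
exists (m * (A * b)), (1 + b); split; [by rewrite !mulr_ge0|lra|move=> eta].
have -> : m * (A * b) * (1 + b) ^+ #|` eta| =
    \sum_(xi <- fpowerset eta) m * (A * b ^+ #|` xi|.+1).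
  rewrite -fset_prod_cst -(subset_sum_prod (fun=> 1) (fun=> b)) /subset_sum /partition_sum mulr_sumr.
  by apply: eq_bigr => xi _; rewrite !fset_prod_cst expr1n exprS; ring.
rewrite /Submission.birth; apply: (le_trans (ler_norm_sum _ _ _)); apply: ler_sum => xi _.
have ib := bounded_birth_integrable xi (eta `\` xi)%fset mH bH.
apply: le_trans; first exact: (le_normr_Rintegral measurableT ib).
have -> : m * (A * b ^+ #|` xi|.+1) = \int[mu]_x (A * b ^+ #|` xi|.+1 * w x).
  by rewrite RintegralZl// /Rintegral wm mulrC.
apply: le_Rintegral => //.
- exact: (integrable_norm ib).
- exact: (integrableZl measurableT _ iw).
- move=> x _; rewrite normrM ger0_norm// mulrC ler_wpM2r//.
  exact: norm_birth_integrand_bounded.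
Qed.

(** Composing with the subset sum adds 1 to each factor [boltzmann x y - 1], so the same Boltzmann
    factor stands on both parts of eta and comes out of the sum. *)
Lemma subset_sum_birth_integrand H x eta :
  subset_sum (fun=> 1) (partition_sum (birth_integrand H x)) eta =
  fset_prod (boltzmann x) eta * subset_sum (fun=> 1) (fun xi => H (x |` xi)%fset) eta.
Proof.
have E xi : partition_sum (birth_integrand H x) xi = subset_sum (fun y => boltzmann x y - 1)
    (subset_scale (boltzmann x) (fun xi => H (x |` xi)%fset)) xi.
  by apply: eq_partition_sum => zeta _; rewrite birth_integrandE mulrC.
rewrite (eq_subset_sum (f := fun=> 1) (g := fun=> 1) (fun y _ => erefl) (fun xi _ => E xi)).
rewrite subset_sum_comp -[RHS]/(subset_scale _ (subset_sum _ _) _) subset_scale_sum.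
by apply: eq_subset_sum => // y _; ring.
Qed.

Lemma subset_sum_birth H eta : measurable_fun setT H -> exp_bounded H ->
  mu.-integrable setT (fun x =>
    (w x * subset_sum (fun=> 1) (partition_sum (birth_integrand H x)) eta)%:E) /\
  subset_sum (fun=> 1) (birth w H) eta =
  \int[mu]_x (w x * subset_sum (fun=> 1) (partition_sum (birth_integrand H x)) eta).
Proof.
move=> mH bH; pose F xi zeta x := (w x * birth_integrand H x zeta (xi `\` zeta)%fset)%:E.
have iF xi zeta : mu.-integrable setT (F xi zeta) by exact: bounded_birth_integrable.
have E x : (\sum_(xi <- fpowerset eta) \sum_(zeta <- fpowerset xi) F xi zeta x)%E =
    (w x * subset_sum (fun=> 1) (partition_sum (birth_integrand H x)) eta)%:E.
  rewrite /F /subset_sum /partition_sum mulr_sumr -sumEFin; apply: eq_bigr => xi _.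
  by rewrite sumEFin fset_prod_cst expr1n mul1r mulr_sumr.
have := integrable_sum measurableT (fpowerset eta) (P := xpredT) (fun xi _ =>
  integrable_sum measurableT (fpowerset xi) (P := xpredT) (fun zeta _ => iF xi zeta)).
under eq_fun do rewrite E.
move=> ih; split => //.
have -> : subset_sum (fun=> 1) (birth w H) eta =
    \sum_(xi <- fpowerset eta) \sum_(zeta <- fpowerset xi) fine (\int[mu]_x F xi zeta x)%E.
  by apply: eq_bigr => xi _; rewrite fset_prod_cst expr1n mul1r.
apply: EFin_inj; rewrite -sumEFin.
under eq_bigr => xi _.
  rewrite -sumEFin; under eq_bigr => zeta _.
    rewrite fineK; last exact: integrable_fin_num.
    over.
  rewrite -integral_sum//; over.
rewrite -integral_sum//; last by move=> xi; exact: integrable_sum.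
move: ih => /(integrable_fin_num measurableT) fin; rewrite /Rintegral fineK//.
by apply: eq_integral => x _; exact: E.
Qed.

(* Inserting a point multiplies the subset sum by a Boltzmann factor, which is at
   most 1, and [subset_sum 1 H] at [x |` eta] is nonnegative. *)
Lemma subset_sum_birth_ge H eta : measurable_fun setT H -> exp_bounded H ->
  subset_positive H ->
  - (m * subset_sum (fun=> 1) H eta) <= subset_sum (fun=> 1) (birth w H) eta.
Proof.
move=> mH bH H0; pose h x := subset_sum (fun=> 1) (partition_sum (birth_integrand H x)) eta.
set S := subset_sum (fun=> 1) H eta.
have [ih Eh] := subset_sum_birth eta mH bH; rewrite -/h in ih Eh.
have iS : mu.-integrable setT (fun x => (S * w x)%:E) by exact: (integrableZl measurableT S iw).
have S0 : 0 <= S by exact: H0.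
have -> : m * S = \int[mu]_x (S * w x) by rewrite RintegralZl// /Rintegral wm mulrC.
rewrite Eh -subr_ge0 opprK -RintegralD//.
(* The integrand is nonnegative except perhaps at the points of eta, a null set, so it may be
   replaced by its absolute value. *)
rewrite (_ : \int[mu]_x _ = \int[mu]_x `|w x * h x + S * w x|).
  by apply: Rintegral_ge0.
have mhS : measurable_fun setT (fun x => w x * h x + S * w x).
  apply/measurable_EFinP; exact: (measurable_int _ (integrableD measurableT ih iS)).
rewrite /Rintegral; congr fine; apply: ae_eq_integral => //.
- exact/measurable_EFinP.
- by apply/measurable_EFinP; exact: (measurableT_comp (@normr_measurable R setT) mhS).
have [me me0] := fset_null (@measurable_row_diagonal R d) atomless eta.
exists [set` eta]; split => // x /= nx; apply: contrapT => xe; apply: nx => _.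
rewrite ger0_norm// mulrC -mulrDl mulr_ge0// /h subset_sum_birth_integrand.
have xe' : x \notin eta by exact/negP.
have := H0 (x |` eta)%fset; rewrite subset_sumU1// mul1r -/S.
set K := subset_sum _ (fun xi => H (x |` xi)%fset) eta => KS.
have /andP[p0 p1] : 0 <= fset_prod (boltzmann x) eta <= 1.
  by rewrite fset_prod_ge0 ?fset_prod_le1// => y; have /andP[] := bz01 x y.
(* With p the Boltzmann factor: p K + S >= p (K + S) >= 0, since S >= 0 and p lies in [0, 1]. *)
nra.
Qed.

Lemma subset_positive_bd_step z delta G : 0 <= z -> 0 <= delta <= 1 -> delta * z * m <= 1 ->
  measurable_fun setT G -> exp_bounded G -> subset_positive G ->
  subset_positive (bd_step phi z delta w G).
Proof.
move=> z0 d01 dzm mG bG G0 eta; have /andP[d0 d1] := d01.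
have mdG := measurable_damp delta mG.
have bdG := exp_bounded_damp d01 bG.
have pdG := subset_positive_damp d01 G0.
rewrite /bd_step subset_sumD subset_sumZ.
have := subset_sum_birth_ge eta mdG bdG pdG; have := pdG eta.
set S := subset_sum _ _ _; set K := subset_sum _ _ _ => S0 SK.
have : delta * z * - (m * S) <= delta * z * K by rewrite ler_wpM2l// mulr_ge0.
nra.
Qed.

Lemma exp_bounded_bd_step z delta G : 0 <= delta <= 1 ->
  measurable_fun setT G -> exp_bounded G -> exp_bounded (bd_step phi z delta w G).
Proof.
move=> d01 mG bG; have bdG := exp_bounded_damp d01 bG.
apply: exp_boundedD => //; apply: exp_boundedZ; apply: exp_bounded_birth => //.
exact: measurable_damp.
Qed.

End weight.
End positivity_cone.

(** * Cubes *)

Lemma tuple_measure_power_fin disp (T : measurableType disp) (R : realType)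
    (mu : {sigma_finite_measure set T -> \bar R}) (A : set T) n :
  measurable A -> (mu A < +oo)%E ->
  measurable [set t : n.-tuple T | forall x, x \in tval t -> A x] /\
  (tuple_measure mu n [set t | forall x, x \in tval t -> A x] < +oo)%E.
Proof.
move=> mA Afin; elim: n => [|n [mAn IH]].
  rewrite (_ : [set t | _] = setT); last by apply/seteqP; split => t //= _; rewrite (tuple0 t).
  split; first exact: measurableT.
  have D1 := @diracT _ _ R ([tuple] : 0.-tuple T).
  by apply: (@le_lt_trans _ _ 1%E); [rewrite -D1|exact: ltry].
have E : @Defs.cons_tuple _ T n @^-1` [set t | forall x, x \in tval t -> A x] =
    A `*` [set t | forall x, x \in tval t -> A x].
  apply/seteqP; split => -[x t] /=.
    move=> H; split; first by apply: H; rewrite inE eqxx.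
    by move=> y yt; apply: H; rewrite inE yt orbT.
  by move=> [Ax At] y; rewrite inE => /predU1P[->//|]; exact: At.
split.
  rewrite (_ : [set t | _] = @uncons_tuple _ T n @^-1`
    (A `*` [set t | forall x, x \in tval t -> A x])).
    rewrite -[X in measurable X]setTI; apply: measurable_uncons_tuple => //.
    exact: measurableX.
  rewrite -E -comp_preimage (_ : _ \o _ = id) ?preimage_id//.
  by apply/funext => t; exact/esym/cons_tupleP.
rewrite [X in (X < _)%E](_ : _ = (mu \x tuple_measure mu n)%E
  (A `*` [set t | forall x, x \in tval t -> A x])); last by rewrite -E.
by rewrite product_measure1E// lte_mul_pinfty// ge0_fin_numE.
Qed.

Section cubes.
Context (R : realType).

Variable d : nat.
Local Notation mu := (lebesgue_measure_row R d).

Definition cube (M : R) : set 'rV[R]_d := [set x | forall i, `|x ord0 i| <= M].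

Let tcube (M : R) := @tuple_measure_power_fin _ (measurableTypeR R) R lebesgue_measure
  [set x | `|x| <= M] d.

Let mI (M : R) : @measurable _ (measurableTypeR R) [set x : R | `|x| <= M] /\
  (lebesgue_measure [set x : R | (`|x| <= M)%R] < +oo)%E.
Proof.
rewrite (_ : [set x | _] = `[- M, M]%classic).
  split; first exact: measurable_itv.
  by rewrite lebesgue_measure_itv/=; case: ifP => _; [rewrite -EFinD ltry|].
by apply/seteqP; split => x /=; rewrite in_itv/= ler_norml.
Qed.

Lemma cube_measurable_fin M : measurable (cube M) /\ (mu (cube M) < +oo)%E.
Proof.
have [mM Mfin] := mI M; have [mT Tfin] := tcube mM Mfin.
have E : @row_of_tuple _ (measurableTypeR R) d @^-1` (cube M) =
    [set t | forall x, x \in tval t -> `|x| <= M].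
  apply/seteqP; split => t /= H.
    by move=> y /tnthP[i ->]; have := H i; rewrite /row_of_tuple mxE.
  by move=> i; rewrite /row_of_tuple mxE; apply: H; exact: mem_tnth.
split; last by apply: le_lt_trans Tfin; rewrite -E.
have -> : cube M = @tuple_of_row _ (measurableTypeR R) d @^-1`
    (@row_of_tuple _ (measurableTypeR R) d @^-1` (cube M)).
  rewrite -comp_preimage (_ : _ \o _ = id) ?preimage_id//.
  by apply/funext => x; apply/rowP => i; rewrite /= /row_of_tuple mxE tnth_mktuple.
rewrite E -[X in measurable X]setTI; exact: measurable_tuple_of_row.
Qed.

Lemma bounded_cube M : bounded_set (cube M).
Proof.
exists `|M|; split; first exact: num_real.
move=> N MN x /= xM; rewrite [leLHS]mx_normrE; apply: bigmax_le => [|[i j] _ /=].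
  by rewrite (le_trans _ (ltW MN)).
by rewrite ord1 (le_trans (xM j))// (le_trans (ler_norm M))// ltW.
Qed.

Lemma bounded_sub_cube (B : set 'rV[R]_d) : bounded_set B -> exists M, B `<=` cube M.
Proof.
move=> [M [_ BM]]; exists (M + 1) => x Bx i.
have Mlt : M < M + 1 by rewrite ltrDl.
apply: le_trans (BM _ Mlt _ Bx).
rewrite [leRHS]mx_normrE.
exact: (le_bigmax _ (fun ij => `|x ij.1 ij.2|) (ord0, i)).
Qed.

Lemma fset_sub_cube (eta : {fset 'rV[R]_d}) :
  exists n0, forall n, (n0 <= n)%N -> [set` eta] `<=` cube n%:R.
Proof.
exists (\max_(x <- eta) \max_(i < d) (Num.truncn `|x ord0 i|).+1) => n le x /= xe i.
apply: (@le_trans _ _ (Num.truncn `|x ord0 i|).+1%:R); first exact/ltW/truncnS_gt.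
rewrite ler_nat; apply: leq_trans le.
apply: leq_trans (leq_bigmax_seq _ xe erefl).
exact: (leq_bigmax_cond i).
Qed.

End cubes.

(** * Convergence of the discrete generators *)

Section dominated.
Context (R : realType) (d : nat).
Local Notation conf := {fset 'rV[R]_d}.
Local Notation lam := (lambda R d).
Implicit Types (G H : conf -> R).

Lemma normL_dominated_cvg c (G : nat -> conf -> R) H : 0 < c -> spaceL c H ->
  (forall n, measurable_fun setT (G n)) -> (forall n eta, `|G n eta| <= `|H eta|) ->
  (forall eta, G n eta @[n --> \oo] --> 0) ->
  forall e, 0 < e -> exists N, forall n, (N <= n)%N -> (normL c (G n) <= e%:E)%E.
Proof.
move=> c0 sH mG GH G0 e e0; have [mH Hfin] := (spaceLP H c0).1 sH.
have sG n : spaceL c (G n) by apply: (spaceL_le c0 (mG n) sH); exact: aeW.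
have cn0 (eta : conf) : 0 <= c ^+ #|` eta| by rewrite exprn_ge0// ltW.
have cv : normL c (G n) @[n --> \oo] --> 0%E.
  under eq_fun do rewrite normLE ?(ltW c0)//.
  rewrite -(integral0 lam setT).
  apply: (@dominated_cvg _ _ _ lam setT measurableT
    (fun n eta => (c ^+ #|` eta| * `|G n eta|)%:E) (cst 0%E)
    (fun eta => (c ^+ #|` eta| * `|H eta|)%:E)) => //.
  - by move=> n; exact: measurable_weighted_norm.
  - move=> eta _; apply: cvg_EFin; first by apply: nearW => n.
    rewrite (_ : _ \o _ = fun n => c ^+ #|` eta| * `|G n eta|)//.
    rewrite -(mulr0 (c ^+ #|` eta|)); apply: cvgMr.
    by rewrite -(normr0 R); apply: cvg_norm; exact: G0.
  - apply/integrableP; split; first exact: measurable_weighted_norm.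
    under eq_integral => eta _ do rewrite gee0_abs ?lee_fin ?mulr_ge0//.
    by rewrite -normLE// ltW.
  - by move=> n eta _; rewrite /= ger0_norm ?mulr_ge0// lee_fin ler_wpM2l.
move: cv => /fine_cvgP[_ /cvgrPdist_le /(_ e e0)[N _ HN]]; exists N => n Nn.
rewrite (nrmLE c0 (sG n)) lee_fin.
by have := HN n Nn; rewrite /= sub0r normrN ger0_norm//; exact: nrmL_ge0.
Qed.

Lemma nrmL_le c G e : (normL c G <= e%:E)%E -> nrmL c G <= e.
Proof.
move=> Ge; rewrite -lee_fin /nrmL fineK// ge0_fin_numE; last exact: Lnorm_ge0.
exact: le_lt_trans Ge (ltry _).
Qed.

End dominated.

Lemma cvg0_le_harmonic (R : realType) (a : nat -> R) (M : R) N :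
  (forall k, (N <= k)%N -> `|a k| <= M * k.+1%:R^-1) -> a k @[k --> \oo] --> 0.
Proof.
move=> aM; apply/norm_cvg0P; apply: (@squeeze_cvgr _ _ _ _ (cst 0) (fun k => M * k.+1%:R^-1)).
- by near=> k; rewrite normr_ge0/=; apply: aM; near: k; exact: nbhs_infty_ge.
- exact: cvg_cst.
- rewrite -(mulr0 M); apply: cvgMr; exact: cvg_harmonic.
Unshelve. all: by end_near. Qed.

Section generator_approximation.
Context (R : realType) (d : nat) (d_gt0 : (0 < d)%N).
Local Notation conf := {fset 'rV[R]_d}.
Local Notation lam := (lambda R d).
Local Notation mu := (lebesgue_measure_row R d).
Variable phi : 'rV[R]_d -> R.
Hypotheses (mphi : measurable_fun setT phi) (phi_ge0 : forall x, 0 <= phi x)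
  (phi_even : forall x, phi (- x) = phi x) (Cphi_fin : (C_phi phi < +oo)%E).
Variables (z C : R).
Hypotheses (z_ge0 : 0 <= z) (C_ge1 : 1 <= C) (zC : z * (expR (C * cphi phi) / C) <= 1).
Implicit Types (G H u : conf -> R) (w : 'rV[R]_d -> R) (x y : 'rV[R]_d) (eta xi : conf).

Local Notation birth := (birth phi).
Local Notation cphi := (cphi phi).
Local Notation birth_finite := (birth_finite phi).
Local Notation bd_step := (bd_step phi z).

Let C_gt0 : 0 < C. Proof. exact: lt_le_trans C_ge1. Qed.

Let C2_gt0 : 0 < 2 * C. Proof. by rewrite mulr_gt0. Qed.

Let Cn_ge0 (eta : conf) : 0 <= C ^+ #|` eta|.
Proof. by rewrite exprn_ge0// ltW. Qed.

Lemma hatLE G : hatL z phi G =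
  (fun eta => - #|` eta|%:R * G eta + z * birth (fun=> 1) G eta).
Proof.
apply/funext => eta; rewrite /hatL; congr (_ + _ * _); apply: eq_bigr => xi _.
by apply: eq_Rintegral => x _; rewrite mul1r.
Qed.

(** $n\le2^n$: this is what the doubled weight of L_2C provides. The function |eta| u eta later
    dominates all three errors of the discrete generator. *)
Lemma spaceL_card G : spaceL (2 * C) G -> spaceL C (fun eta => #|` eta|%:R * G eta).
Proof.
move=> /spaceLP-/(_ C2_gt0)[mG Gfin].
have mcard := @measurable_card R d.
apply/spaceLP => //; split; first exact: measurable_funM.
apply: le_lt_trans Gfin; rewrite !normLE ?(ltW C_gt0) ?(ltW C2_gt0)//.
apply: ge0_le_integral => //.
- by move=> eta _; rewrite lee_fin mulr_ge0.
- by apply: measurable_weighted_norm; exact: measurable_funM.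
- exact: measurable_weighted_norm.
- move=> eta _; rewrite lee_fin exprMn normrM ger0_norm ?ler0n// mulrCA mulrA.
  rewrite ler_wpM2r// ler_wpM2r// -natrX ler_nat; exact/ltnW/ltn_expl.
Qed.

(** The smallness of z absorbs the constant of [normL_birth_le]: births located by w cost no more
    than deaths at rate [fset_sum w]. *)
Lemma normL_birth_le_fset_sum w G : (forall x, 0 <= w x) -> measurable_fun setT w ->
  measurable_fun setT G ->
  (z%:E * normL C (birth w G) <= normL C (fun eta => fset_sum w eta * G eta)%R)%E.
Proof.
move=> w0 mw mG; rewrite [leRHS]normLE ?(ltW C_gt0)//.
have := normL_birth_le d_gt0 mphi phi_ge0 phi_even Cphi_fin C_ge1 w0 mw mG.
move=> /(lee_wpmul2l (x := z%:E)); rewrite lee_fin => /(_ z_ge0) /le_trans; apply.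
rewrite muleA -EFinM -[leRHS]mul1e.
rewrite (_ : (fun eta => (fset_sum w eta * _)%:E) =
  (fun eta => (C ^+ #|` eta| * `|fset_sum w eta * G eta|)%:E)); last first.
  by apply/funext => eta; rewrite normrM ger0_norm ?fset_sum_ge0// mulrCA.
apply: lee_wpmul2r; last by rewrite lee_fin.
by apply: integral_ge0 => eta _; rewrite lee_fin !mulr_ge0.
Qed.

Lemma measurable_hatL G : measurable_fun setT G -> measurable_fun setT (hatL z phi G).
Proof.
move=> mG; rewrite hatLE; apply: measurable_funD.
  by apply: measurable_funM => //; apply: measurable_funN; exact: measurable_card.
by apply: measurable_funM => //; apply: measurable_birth.
Qed.

Lemma spaceL_hatL G : spaceL (2 * C) G -> spaceL C (hatL z phi G).
Proof.
move=> sG; have [mG Gfin] := (spaceLP G C2_gt0).1 sG.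
have sc := spaceL_card sG; have [mc cfin] := (spaceLP _ C_gt0).1 sc.
have zb := normL_birth_le_fset_sum (w := fun=> 1) (fun _ => ler01) (measurable_cst _) mG.
have sb : spaceL C (fun eta => z * birth (fun=> 1) G eta).
  have mb : measurable_fun setT (birth (fun=> 1) G) by exact: measurable_birth.
  apply/spaceLP => //; split; first exact: measurable_funM.
  rewrite normLZ ?(ltW C_gt0)// ger0_norm//; apply: le_lt_trans zb _.
  by under eq_fun do rewrite fset_sum1.
rewrite hatLE; have := spaceL_lin (-1) C_gt0 sc sb.
by under eq_fun do rewrite mulN1r -mulNr.
Qed.

(** Makes $((1-\delta)^n-1)/\delta + n$ nonnegative and at most $n^2\delta$. *)
Lemma damp_taylor2 (delta : R) n : 0 <= delta <= 1 ->
  1 - n%:R * delta <= (1 - delta) ^+ n <= 1 - n%:R * delta + n%:R ^+ 2 * delta ^+ 2.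
Proof.
move=> /andP[d0 d1]; elim: n => [|n /andP[IH1 IH2]].
  by rewrite expr0 !mul0r subr0 expr0n/= mul0r addr0 lexx.
have p0 : 0 <= (1 - delta) ^+ n by rewrite exprn_ge0// subr_ge0.
have n0 := ler0n R n.
rewrite exprS -natr1; apply/andP; split.
  apply: (@le_trans _ _ ((1 - delta) * (1 - n%:R * delta))); last by rewrite ler_wpM2l// subr_ge0.
  by nra.
apply: (@le_trans _ _ ((1 - delta) * (1 - n%:R * delta + n%:R ^+ 2 * delta ^+ 2))).
  by rewrite ler_wpM2l// subr_ge0.
have h1 : 0 <= n%:R ^+ 2 * delta ^+ 3 by rewrite mulr_ge0// exprn_ge0.
have h2 : 0 <= n%:R * delta ^+ 2 by rewrite mulr_ge0// exprn_ge0.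
have h3 : 0 <= delta ^+ 2 by rewrite exprn_ge0.
nra.
Qed.

Lemma spaceL_fset_sum w G u : (forall x, 0 <= w x <= 1) -> measurable_fun setT w ->
  measurable_fun setT G -> (forall eta, `|G eta| <= `|u eta|) -> spaceL (2 * C) u ->
  spaceL C (fun eta => fset_sum w eta * G eta).
Proof.
move=> w01 mw mG Gu su; apply: (spaceL_le C_gt0 _ (spaceL_card su)).
  apply: measurable_funM => //.
  by apply: measurable_fset_sum mw; exact: measurable_row_diagonal.
apply: aeW => eta; rewrite !normrM ler_pM// ger0_norm.
  by rewrite ger0_norm// fset_sum_le_card// => x; have /andP[] := w01 x.
by apply: fset_sum_ge0 => x; have /andP[] := w01 x.
Qed.

Lemma birth_finite_spaceL2 w G u : (forall x, 0 <= w x <= 1) -> measurable_fun setT w ->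
  measurable_fun setT G -> (forall eta, `|G eta| <= `|u eta|) -> spaceL (2 * C) u ->
  {ae lam, forall eta, birth_finite w G eta}.
Proof.
move=> w01 mw mG Gu su; have w0 x : 0 <= w x by have /andP[] := w01 x.
apply: (birth_finite_ae d_gt0 mphi phi_ge0 phi_even Cphi_fin C_ge1 w0 mw mG).
have [_] := (spaceLP _ C_gt0).1 (spaceL_fset_sum w01 mw mG Gu su).
rewrite normLE ?(ltW C_gt0)//; under eq_integral => eta _.
  rewrite normrM ger0_norm ?fset_sum_ge0// mulrCA; over.
by [].
Qed.

(** Three errors: the difference quotient of the thinning, the births suppressed by the window
    (weight 1 - w), and the births computed from the thinned u instead of u. The last two are
    reduced to first moments by [normL_birth_le_fset_sum]. *)
Lemma normL_generator_error delta w u : 0 < delta <= 1 -> (forall x, 0 <= w x <= 1) ->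
  measurable_fun setT w -> spaceL (2 * C) u ->
  (normL C (fun eta => delta^-1 * (bd_step delta w u eta - u eta) - hatL z phi u eta)%R <=
   normL C (fun eta => (delta^-1 * ((1 - delta) ^+ #|` eta| - 1) + #|` eta|%:R) * u eta)%R +
   (normL C (fun eta => fset_sum (fun x => 1 - w x) eta * u eta)%R +
    normL C (fun eta => fset_sum w eta * (u eta - damp delta u eta))%R))%E.
Proof.
move=> /andP[d0 d1] w01 mw su; have [mu_ _] := (spaceLP u C2_gt0).1 su.
have w0 x : 0 <= w x by have /andP[] := w01 x.
have v01 x : 0 <= 1 - w x <= 1 by have /andP[] := w01 x; lra.
have v0 x : 0 <= 1 - w x by have /andP[] := v01 x.
have mv : measurable_fun setT (fun x => 1 - w x) by exact: measurable_funB.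
have p01 (eta : conf) : 0 <= (1 - delta) ^+ #|` eta| <= 1.
  by rewrite exprn_ge0 ?subr_ge0// exprn_ile1 ?subr_ge0// gerBl ltW.
have mdu := measurable_damp delta mu_.
have mud : measurable_fun setT (fun eta => u eta - damp delta u eta) by exact: measurable_funB.
have du eta : `|damp delta u eta| <= `|u eta|.
  have /andP[p0 p1] := p01 eta.
  by rewrite normrM -[leRHS]mul1r ler_wpM2r// ger0_norm.
have ud eta : `|u eta - damp delta u eta| <= `|u eta|.
  have /andP[p0 p1] := p01 eta; rewrite /damp -[X in X - _]mul1r -mulrBl.
  by rewrite normrM -[leRHS]mul1r ler_wpM2r// ger0_norm ?subr_ge0// gerBl.
have mA : measurable_fun setT (fun eta : conf =>
    (delta^-1 * ((1 - delta) ^+ #|` eta| - 1) + #|` eta|%:R) * u eta).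
  apply: measurable_funM => //; apply: measurable_funD; last exact: measurable_card.
  apply: measurable_funM => //; apply: measurable_funB => //.
  exact: measurable_card_power.
have mb1 : measurable_fun setT (fun eta => - z * birth (fun x => 1 - w x) u eta).
  by apply: measurable_funM => //; exact: measurable_birth.
have mb2 : measurable_fun setT (fun eta => - z * birth w (fun eta => u eta - damp delta u eta) eta).
  by apply: measurable_funM => //; exact: measurable_birth.
rewrite (@normL_ae_eq _ _ C _ (fun eta =>
    (delta^-1 * ((1 - delta) ^+ #|` eta| - 1) + #|` eta|%:R) * u eta +
    (- z * birth (fun x => 1 - w x) u eta +
     - z * birth w (fun eta => u eta - damp delta u eta) eta))).
- apply: (le_trans (normLD _ mA (measurable_funD mb1 mb2))); first exact: ltW.
  apply: leeD => //; apply: (le_trans (normLD _ mb1 mb2)); first exact: ltW.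
  rewrite !normLZ ?(ltW C_gt0)//; first last.
  + exact: measurable_birth.
  + exact: measurable_birth.
  by rewrite normrN ger0_norm//; apply: leeD; exact: normL_birth_le_fset_sum.
- exact: ltW.
- apply: measurable_funB; last exact: measurable_hatL.
  by apply: measurable_funM => //; apply: measurable_funB => //; exact: measurable_bd_step.
- by apply: measurable_funD => //; exact: measurable_funD.
have uu eta : `|u eta| <= `|u eta| by [].
have := birth_finite_spaceL2 w01 mw mu_ uu su.
have := birth_finite_spaceL2 v01 mv mu_ uu su.
have := birth_finite_spaceL2 w01 mw mdu du su.
apply: filterS3 => eta fdw fv fw _.
rewrite hatLE /bd_step (_ : (fun=> 1) = (fun x => w x + (1 - w x))); last first.
  by apply/funext => x; rewrite subrKC.
rewrite (birth_weightD mphi phi_ge0 w0 mw v0 mv mu_ fw fv).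
rewrite (_ : (fun eta => u eta - damp delta u eta) = (fun eta => -1 * damp delta u eta + u eta)); last first.
  by apply/funext => e; ring.
rewrite (birth_lin mphi phi_ge0 (-1) w0 mw mdu mu_ fdw fw) /damp.
by field; rewrite gt_eqF.
Qed.

Lemma generator_approximation u e : spaceL (2 * C) u -> 0 < e ->
  exists delta w m, [/\ 0 < delta <= 1 /\ delta * z * m <= 1,
    forall x, 0 <= w x <= 1, measurable_fun setT w, (\int[mu]_x (w x)%:E = m%:E)%E &
    nrmL C (fun eta => delta^-1 * (bd_step delta w u eta - u eta) - hatL z phi u eta) <= e].
Proof.
move=> su e0; have [mu_ _] := (spaceLP u C2_gt0).1 su.
pose w k : 'rV[R]_d -> R := \1_(cube k%:R).
pose m k := fine (mu (cube k%:R)).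
have m0 k : 0 <= m k by rewrite fine_ge0.
(* The denominator serves two bounds: delta k <= 1 / (k + 1) for convergence, and delta k z m k <= 1
   for positivity while the cubes grow. *)
pose delta k := (k.+1%:R + z * m k)^-1.
have den k : 1 <= k.+1%:R + z * m k.
  by rewrite ler_wpDr ?mulr_ge0// ler1n.
have d01 k : 0 < delta k <= 1.
  by rewrite invr_gt0 invf_le1 ?den ?andbT (lt_le_trans _ (den k)).
have w01 k x : 0 <= w k x <= 1.
  by rewrite /w indicE; case: (_ \in _); rewrite /= ?lexx ?ler01.
have mw k : measurable_fun setT (w k).
  by apply: measurable_indic; have [] := @cube_measurable_fin R d k%:R.
have dh k : delta k <= k.+1%:R^-1.
  rewrite lef_pV2 ?posrE ?ltr0n ?(lt_le_trans _ (den k))//.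
  by rewrite lerDl mulr_ge0.
have scard := spaceL_card su.
have p01 k (eta : conf) : 0 <= (1 - delta k) ^+ #|` eta| <= 1.
  have /andP[? ?] := d01 k.
  by rewrite exprn_ge0 ?subr_ge0// exprn_ile1 ?subr_ge0// gerBl ltW.
have mcard := @measurable_card R d.
(* With n points, the bound n is uniform in k and serves as domination; n^2 / (k + 1) makes the
   error vanish at a fixed configuration. *)
have ta k (eta : conf) : 0 <= (delta k)^-1 * ((1 - delta k) ^+ #|` eta| - 1) + #|` eta|%:R <=
    Num.min #|` eta|%:R (#|` eta|%:R ^+ 2 * k.+1%:R^-1).
  have /andP[dk0 dk1] := d01 k; have dk01 : 0 <= delta k <= 1 by rewrite ltW.
  have /andP[t1 t2] := damp_taylor2 #|` eta| dk01; have /andP[p0 p1] := p01 k eta.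
  have dn0 : delta k != 0 by rewrite gt_eqF.
  have -> : (delta k)^-1 * ((1 - delta k) ^+ #|` eta| - 1) + #|` eta|%:R =
      (delta k)^-1 * ((1 - delta k) ^+ #|` eta| - 1 + #|` eta|%:R * delta k) by field.
  move: t1 t2 p0 p1; set p := _ ^+ _; move: p => p t1 t2 p0 p1.
  rewrite le_min; apply/and3P; split.
  - apply: mulr_ge0; [by rewrite invr_ge0 ltW|lra].
  - by rewrite ler_pdivrMl// mulrC; lra.
  - apply: (@le_trans _ _ (#|` eta|%:R ^+ 2 * delta k)); last by rewrite ler_wpM2l// exprn_ge0.
    rewrite ler_pdivrMl//; rewrite !expr2 in t2 *; lra.
have e3 : 0 < e / 3 by rewrite divr_gt0.
have [N1 H1] : exists N, forall k, (N <= k)%N -> (normL C (fun eta =>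
    ((delta k)^-1 * ((1 - delta k) ^+ #|` eta| - 1) + #|` eta|%:R) * u eta)%R <= (e / 3)%:E)%E.
  apply: (normL_dominated_cvg C_gt0 scard) => // [k|k eta|eta].
  - apply: measurable_funM => //; apply: measurable_funD => //.
    apply: measurable_funM => //; apply: measurable_funB => //.
    exact: measurable_card_power.
  - have /andP[t0] := ta k eta; rewrite le_min => /andP[t1 _].
    by rewrite !normrM ler_wpM2r// !ger0_norm.
  - apply: (@cvg0_le_harmonic _ _ (#|` eta|%:R ^+ 2 * `|u eta|) 0) => k _.
    have /andP[t0] := ta k eta; rewrite le_min => /andP[_ t2].
    by rewrite normrM ger0_norm// mulrAC ler_wpM2r.
have [N2 H2] : exists N, forall k, (N <= k)%N -> (normL C (fun eta =>
    fset_sum (fun x => 1 - w k x) eta * u eta)%R <= (e / 3)%:E)%E.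
  apply: (normL_dominated_cvg C_gt0 scard) => // [k|k eta|eta].
  - apply: measurable_funM => //; apply: measurable_fset_sum; first exact: measurable_row_diagonal.
    exact: measurable_funB.
  - rewrite !normrM ler_wpM2r// !ger0_norm ?fset_sum_ge0//.
      by apply: fset_sum_le_card => x; have /andP[] := w01 k x; lra.
    by move=> x; have /andP[] := w01 k x; lra.
  - have [N HN] := fset_sub_cube eta.
    (* The error is exactly 0 once the cube contains eta, hence the constant 0. *)
    apply: (@cvg0_le_harmonic _ _ 0 N) => k Nk.
    rewrite mul0r normr_le0 mulf_eq0 (_ : fset_sum _ _ = 0) ?eqxx//.
    apply: big1_seq => x /andP[_ xe]; rewrite /w indicE mem_set ?subrr//.
    exact: HN.
have [N3 H3] : exists N, forall k, (N <= k)%N -> (normL C (fun eta =>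
    fset_sum (w k) eta * (u eta - damp (delta k) u eta))%R <= (e / 3)%:E)%E.
  have E k eta : u eta - damp (delta k) u eta = (1 - (1 - delta k) ^+ #|` eta|) * u eta.
    by rewrite /damp; ring.
  have s0n k eta : 0 <= fset_sum (w k) eta <= #|` eta|%:R.
    apply/andP; split.
      by apply: fset_sum_ge0 => x; have /andP[] := w01 k x.
    by apply: fset_sum_le_card => x; have /andP[] := w01 k x.
  apply: (normL_dominated_cvg C_gt0 scard) => // [k|k eta|eta].
  - apply: measurable_funM => //.
      by apply: measurable_fset_sum => //; exact: measurable_row_diagonal.
    by apply: measurable_funB => //; exact: measurable_damp.
  - have /andP[p0 p1] := p01 k eta; have /andP[s0 sn] := s0n k eta.
    rewrite E !normrM mulrA ler_wpM2r// (ger0_norm s0) (ger0_norm (ler0n R _)).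
    by rewrite ger0_norm ?subr_ge0// -[leRHS]mulr1 ler_pM// ?subr_ge0// gerBl.
  - apply: (@cvg0_le_harmonic _ _ (#|` eta|%:R ^+ 2 * `|u eta|) 0) => k _.
    have /andP[p0 p1] := p01 k eta; have /andP[s0 sn] := s0n k eta.
    have /andP[dk0 dk1] := d01 k; have dk01 : 0 <= delta k <= 1 by rewrite ltW.
    have /andP[t1 _] := damp_taylor2 #|` eta| dk01.
    rewrite E !normrM mulrA [leRHS]mulrAC ler_wpM2r// (ger0_norm s0).
    rewrite ger0_norm ?subr_ge0// expr2 -mulrA ler_pM// ?subr_ge0//.
    apply: (@le_trans _ _ (#|` eta|%:R * delta k)); first by lra.
    by rewrite ler_wpM2l.
pose k := maxn N1 (maxn N2 N3); exists (delta k), (w k), (m k); split => //.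
- split => //; rewrite /delta -mulrA ler_pdivrMl ?(lt_le_trans _ (den k))// mulr1.
  by rewrite lerDr.
- rewrite /w; under eq_integral do rewrite -/(EFin _).
  rewrite integral_indic// ?setIT.
    by rewrite /m fineK// ge0_fin_numE//; have [] := @cube_measurable_fin R d k%:R.
  by have [] := @cube_measurable_fin R d k%:R.
have {}H1 := H1 k (leq_maxl _ _).
have {}H2 := H2 k (leq_trans (leq_maxl _ _) (leq_maxr _ _)).
have {}H3 := H3 k (leq_trans (leq_maxr _ _) (leq_maxr _ _)).
apply: nrmL_le; apply: (le_trans (normL_generator_error (d01 k) (w01 k) (mw k) su)).
apply: (le_trans (leeD H1 (leeD H2 H3))).
by rewrite -!EFinD lee_fin; lra.
Qed.

End generator_approximation.

(** * The cone of positive functions *)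

Section positive_cone.
Context (R : realType) (d : nat) (d_gt0 : (0 < d)%N).
Local Notation conf := {fset 'rV[R]_d}.
Local Notation lam := (lambda R d).
Local Notation mu := (lebesgue_measure_row R d).
Variable C : R.
Hypothesis C_gt0 : 0 < C.
Implicit Types (G H k : conf -> R) (w : 'rV[R]_d -> R) (B : set 'rV[R]_d) (eta xi : conf).

Let diag := @measurable_row_diagonal R d.
Let atomless : forall x, mu [set x] = 0%E.
Proof. by move=> x; exact: lebesgue_measure_row_set1. Qed.

Definition positive_cone : set (conf -> R) :=
  [set G | [/\ spaceL C G, exp_bounded G & subset_positive G]].

Lemma positive_cone0 : positive_cone (fun=> 0).
Proof.
split; first exact: spaceL0.
  by exists 0, 1; split => // eta; rewrite normr0 mul0r.
by move=> eta; rewrite /subset_sum /partition_sum big1// => xi _; rewrite mulr0.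
Qed.

Lemma positive_coneD G H : positive_cone G -> positive_cone H ->
  positive_cone (fun eta => G eta + H eta).
Proof.
move=> [sG bG pG] [sH bH pH]; split; last by move=> eta; rewrite subset_sumD addr_ge0.
  by have := spaceL_lin 1 C_gt0 sG sH; under eq_fun do rewrite mul1r.
exact: exp_boundedD.
Qed.

Lemma positive_coneZ a G : 0 <= a -> positive_cone G ->
  positive_cone (fun eta => a * G eta).
Proof.
move=> a0 [sG bG pG]; split; last by move=> eta; rewrite subset_sumZ mulr_ge0.
  by have := spaceL_lin a C_gt0 sG (spaceL0 d C_gt0); under eq_fun do rewrite addr0.
exact: exp_boundedZ.
Qed.

Lemma K_transform_fset G eta : K_transform G [set` eta] = subset_sum (fun=> 1) G eta.
Proof.
rewrite /K_transform (_ : [set xi | _] = [set` fpowerset eta]).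
  rewrite fsbig_finite//= set_fsetK; apply: eq_bigr => xi _.
  by rewrite fset_prod_cst expr1n mul1r.
apply/seteqP; split => xi /=; rewrite fpowersetE.
  by move=> H; apply/fsubsetP => y; exact: H.
by move=> /fsubsetP H y; exact: H.
Qed.

Lemma subset_positive_of_K G :
  (forall gamma, locally_finite gamma -> 0 <= K_transform G gamma) -> subset_positive G.
Proof.
move=> GK eta; rewrite -K_transform_fset; apply: GK => B _.
by apply: sub_finite_set (finite_fset eta); exact: subIsetl.
Qed.

Definition restrict_config B G eta := fset_prod \1_B eta * G eta.

Lemma measurable_restrict_config B G : measurable B -> measurable_fun setT G ->
  measurable_fun setT (restrict_config B G).
Proof.
move=> mB mG; apply: measurable_funM => //; apply: (measurable_fset_prod diag).
exact: measurable_indic.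
Qed.

Lemma norm_restrict_config_le B G eta : `|restrict_config B G eta| <= `|G eta|.
Proof.
rewrite /restrict_config fset_prod_indic.
by case: `[< _ >]; rewrite ?mul1r// mul0r normr0.
Qed.

Lemma restrict_config_sub B G eta : [set` eta] `<=` B -> restrict_config B G eta = G eta.
Proof. by move=> eB; rewrite /restrict_config fset_prod_indic asboolT// mul1r. Qed.

Lemma restrict_config_nsub B G eta : ~ [set` eta] `<=` B -> restrict_config B G eta = 0.
Proof. by move=> eB; rewrite /restrict_config fset_prod_indic asboolF// mul0r. Qed.

(** K of the restriction at gamma is K G at the intersection of gamma with B, a finite
    configuration, where [subset_positive] applies. *)
Lemma K_transform_restrict_ge0 B G gamma : bounded_set B -> locally_finite gamma ->
  subset_positive G -> 0 <= K_transform (restrict_config B G) gamma.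
Proof.
move=> bB lf G0; have fin := lf B bB.
have -> : K_transform (restrict_config B G) gamma =
    K_transform G [set` fset_set (gamma `&` B)].
  rewrite /K_transform fset_setK//.
  rewrite -(@fsbig_widen _ _ _ _ [set eta : conf | [set` eta] `<=` gamma `&` B]).
  - apply: eq_fsbigr => xi; rewrite inE /= => xB; apply: restrict_config_sub.
    by apply: subset_trans xB _; exact: subIsetr.
  - by move=> xi /= xB; apply: subset_trans xB _; exact: subIsetl.
  - move=> xi [/= xg nxB]; apply: restrict_config_nsub => xB; apply: nxB.
    by move=> y yx; split; [exact: xg|exact: xB].
by rewrite K_transform_fset; exact: G0.
Qed.

Lemma pairing_cone_ge0 k G : positive_definite C k -> positive_cone G -> 0 <= pairing G k.
Proof.
move=> [sk kpos] [sG _ pG]; have [mG _] := (spaceLP G C_gt0).1 sG.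
have [mk [M M0 kM]] := (spaceKP k C_gt0).1 sk.
pose g n := restrict_config (cube n%:R) G.
have mB n : measurable (cube n%:R : set 'rV[R]_d) by have [] := @cube_measurable_fin R d n%:R.
have mg n : measurable_fun setT (g n) by exact: measurable_restrict_config.
have sg n : spaceL C (g n).
  by apply: (spaceL_le C_gt0 (mg n) sG); apply: aeW => eta; exact: norm_restrict_config_le.
have g0 n : 0 <= pairing (g n) k.
  apply: kpos => //.
    exists (cube n%:R); split => //; first exact: bounded_cube.
    by move=> eta; exact: restrict_config_nsub.
  by move=> gamma lf; apply: K_transform_restrict_ge0 => //; exact: bounded_cube.
rewrite -oppr_le0; apply/ler_addgt0Pr => e e0; rewrite add0r.
have eM : 0 < e / (M + 1) by rewrite divr_gt0// ltr_wpDl.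
have sd n : spaceL C (fun eta => -1 * G eta + g n eta) by exact: spaceL_lin.
have [N HN] : exists N, forall n, (N <= n)%N ->
    (normL C (fun eta => -1 * G eta + g n eta)%R <= (e / (M + 1))%:E)%E.
  apply: (normL_dominated_cvg C_gt0 sG) => // [n|n eta|eta].
  - by apply: measurable_funD => //; exact: measurable_funM.
  - rewrite /g /restrict_config fset_prod_indic.
    by case: `[< _ >]; rewrite ?mul1r ?mul0r mulN1r ?addNr ?normr0 ?addr0 ?normrN.
  - have [N HN] := fset_sub_cube eta.
    apply: (@cvg0_le_harmonic _ _ 0 N) => n Nn.
    by rewrite /g restrict_config_sub ?mulN1r ?addNr ?normr0 ?mul0r//; exact: HN.
have := pairing_le C_gt0 M0 (sd N) mk kM; rewrite (pairing_linl _ C_gt0 sG (sg N) sk).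
have : M * nrmL C (fun eta => -1 * G eta + g N eta) <= e.
  have := nrmL_le (HN N (leqnn N)); have := nrmL_ge0 C (fun eta => -1 * G eta + g N eta).
  set r := nrmL _ _ => r0 re.
  rewrite (le_trans (_ : _ <= (M + 1) * r))//; first by rewrite ler_wpM2r// lerDl.
  by rewrite mulrC -ler_pdivlMr// ltr_wpDl.
have := g0 N; have := ler_norm (-1 * pairing G k + pairing (g N) k); lra.
Qed.

End positive_cone.

(** * Approximation of local positive functions from the cone and the core *)

Section cone_approximation.
Context (R : realType) (d : nat) (d_gt0 : (0 < d)%N).
Local Notation conf := {fset 'rV[R]_d}.
Local Notation lam := (lambda R d).
Local Notation mu := (lebesgue_measure_row R d).
Implicit Types (c m : R) (G H : conf -> R) (B : set 'rV[R]_d) (eta xi : conf).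

Let diag := @measurable_row_diagonal R d.
Let atomless : forall x, mu [set x] = 0%E.
Proof. by move=> x; exact: lebesgue_measure_row_set1. Qed.

Lemma integral_scaled_indic c m B : 0 <= c -> measurable B -> mu B = m%:E ->
  (\int[mu]_x (c * \1_B x)%:E = (c * m)%:E)%E.
Proof.
move=> c0 mB Bm; under eq_integral do rewrite EFinM.
rewrite ge0_integralZl//.
- by rewrite EFinM -Bm integral_indic// setIT.
- by apply/measurable_EFinP; exact: measurable_indic.
Qed.

Let indic_ge0 c B x : 0 <= c -> 0 <= c * \1_B x.
Proof. by move=> c0; rewrite mulr_ge0// indicE. Qed.

(** Weight and restriction together are multiplication by the product of c 1_B over the
    configuration, under which the K-transform becomes convolution with c 1_B, of mass c m. *)
Lemma normL_restrict_subset_sum_le c m B H : 0 <= c -> measurable B -> mu B = m%:E ->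
  measurable_fun setT H -> (forall eta, 0 <= H eta) ->
  (normL c (restrict_config B (subset_sum (fun=> 1%R) H)) <=
   (expR (c * m))%:E * normL c (restrict_config B H))%E.
Proof.
move=> c0 mB Bm mH H0; pose f x := c * \1_B x : R.
have f0 x : 0 <= f x by exact: indic_ge0.
have mf : measurable_fun setT f by apply: measurable_funM => //; exact: measurable_indic.
have E (K : conf -> R) eta : (forall xi, 0 <= K xi) ->
    c ^+ #|` eta| * `|restrict_config B K eta| = subset_scale f K eta.
  move=> K0; rewrite /restrict_config /subset_scale ger0_norm; last first.
    by rewrite mulr_ge0// fset_prod_ge0// => x; rewrite indicE.
  by rewrite -(fset_prod_cst c) mulrA -fset_prodM.
have S0 eta : 0 <= subset_sum (fun=> 1) H eta by apply: subset_sum_ge0.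
rewrite !normLE//; under eq_integral do rewrite E//; under [in leRHS]eq_integral do rewrite E//.
under eq_integral do rewrite subset_scale_sum.
rewrite (_ : (fun x => f x * 1) = f); last by apply/funext => x; rewrite mulr1.
apply: (integral_subset_sum_le diag atomless) => //.
- by move=> eta; rewrite mulr_ge0// fset_prod_ge0.
- by apply: measurable_funM => //; exact: (measurable_fset_prod diag).
- exact: integral_scaled_indic.
Qed.

(** A subset containing x is not contained in B and contributes 0: K G sees only the points in B. *)
Lemma subset_sum_local B G x eta : (forall xi, ~ [set` xi] `<=` B -> G xi = 0) ->
  x \notin eta -> ~ B x -> subset_sum (fun=> 1) G (x |` eta)%fset = subset_sum (fun=> 1) G eta.
Proof.
move=> GB xe nBx; rewrite subset_sumU1// mul1r (_ : subset_sum _ _ _ = 0) ?add0r//.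
rewrite /subset_sum /partition_sum big1// => xi _; rewrite GB ?mulr0// => H.
by apply/nBx/H; rewrite /= !inE eqxx.
Qed.

(** The truncation is made on K G, where positivity is visible. Once K G is cut at N,
    inclusion-exclusion gives the bound $N2^{|\eta|}$, which provides [exp_bounded] and, for local
    G, membership in every L_c, in particular in the core. *)
Definition truncated_inverse G (N : R) : conf -> R :=
  subset_sum (fun=> -1) (fun xi => Num.min (subset_sum (fun=> 1) G xi) N).

(** If x in eta lies outside B, the subsets of eta with and without x contribute equal values with
    opposite signs, since K G does not see x. *)
Lemma truncated_inverse_local B G N eta : (forall xi, ~ [set` xi] `<=` B -> G xi = 0) ->
  ~ [set` eta] `<=` B -> truncated_inverse G N eta = 0.
Proof.
move=> GB /existsNP[x /not_implyP[/= xe nBx]].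
rewrite -(fsetD1K xe) /truncated_inverse; have xe' : x \notin (eta `\ x)%fset by rewrite !inE eqxx.
rewrite subset_sumU1// mulN1r.
apply/eqP; rewrite subr_eq0; apply/eqP; apply: eq_subset_sum => // xi xis.
rewrite (subset_sum_local GB)//; apply: contra xe'; exact: (fsubsetP xis).
Qed.

Lemma subset_sum_truncated_inverse G N eta :
  subset_sum (fun=> 1) (truncated_inverse G N) eta = Num.min (subset_sum (fun=> 1) G eta) N.
Proof.
rewrite /truncated_inverse subset_sum_comp.
rewrite -[RHS](subset_sum_eq0 (fun xi => Num.min (subset_sum (fun=> 1) G xi) N)).
by apply: eq_subset_sum => // x _; rewrite subrr.
Qed.

Lemma measurable_truncated_inverse G N : measurable_fun setT G ->
  measurable_fun setT (truncated_inverse G N).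
Proof.
move=> mG; apply: (measurable_subset_sum diag) => //.
by apply: measurable_minr => //; exact: (measurable_subset_sum diag).
Qed.

Lemma norm_truncated_inverse_le G N eta : 0 <= N -> subset_positive G ->
  `|truncated_inverse G N eta| <= N * 2 ^+ #|` eta|.
Proof.
move=> N0 G0; rewrite -fset_prod_cst.
rewrite (_ : fset_prod (fun=> 2) eta = subset_sum (fun=> 1) (fun=> 1) eta); last first.
  by rewrite fset_prod_subset_sum; apply: eq_fset_prod => x _.
rewrite -subset_sumZ; apply: normr_subset_sum_le => [x|xi]; first by rewrite normrN1.
by rewrite mulr1 ger0_norm ?ge_min ?lexx ?orbT// le_min N0 G0.
Qed.

Lemma spaceL_truncated_inverse c B G N : 0 < c -> 0 <= N -> measurable B ->
  (mu B < +oo)%E -> measurable_fun setT G -> subset_positive G ->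
  (forall xi, ~ [set` xi] `<=` B -> G xi = 0) -> spaceL c (truncated_inverse G N).
Proof.
move=> c0 N0 mB Bfin mG G0 GB; have mT := measurable_truncated_inverse N mG.
have Bm : mu B = (fine (mu B))%:E by rewrite fineK// ge0_fin_numE.
(* The bound $N2^{|\eta|}$, weighted by $c^{|\eta|}$ and confined to B, is N times [fset_prod f],
   whose integral is at most $e^{2c|B|}$. *)
pose f x := 2 * c * \1_B x : R; have c2 : 0 <= 2 * c by rewrite mulr_ge0// ltW.
have mf : measurable_fun setT f by apply: measurable_funM => //; exact: measurable_indic.
apply/spaceLP => //; split => //.
apply: (@le_lt_trans _ _ (N%:E * \int[lam]_eta (fset_prod f eta)%:E)%E).
  rewrite normLE ?(ltW c0)// -ge0_integralZl//; first last.
  - by move=> eta _; rewrite lee_fin fset_prod_ge0// => x; exact: indic_ge0.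
  - by apply/measurable_EFinP; exact: (measurable_fset_prod diag).
  apply: ge0_le_integral => //.
  - by move=> eta _; rewrite lee_fin mulr_ge0// exprn_ge0// ltW.
  - exact: measurable_weighted_norm.
  - by apply: measurable_funeM; apply/measurable_EFinP; exact: (measurable_fset_prod diag).
  - move=> eta _; rewrite -EFinM lee_fin.
    have [eB|eB] := pselect ([set` eta] `<=` B); last first.
      rewrite (truncated_inverse_local _ GB)// normr0 mulr0 mulr_ge0//.
      by rewrite fset_prod_ge0// => x; exact: indic_ge0.
    rewrite fset_prodM fset_prod_cst fset_prod_indic asboolT// mulr1 exprMn.
    rewrite mulrC mulrA ler_wpM2r ?exprn_ge0 ?(ltW c0)//.
    exact: norm_truncated_inverse_le.
rewrite lte_mul_pinfty ?lee_fin//.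
apply: le_lt_trans (integral_fset_prod_le d_gt0 mf _ (integral_scaled_indic c2 mB Bm)) (ltry _).
by move=> x; exact: indic_ge0.
Qed.

(** Up to sign, g - G is the inverse K-transform of the excess of K G over n. Over B both K and its
    inverse are bounded in L_c by $e^{c|B|}$; so K G restricted to B lies in L_c and dominates the
    excess, which is 0 at each configuration for large n. *)
Lemma cone_approximation c G e : 1 <= c -> spaceL c G -> local_support G ->
  (forall gamma, locally_finite gamma -> 0 <= K_transform G gamma) -> 0 < e ->
  exists g, [/\ positive_cone c g, spaceL (2 * c) g &
    nrmL c (fun eta => g eta - G eta) <= e].
Proof.
move=> c1 sG [B [bB mB GB]] GK e0; have c0 : 0 < c by lra.
have G0 := subset_positive_of_K GK; have [mG Gfin] := (spaceLP G c0).1 sG.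
have [M BM] := bounded_sub_cube bB; have [mM Mfin] := @cube_measurable_fin R d M.
have Bfin : (mu B < +oo)%E by apply: le_lt_trans Mfin; apply: le_measure; rewrite ?inE.
have Bm : mu B = (fine (mu B))%:E by rewrite fineK// ge0_fin_numE.
set m := fine (mu B) in Bm.
pose F := subset_sum (fun=> 1) G.
have mF : measurable_fun setT F by exact: (measurable_subset_sum diag).
have F0 eta : 0 <= F eta by exact: G0.
pose Rn (n : nat) eta := F eta - Num.min (F eta) n%:R.
have Rn0 n eta : 0 <= Rn n eta by rewrite subr_ge0 ge_min lexx.
have mRn n : measurable_fun setT (Rn n).
  by apply: measurable_funB => //; exact: measurable_minr.
have sF : spaceL c (restrict_config B F).
  apply/spaceLP => //; split; first exact: measurable_restrict_config.
  have mGn : measurable_fun setT (fun eta => `|G eta|) by exact: measurableT_comp.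
  have Gn0 eta : 0 <= `|G eta| by [].
  apply: (@le_lt_trans _ _ ((expR (c * m))%:E * normL c G)%E); last first.
    by rewrite lte_mul_pinfty// ?lee_fin ?expR_ge0//.
  apply: (@le_trans _ _ (normL c (restrict_config B (subset_sum (fun=> 1) (fun eta => `|G eta|))))).
    apply: le_normL; [exact: ltW|exact: measurable_restrict_config| |].
      by apply: measurable_restrict_config => //; exact: (measurable_subset_sum diag).
    apply: aeW => eta; rewrite /restrict_config !normrM ler_wpM2l//.
    rewrite (le_trans _ (ler_norm _))//; apply: normr_subset_sum_le => // x.
    by rewrite normr1.
  apply: (le_trans (normL_restrict_subset_sum_le (ltW c0) mB Bm mGn Gn0)).
  apply: lee_wpmul2l; first by rewrite lee_fin expR_ge0.
  apply: le_normL => //; [exact: ltW|exact: measurable_restrict_config|].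
  by apply: aeW => eta; rewrite (le_trans (norm_restrict_config_le _ _ _))// normr_id.
(* The inverse K-transform will cost the factor [expR (c * m)], divided out in advance. *)
have e1 : 0 < e / expR (c * m) by rewrite divr_gt0// expR_gt0.
have [n Hn] : exists N, forall n, (N <= n)%N ->
    (normL c (restrict_config B (Rn n)) <= (e / expR (c * m))%:E)%E.
  apply: (normL_dominated_cvg c0 sF) => // [n|n eta|eta].
  - exact: measurable_restrict_config.
  - rewrite /restrict_config !normrM ler_wpM2l// (ger0_norm (F0 eta)) (ger0_norm (Rn0 n eta)).
    by rewrite gerBl le_min ler0n F0.
  - apply: (@cvg0_le_harmonic _ _ 0 (Num.truncn (F eta)).+1) => n Nn.
    rewrite mul0r normr_le0 /restrict_config /Rn (_ : Num.min _ _ = F eta) ?subrr ?mulr0//.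
    apply/min_idPl; apply/ltW/(lt_le_trans (truncnS_gt _)); by rewrite ler_nat.
exists (truncated_inverse G n%:R); split.
- split.
  + exact: (spaceL_truncated_inverse c0 (ler0n _ _) mB Bfin).
  + exists n%:R, 2; split => //; [by rewrite ler1n|move=> eta].
    exact: norm_truncated_inverse_le.
  + by move=> eta; rewrite subset_sum_truncated_inverse le_min G0 ler0n.
- by apply: (spaceL_truncated_inverse _ (ler0n _ _) mB Bfin) => //; rewrite mulr_gt0.
apply: nrmL_le; apply: (@le_trans _ _ (normL c (restrict_config B (subset_sum (fun=> 1) (Rn n))))).
  apply: le_normL; [exact: ltW| | |].
  - by apply: measurable_funB => //; exact: measurable_truncated_inverse.
  - by apply: measurable_restrict_config => //; exact: (measurable_subset_sum diag).
  apply: aeW => eta; have [eB|eB] := pselect ([set` eta] `<=` B); last first.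
    by rewrite (truncated_inverse_local _ GB)// GB// subrr normr0.
  rewrite (restrict_config_sub _ eB) (le_trans _ (ler_norm _))//.
  rewrite (_ : _ - _ = subset_sum (fun=> -1) (fun xi => -1 * Rn n xi) eta).
    apply: normr_subset_sum_le => [x|xi]; first by rewrite normrN1.
    by rewrite mulN1r normrN ger0_norm.
  have -> : G eta = subset_sum (fun=> -1) F eta.
    rewrite /F subset_sum_comp -[LHS]subset_sum_eq0.
    by apply: eq_subset_sum => // x _; rewrite addNr.
  rewrite /truncated_inverse -/F -[- subset_sum _ F _]mulN1r -subset_sumZ -subset_sumD.
  apply: eq_subset_sum => // xi _.
  by rewrite /Rn; ring.
apply: (le_trans (normL_restrict_subset_sum_le (ltW c0) mB Bm (mRn n) (Rn0 n))).
apply: (le_trans (lee_wpmul2l _ (Hn n (leqnn n)))); first by rewrite lee_fin expR_ge0.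
by rewrite -EFinM lee_fin mulrCA divff ?mulr1// gt_eqF// expR_gt0.
Qed.

End cone_approximation.

(** * Contraction semigroups and their adjoints *)

Lemma cvg_right0P (R : realType) (F : R -> \bar R) : (forall h, 0 <= F h)%E ->
  (F h @[h --> 0^'+] --> 0%E) <->
  (forall e, 0 < e -> exists2 h0, 0 < h0 & forall h, 0 < h < h0 -> (F h <= e%:E)%E).
Proof.
move=> F0; split => [/fine_cvgP[Ffin /cvgrPdist_le Fcvg] e e0|H].
  have : \forall h \near 0^'+, (F h <= e%:E)%E.
    near=> h; have Fh : F h \is a fin_num by near: h.
    rewrite -(fineK Fh) lee_fin.
    have : `|0 - (fine \o F) h| <= e by near: h; exact: Fcvg.
    by rewrite sub0r normrN ger0_norm//= fine_ge0.
  move=> [h0 /= h00 Hh]; exists h0 => // h /andP[hgt hlt]; apply: Hh => //.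
  by rewrite /= sub0r normrN gtr0_norm.
have fin : \forall h \near 0^'+, F h \is a fin_num.
  have [h0 h00 Hh] := H 1 ltr01; near=> h.
  rewrite ge0_fin_numE//; apply: (@le_lt_trans _ _ 1%:E); last exact: ltry.
  by apply: Hh; apply/andP; split; near: h; [exact: nbhs_right_gt|exact: nbhs_right_lt].
apply/fine_cvgP; split => //; apply/cvgrPdist_le => e e0.
have [h0 h00 Hh] := H e e0; near=> h.
rewrite sub0r normrN ger0_norm ?fine_ge0//= -lee_fin fineK; last by near: h.
by apply: Hh; apply/andP; split; near: h; [exact: nbhs_right_gt|exact: nbhs_right_lt].
Unshelve. all: by end_near. Qed.

Lemma cvg_seq0_le (R : realType) (F : nat -> \bar R) e : (forall n, 0 <= F n)%E ->
  F n @[n --> \oo] --> 0%E -> 0 < e -> \forall n \near \oo, (F n <= e%:E)%E.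
Proof.
move=> F0 /fine_cvgP[Ffin /cvgrPdist_le Fcvg] e0; near=> n.
have Fn : F n \is a fin_num by near: n.
rewrite -(fineK Fn) lee_fin.
have : `|0 - (fine \o F) n| <= e by near: n; exact: Fcvg.
by rewrite sub0r normrN ger0_norm//= fine_ge0.
Unshelve. all: by end_near. Qed.

Lemma ae_eq_forall disp (X : measurableType disp) (R : realType)
    (m : {measure set X -> \bar R}) (f g : X -> R) :
  f = g %[ae m] <-> {ae m, forall x, f x = g x}.
Proof. by split; apply: filterS => x H //; exact: H. Qed.

Section semigroups.
Context (R : realType) (d : nat) (d_gt0 : (0 < d)%N).
Local Notation conf := {fset 'rV[R]_d}.
Local Notation lam := (lambda R d).
Variables (C : R) (T : R -> (conf -> R) -> conf -> R).
Hypotheses (C_gt0 : 0 < C) (T_semigroup : contraction_semigroup C T).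
Implicit Types (G H u v k : conf -> R) (t s h : R).

Let sT t G : 0 <= t -> spaceL C G -> spaceL C (T t G).
Proof. exact: (semigroup_spaceL T_semigroup). Qed.

Let sM G : spaceL C G -> measurable_fun setT G.
Proof. by move=> /(spaceLP G C_gt0)[]. Qed.

Lemma spaceL_sub G H : spaceL C G -> spaceL C H -> spaceL C (fun eta => G eta - H eta).
Proof.
move=> sG sH; have := spaceL_lin (-1) C_gt0 sH sG.
by rewrite (_ : (fun eta => -1 * _ + _) = fun eta => G eta - H eta)//;
  apply/funext => eta; rewrite mulN1r addrC.
Qed.

Lemma nrmL_ae_eq G H : spaceL C G -> spaceL C H -> G = H %[ae lam] ->
  nrmL C G = nrmL C H.
Proof.
move=> sG sH GH; rewrite /nrmL; congr fine; apply: normL_ae_eq => //.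
- exact: ltW.
- exact: sM.
- exact: sM.
Qed.

Lemma semigroup_lin3 t a b c G H u : 0 <= t -> spaceL C G -> spaceL C H -> spaceL C u ->
  T t (fun eta => a * G eta + (b * H eta + c * u eta)) =
  (fun eta => a * T t G eta + (b * T t H eta + c * T t u eta)) %[ae lam].
Proof.
move=> t0 sG sH su; have s0 := spaceL0 d C_gt0.
have su' := spaceL_lin c C_gt0 su s0; have sHu := spaceL_lin b C_gt0 sH su'.
have E1 := semigroup_linear T_semigroup a t0 sG sHu.
have E2 := semigroup_linear T_semigroup b t0 sH su'.
have E3 := semigroup_linear T_semigroup c t0 su s0.
have E4 := semigroup_linear T_semigroup 1 t0 s0 s0.
have -> : (fun eta => a * G eta + (b * H eta + c * u eta)) =
    (fun eta => a * G eta + (b * H eta + (c * u eta + 0))).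
  by apply/funext => eta; rewrite addr0.
(* Linearity at the zero function reads T t 0 = T t 0 + T t 0, so T t 0 vanishes almost
   everywhere. *)
have E5 : (fun _ : conf => 1 * 0 + 0 : R) = (fun=> 0).
  by apply/funext => eta; rewrite mulr0 addr0.
rewrite E5 in E4.
move/ae_eq_forall : E1 => E1; move/ae_eq_forall : E2 => E2.
move/ae_eq_forall : E3 => E3; move/ae_eq_forall : E4 => E4.
apply/ae_eq_forall; apply: filterS3 (filterI E1 E2) E3 E4 => eta [e1 e2] e3 e4.
rewrite e1 e2 e3; move: e4; rewrite mul1r => /eqP.
by rewrite -subr_eq0 opprD addrA subrr sub0r oppr_eq0 => /eqP ->; rewrite addr0.
Qed.

Lemma nrmL_semigroup t G : 0 <= t -> spaceL C G -> nrmL C (T t G) <= nrmL C G.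
Proof.
move=> t0 sG; rewrite -lee_fin -!nrmLE//; last exact: sT.
exact: (semigroup_contraction T_semigroup t0 sG).
Qed.

Lemma nrmL_semigroup_sub t G H : 0 <= t -> spaceL C G -> spaceL C H ->
  nrmL C (fun eta => T t G eta - T t H eta) <= nrmL C (fun eta => G eta - H eta).
Proof.
move=> t0 sG sH; have sGH := spaceL_sub sG sH; have s0 := spaceL0 d C_gt0.
rewrite (@nrmL_ae_eq _ (T t (fun eta => G eta - H eta))).
- exact: nrmL_semigroup.
- by apply: spaceL_sub; exact: sT.
- exact: sT.
have /ae_eq_forall := semigroup_lin3 1 (-1) 0 t0 sG sH s0.
rewrite (_ : (fun eta => 1 * G eta + _) = (fun eta => G eta - H eta)); last first.
  by apply/funext => eta; ring.
by move=> E; apply/ae_eq_forall; apply: filterS E => eta ->; ring.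
Qed.

(** [T t] commutes with difference quotients almost everywhere and is a contraction, so at [T t u]
    they converge at least as fast as at u. *)
Lemma generator_flow t u v : 0 <= t -> semigroup_generator C T (u, v) ->
  semigroup_generator C T (T t u, T t v).
Proof.
move=> t0 [/= su sv]; have Stu := sT t0 su; have Stv := sT t0 sv.
move=> /cvg_right0P; move=> /(_ (fun h => Lnorm_ge0 _ _ _)) H.
split => //=; apply/cvg_right0P => [h|e e0]; first exact: Lnorm_ge0.
have [h0 h00 Hh] := H e e0; exists h0 => // h hh; have /andP[hgt _] := hh.
apply: le_trans (Hh h hh).
have Shu := sT (ltW hgt) su.
have SD : spaceL C (fun eta => h^-1 * (T h u eta - u eta) - v eta).
  apply: spaceL_sub => //; have := spaceL_lin h^-1 C_gt0 (spaceL_sub Shu su) (spaceL0 d C_gt0).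
  by under eq_fun do rewrite addr0.
apply: le_trans (semigroup_contraction T_semigroup t0 SD).
apply: le_normL.
- exact: ltW.
- apply: measurable_funB; last exact: sM.
  apply: measurable_funM => //; apply: measurable_funB; last exact: sM.
  by apply: sM; apply: sT => //; exact: ltW.
- by apply: sM; exact: sT.
have /ae_eq_forall E1 := semigroup_lin3 h^-1 (- h^-1) (-1) t0 Shu su sv.
have /ae_eq_forall E2 := semigroupD T_semigroup (ltW hgt) t0 su.
have /ae_eq_forall E3 := semigroupD T_semigroup t0 (ltW hgt) su.
apply: filterS3 E1 E2 E3 => eta e1 e2 e3.
rewrite (_ : (fun eta => h^-1 * (T h u eta - u eta) - v eta) =
  (fun eta => h^-1 * T h u eta + (- h^-1 * u eta + -1 * v eta))); last first.
  by apply/funext => e'; ring.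
rewrite e1 -e3 -e2 (addrC h t).
by rewrite le_eqVlt; apply/orP; left; apply/eqP; congr `|_|; ring.
Qed.

(** The weak form of kt = T^*(t) k, kept as a relation because kt is determined only almost
    everywhere. *)
Definition dual_flow t k kt := spaceK C kt /\
  forall G, spaceL C G -> pairing (T t G) k = pairing G kt.

Lemma dual_flow_exists t k : 0 <= t -> spaceK C k -> exists kt, dual_flow t k kt.
Proof.
move=> t0 sk; have [mk [M M0 kM]] := (spaceKP k C_gt0).1 sk.
have lin a G H : spaceL C G -> spaceL C H ->
    pairing (T t (fun eta => a * G eta + H eta)) k = a * pairing (T t G) k + pairing (T t H) k.
  move=> sG sH; rewrite -(pairing_linl a C_gt0 (sT t0 sG) (sT t0 sH) sk).
  apply: eq_pairing_ae => //.
  - by apply: sM; apply: sT => //; exact: spaceL_lin.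
  - by apply: sM; apply: spaceL_lin => //; exact: sT.
  - exact: (semigroup_linear T_semigroup a t0 sG sH).
have bd G : spaceL C G -> `|pairing (T t G) k| <= M * nrmL C G.
  move=> sG; apply: (le_trans (pairing_le C_gt0 M0 (sT t0 sG) mk kM)).
  by rewrite ler_wpM2l//; exact: nrmL_semigroup.
have [kt [mkt ktM E]] := dual_repr d_gt0 C_gt0 M0 lin bd.
by exists kt; split => //; apply/(spaceKP kt C_gt0); split => //; exists M.
Qed.

Lemma dual_flow_bound t k k' kt kt' M : 0 <= t -> 0 <= M -> spaceK C k -> spaceK C k' ->
  dual_flow t k kt -> dual_flow t k' kt' ->
  bounded_by C (fun eta => k eta - k' eta) M -> bounded_by C (fun eta => kt eta - kt' eta) M.
Proof.
move=> t0 M0 sk sk' [skt kt_dual] [skt' kt_dual'] kM.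
have [mk _] := (spaceKP k C_gt0).1 sk; have [mk' _] := (spaceKP k' C_gt0).1 sk'.
have subE f f' : (fun eta : conf => f eta - f' eta : R) = (fun eta => -1 * f' eta + f eta).
  by apply/funext => eta; ring.
have sd : spaceK C (fun eta => kt eta - kt' eta).
  have [mkt [A A0 kA]] := (spaceKP kt C_gt0).1 skt.
  have [mkt' [A' A'0 kA']] := (spaceKP kt' C_gt0).1 skt'.
  apply/(spaceKP _ C_gt0); split; first exact: measurable_funB.
  exists (A + A'); first exact: addr_ge0.
  apply: filterS2 kA kA' => eta h h'; rewrite mulrDl.
  by apply: (le_trans (ler_normB _ _)); exact: lerD.
apply: (dual_norm d_gt0 C_gt0 M0 sd) => G sG; have sTG := sT t0 sG.
rewrite subE (pairing_linr _ C_gt0 sG skt' skt) -kt_dual// -kt_dual'//.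
rewrite -(pairing_linr (-1) C_gt0 sTG sk' sk) -subE.
apply: (le_trans (pairing_le C_gt0 M0 sTG _ kM)); first exact: measurable_funB.
by rewrite ler_wpM2l//; exact: nrmL_semigroup.
Qed.

Section generator.
Variable L : operatorL R d.
Hypothesis L_space : forall u v, L (u, v) -> spaceL C u /\ spaceL C v.
Hypothesis T_generator : semigroup_generator C T = closure_operator C L.

Lemma generator_core u v : L (u, v) -> semigroup_generator C T (u, v).
Proof.
move=> Luv; have [su sv] := L_space Luv; rewrite T_generator; split => //.
have E f : normL C (f \- f)%R = 0%E.
  rewrite (_ : (f \- f)%R = fun=> 0); last by apply/funext => eta; rewrite /= subrr.
  by rewrite normLE ?(ltW C_gt0)// integral0_eq// => eta _; rewrite normr0 mulr0.
by exists (fun=> (u, v)); split => //=; rewrite E; exact: cvg_cst.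
Qed.

Lemma generator_approx u v e : semigroup_generator C T (u, v) -> 0 < e ->
  exists u' v', [/\ L (u', v'), nrmL C (fun eta => u' eta - u eta) <= e &
    nrmL C (fun eta => v' eta - v eta) <= e].
Proof.
rewrite T_generator => -[/= su sv [s [Ls s1 s2]]] e0.
have H1 := cvg_seq0_le (fun n => Lnorm_ge0 _ _ _) s1 e0.
have H2 := cvg_seq0_le (fun n => Lnorm_ge0 _ _ _) s2 e0.
have [n [h1 h2]] := filter_ex (filterI H1 H2).
exists (s n).1, (s n).2; split; [by rewrite -surjective_pairing|exact: nrmL_le|exact: nrmL_le].
Qed.

(** For (G, H) in L the pair (T t G, T t H) lies in the closure of L, perhaps not in L. The adjoint
    relation of k is therefore used at approximations from L and passed to the limit. *)
Lemma dual_flow_adjoint t k k' kt kt' : 0 <= t -> adjoint_operator C L (k, k') ->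
  dual_flow t k kt -> dual_flow t k' kt' -> adjoint_operator C L (kt, kt').
Proof.
move=> t0 [/= sk sk' adj] [skt kt_dual] [skt' kt_dual']; split => //= G H LGH.
have [sG sH] := L_space LGH; rewrite -kt_dual// -kt_dual'//.
have sTG := sT t0 sG; have sTH := sT t0 sH.
have [mk [M M0 kM]] := (spaceKP k C_gt0).1 sk.
have [mk' [M' M'0 kM']] := (spaceKP k' C_gt0).1 sk'.
have gen := generator_flow t0 (generator_core LGH).
have lin f g l : spaceL C f -> spaceL C g -> spaceK C l ->
    pairing (fun eta => f eta - g eta) l = pairing f l - pairing g l.
  move=> sf sg sl; rewrite (_ : (fun eta => f eta - g eta) = (fun eta => -1 * g eta + f eta)).
    by rewrite (pairing_linl _ C_gt0 sg sf sl); ring.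
  by apply/funext => eta; ring.
apply/eqP; rewrite -subr_eq0 -normr_le0; apply/ler_addgt0Pr => e e0; rewrite add0r.
(* The errors in the two components carry the factors M' and M; the 1 keeps the denominator
   positive. *)
have MM : 0 < M + M' + 1 by lra.
have [u [v [Luv Nu Nv]]] := generator_approx gen (divr_gt0 e0 MM).
have [su sv] := L_space Luv.
have := pairing_le C_gt0 M0 (spaceL_sub sv sTH) mk kM.
have := pairing_le C_gt0 M'0 (spaceL_sub su sTG) mk' kM'.
rewrite !lin// (adj _ _ Luv).
have : M * nrmL C (fun eta => v eta - T t H eta) <= M * (e / (M + M' + 1)) by rewrite ler_wpM2l.
have : M' * nrmL C (fun eta => u eta - T t G eta) <= M' * (e / (M + M' + 1)) by rewrite ler_wpM2l.
have : (M + M' + 1) * (e / (M + M' + 1)) = e by rewrite mulrC divfK// gt_eqF.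
have : 0 < e / (M + M' + 1) by rewrite divr_gt0.
rewrite !ler_norml => ? ? ? ? /andP[? ?] /andP[? ?]; apply/andP; split; lra.
Qed.

Lemma dual_flow_closure t k kt : 0 <= t ->
  closureK C (operator_domain (adjoint_operator C L)) k -> dual_flow t k kt ->
  closureK C (operator_domain (adjoint_operator C L)) kt.
Proof.
move=> t0 [sk kcl] kt_dual; split; first by have [] := kt_dual.
(* Halving e leaves room: the bound is transported by the flow as a weak inequality, while the
   closure asks for a strict one. *)
move=> e e0; have [k0 [k0' adj] kk0] := kcl _ (divr_gt0 e0 (ltr0n R 2)).
have [/= sk0 sk0' _] := adj.
have [k0t k0t_dual] := dual_flow_exists t0 sk0.
have [k0t' k0t_dual'] := dual_flow_exists t0 sk0'.
exists k0t; first by exists k0t'; exact: (dual_flow_adjoint t0 adj).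
have e2 : 0 <= e / 2 by rewrite divr_ge0// ltW.
apply: (@le_lt_trans _ _ (e / 2)%:E); last by rewrite lte_fin; lra.
apply/(normK_leP _ C_gt0 e2).
apply: (dual_flow_bound t0 e2 sk sk0 kt_dual k0t_dual).
exact/(normK_leP _ C_gt0 e2)/ltW.
Qed.

(** Contractivity of [T s] reduces the defect at time s to the defect at time 0; this is the
    uniformity in s that [cone_dist_flow] needs. *)
Lemma semigroup_small u v e : semigroup_generator C T (u, v) -> 0 < e ->
  exists2 h0, 0 < h0 & forall h s, 0 < h < h0 -> 0 <= s ->
    nrmL C (fun eta => T (s + h) u eta - h * T (s + h) v eta - T s u eta) <= e * h.
Proof.
move=> [/= su sv /(cvg_right0P (fun h => Lnorm_ge0 _ _ _)) H] e0.
have := semigroup_continuous T_semigroup sv => /(cvg_right0P (fun h => Lnorm_ge0 _ _ _)) Hv.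
have e2 : 0 < e / 2 by rewrite divr_gt0.
have [h1 h10 H1] := H _ e2; have [h2 h20 H2] := Hv _ e2.
exists (Num.min h1 h2); first by rewrite lt_min h10.
move=> h s; rewrite lt_min => /and3P[h0 hh1 hh2] s0; have hge0 := ltW h0.
have {}H1 : nrmL C (fun eta => h^-1 * (T h u eta - u eta) - v eta) <= e / 2.
  by apply: nrmL_le; apply: H1; rewrite h0.
have {}H2 : nrmL C (fun eta => T h v eta - v eta) <= e / 2.
  by apply: nrmL_le; apply: H2; rewrite h0.
have sThu := sT hge0 su; have sThv := sT hge0 sv; have s0' := spaceL0 d C_gt0.
have sZ a (f : conf -> R) : spaceL C f -> spaceL C (fun eta => a * f eta).
  by move=> sf; have := spaceL_lin a C_gt0 sf s0'; under eq_fun do rewrite addr0.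
pose D eta := T h u eta - h * T h v eta - u eta.
have sD : spaceL C D by apply: spaceL_sub => //; apply: spaceL_sub => //; exact: sZ.
have shge0 : 0 <= s + h by rewrite addr_ge0.
have sA : spaceL C (fun eta => h^-1 * (T h u eta - u eta) - v eta).
  by apply: spaceL_sub => //; apply: sZ; exact: spaceL_sub.
rewrite (@nrmL_ae_eq _ (T s D)); first last.
- have /ae_eq_forall E1 := semigroup_lin3 1 (- h) (-1) s0 sThu sThv su.
  have /ae_eq_forall E2 := semigroupD T_semigroup s0 hge0 su.
  have /ae_eq_forall E3 := semigroupD T_semigroup s0 hge0 sv.
  apply/ae_eq_forall; apply: filterS3 E1 E2 E3 => eta e1 e2' e3.
  rewrite (_ : D = (fun eta => 1 * T h u eta + (- h * T h v eta + -1 * u eta))); last first.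
    by apply/funext => e'; rewrite /D; ring.
  by rewrite e1 e2' e3; ring.
- exact: sT.
- by apply: spaceL_sub; [apply: spaceL_sub; [exact: sT|apply: sZ; exact: sT]|exact: sT].
apply: (le_trans (nrmL_semigroup s0 sD)).
(* The implicit Euler defect splits into the error of the difference quotient at u and the variation
   of [T h v], controlled by strong continuity; each is at most h e / 2. *)
rewrite (_ : D = (fun eta => h * (h^-1 * (T h u eta - u eta) - v eta) + - h * (T h v eta - v eta))); last first.
  by apply/funext => eta; rewrite /D; field; rewrite gt_eqF.
apply: (le_trans (nrmLD C_gt0 (sZ h _ sA) (sZ (- h) _ (spaceL_sub sThv sv)))).
rewrite !nrmLZ//; last exact: spaceL_sub.
rewrite normrN gtr0_norm// -mulrDr mulrC ler_wpM2r//.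
have -> : e = e / 2 + e / 2 by lra.
exact: lerD.
Qed.

End generator.
End semigroups.

(** * Preservation of positive definiteness *)

Section positivity_preserved.
Context (R : realType) (d : nat) (d_gt0 : (0 < d)%N).
Local Notation conf := {fset 'rV[R]_d}.
Local Notation lam := (lambda R d).
Local Notation mu := (lebesgue_measure_row R d).
Variable phi : 'rV[R]_d -> R.
Hypotheses (mphi : measurable_fun setT phi) (phi_ge0 : forall x, 0 <= phi x)
  (phi_even : forall x, phi (- x) = phi x) (Cphi_fin : (C_phi phi < +oo)%E).
Variables (z C : R) (T : R -> (conf -> R) -> conf -> R).
Hypotheses (z_ge0 : 0 <= z) (C_ge1 : 1 <= C) (zC : z * (expR (C * cphi phi) / C) <= 1).
Hypotheses (T_semigroup : contraction_semigroup C T)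
  (T_generator : semigroup_generator C T = closure_operator C (hatL_operator z phi C)).

Let C_gt0 : 0 < C. Proof. exact: lt_le_trans C_ge1. Qed.

Lemma hatL_operator_spaceL u v : hatL_operator z phi C (u, v) -> spaceL C u /\ spaceL C v.
Proof.
move=> [/= su ->]; split; last exact: spaceL_hatL.
by apply: (le_spaceL C_gt0 _ su); rewrite ler_peMl ?ler1n// ltW.
Qed.

Local Notation dist := (cone_dist (nrmL C) (positive_cone C : set (conf -> R))).

(** The orbit stays in the domain of the generator but may leave L_2C, where the discrete steps
    approximate. Dissipativity is obtained on L_2C and reaches the orbit by closure of the graph. *)
Lemma cone_dist_semigroup g t : positive_cone C g -> spaceL (2 * C) g -> 0 <= t ->
  dist (T t g) <= dist (T 0 g).
Proof.
move=> pg sg t0; pose Ag := hatL z phi g.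
have [sg1 sAg] := hatL_operator_spaceL (conj sg erefl : hatL_operator z phi C (g, Ag)).
have gen : semigroup_generator C T (g, Ag).
  by apply: (generator_core C_gt0 hatL_operator_spaceL T_generator).
have cone_sub : (positive_cone C : set (conf -> R)) `<=` spaceL C by move=> f [].
have lin a (f f' : conf -> R) : spaceL C f -> spaceL C f' -> spaceL C (fun x => a * f x + f' x).
  exact: spaceL_lin.
have N0 (f : conf -> R) : spaceL C f -> 0 <= nrmL C f by move=> _; exact: nrmL_ge0.
have ND (f f' : conf -> R) : spaceL C f -> spaceL C f' ->
  nrmL C (fun x => f x + f' x) <= nrmL C f + nrmL C f' by exact: nrmLD.
have NZ a (f : conf -> R) : spaceL C f -> nrmL C (fun x => a * f x) = `|a| * nrmL C f.
  exact: nrmLZ.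
have P0 := @positive_cone0 R d C C_gt0.
have PD := @positive_coneD R d C C_gt0.
have PZ := @positive_coneZ R d C C_gt0.
apply: (@cone_dist_flow _ _ (spaceL C) _ _ lin N0 ND cone_sub P0 (T ^~ g) (fun s => T s Ag)) => //.
- by move=> s s0; exact: (semigroup_spaceL T_semigroup).
- by move=> s s0; exact: (semigroup_spaceL T_semigroup).
- move=> s h s0 h0; have gens := generator_flow C_gt0 T_semigroup s0 gen.
  apply: (cone_dist_dissipative_closure lin N0 ND NZ cone_sub P0) => //.
  + exact: (semigroup_spaceL T_semigroup).
  + exact: (semigroup_spaceL T_semigroup).
  move=> e e0; have [u [v [[/= su vE] Nu Nv]]] := generator_approx T_generator gens e0.
  rewrite vE in Nv *.
  have [su1 sv] := hatL_operator_spaceL (conj su erefl : hatL_operator z phi C (u, hatL z phi u)).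
  exists u, (hatL z phi u); split => //.
  apply: (cone_dist_dissipative_lim lin N0 ND NZ cone_sub P0 PD PZ) => // e' e'0.
  have [delta [w [m [[d01 dzm] w01 mw wm Nd]]]] :=
    generator_approximation d_gt0 mphi phi_ge0 phi_even Cphi_fin z_ge0 C_ge1 zC su e'0.
  have /andP[dgt0 dle1] := d01; have d01' : 0 <= delta <= 1 by rewrite ltW.
  have w0 x : 0 <= w x by have /andP[] := w01 x.
  exists (bd_step phi z delta w), delta; split => //; split.
  + by move=> f sf; exact: spaceL_bd_step.
  + move=> f [sf bf pf]; have [mf _] := (spaceLP f C_gt0).1 sf; split.
    * exact: spaceL_bd_step.
    * exact: (exp_bounded_bd_step mphi phi_ge0 w0 mw wm).
    * exact: (subset_positive_bd_step d_gt0 mphi phi_ge0 w0 mw wm).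
  + by move=> f f' sf [sf' _ _]; exact: bd_step_contraction.
- move=> e e0; exact: (semigroup_small C_gt0 T_semigroup gen).
Qed.

Lemma pairing_semigroup_ge0 k G t : positive_definite C k -> spaceL C G ->
  local_support G -> (forall gamma, locally_finite gamma -> 0 <= K_transform G gamma) ->
  0 <= t -> 0 <= pairing (T t G) k.
Proof.
move=> kpos sG Gloc GK t0; have [sk _] := kpos.
have [mk [M M0 kM]] := (spaceKP k C_gt0).1 sk.
rewrite -oppr_le0; apply/ler_addgt0Pr => e e0; rewrite add0r.
(* Two approximations, of G by g and of [T t g] by an element of the cone, each cost M times the
   precision. *)
have MM : 0 < 2 * M + 1 by lra.
have e1 : 0 < e / (2 * M + 1) by rewrite divr_gt0.
have [g [pg sg Ng]] := cone_approximation d_gt0 C_ge1 sG Gloc GK e1.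
have [sg1 _ _] := pg.
have sTg : spaceL C (T t g) by exact: (semigroup_spaceL T_semigroup).
have sTG : spaceL C (T t G) by exact: (semigroup_spaceL T_semigroup).
have sT0 : spaceL C (T 0 g) by exact: (semigroup_spaceL T_semigroup).
have cone_sub : (positive_cone C : set (conf -> R)) `<=` spaceL C by move=> f [].
have lin a (f f' : conf -> R) : spaceL C f -> spaceL C f' -> spaceL C (fun x => a * f x + f' x).
  exact: spaceL_lin.
have N0 (f : conf -> R) : spaceL C f -> 0 <= nrmL C f by move=> _; exact: nrmL_ge0.
have P0 := @positive_cone0 R d C C_gt0.
have d0 : dist (T t g) <= 0.
  apply: (le_trans (cone_dist_semigroup pg sg t0)).
  (* [T 0 g] equals g only almost everywhere, so it need not itself lie in the cone; the norm of the
     difference is 0 all the same. *)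
  have N00 : nrmL C (fun eta => T 0 g eta - g eta) = 0.
    rewrite (@nrmL_ae_eq _ _ _ C_gt0 _ (fun=> 0)).
    - by rewrite /nrmL normLE ?(ltW C_gt0)// integral0_eq// => eta _; rewrite normr0 mulr0.
    - exact: spaceL_sub.
    - exact: spaceL0.
    - have /ae_eq_forall := semigroup0 T_semigroup sg1.
      by move=> E; apply/ae_eq_forall; apply: filterS E => eta ->; rewrite subrr.
  by have := cone_dist_le lin N0 cone_sub P0 sT0 pg; rewrite N00.
have [p pp Np] := cone_dist_lt lin N0 cone_sub P0 sTg e1.
have {}Np : nrmL C (fun eta => T t g eta - p eta) <= e / (2 * M + 1) by lra.
have [sp _ _] := pp; have p0 := pairing_cone_ge0 C_gt0 kpos pp.
have N1 : nrmL C (fun eta => T t g eta - T t G eta) <= e / (2 * M + 1).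
  by apply: le_trans Ng; exact: nrmL_semigroup_sub.
have plin f f' : spaceL C f -> spaceL C f' ->
    pairing (fun eta => f eta - f' eta) k = pairing f k - pairing f' k.
  move=> sf sf'; rewrite (_ : (fun eta => f eta - f' eta) = (fun eta => -1 * f' eta + f eta)).
    by rewrite (pairing_linl _ C_gt0 sf' sf sk); ring.
  by apply/funext => eta; ring.
have := pairing_le C_gt0 M0 (spaceL_sub C_gt0 sTg sTG) mk kM.
have := pairing_le C_gt0 M0 (spaceL_sub C_gt0 sTg sp) mk kM.
rewrite !plin//.
have := ler_wpM2l M0 N1; have := ler_wpM2l M0 Np.
have : (2 * M + 1) * (e / (2 * M + 1)) = e by rewrite mulrC divfK// gt_eqF.
rewrite !ler_norml => ? ? ? /andP[? ?] /andP[? ?]; lra.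
Qed.

Theorem positive_definite_sun_dual k t :
  closureK C (operator_domain (adjoint_operator C (hatL_operator z phi C))) k ->
  positive_definite C k -> 0 <= t ->
  exists kt : conf -> R,
    [/\ sun_dual z phi C T t (k, kt),
        closureK C (operator_domain (adjoint_operator C (hatL_operator z phi C))) kt &
        positive_definite C kt].
Proof.
move=> kcl kpos t0; have [sk _] := kpos.
have [kt kt_dual] := dual_flow_exists d_gt0 C_gt0 T_semigroup t0 sk.
have [skt E] := kt_dual; exists kt; split.
- by split => //=; split => //= G H [/= sG ->]; exact: E.
- exact: (dual_flow_closure d_gt0 C_gt0 T_semigroup hatL_operator_spaceL T_generator t0 kcl).
- by split => // G sG Gloc GK; rewrite -E//; exact: pairing_semigroup_ge0.
Qed.

End positivity_preserved.

(** * Independence of the value of the potential at the origin *)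

Section value_at_zero.
Context (R : realType) (d : nat) (d_gt0 : (0 < d)%N).
Local Notation conf := {fset 'rV[R]_d}.
Local Notation mu := (lebesgue_measure_row R d).
Implicit Types (phi : 'rV[R]_d -> R) (eta : conf).

Let diag := @measurable_row_diagonal R d.
Let atomless : forall x, mu [set x] = 0%E.
Proof. by move=> x; exact: lebesgue_measure_row_set1. Qed.

(** Every subset of eta is finite, hence measurable, so the values of g on eta are immaterial. *)
Lemma measurable_fun_off_fset (f g : 'rV[R]_d -> R) eta : measurable_fun setT f ->
  (forall x, x \notin eta -> f x = g x) -> measurable_fun setT g.
Proof.
move=> mf fg _ Y mY; rewrite setTI.
rewrite (_ : g @^-1` Y = [set` [fset x in eta | `[< Y (g x) >]]%fset] `|`
    (f @^-1` Y `&` ~` [set` eta])).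
  have mfin (xi : conf) : measurable [set` xi] by have [] := fset_null diag atomless xi.
  apply: measurableU; first exact: mfin.
  apply: measurableI; last exact: (measurableC (mfin eta)).
  by rewrite -[X in measurable X]setTI; exact: mf.
apply/seteqP; split => x /=.
  move=> Yx; have [xe|xe] := boolP (x \in eta); [left|right].
    by rewrite !inE xe; apply/asboolP.
  by rewrite fg//; split => //; exact/negP.
by move=> [|[Yx /negP xe]]; [rewrite !inE => /andP[_ /asboolP]|rewrite -fg].
Qed.

Lemma integral_off_fset (f g : 'rV[R]_d -> R) eta : measurable_fun setT f ->
  (forall x, x \notin eta -> f x = g x) ->
  (\int[mu]_x (f x)%:E = \int[mu]_x (g x)%:E)%E.
Proof.
move=> mf fg; have mg := measurable_fun_off_fset mf fg.
have [me me0] := fset_null diag atomless eta.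
apply: ae_eq_integral => //; [exact/measurable_EFinP..|].
exists [set` eta]; split => // x /= nx; apply: contrapT => xe; apply: nx => _.
by rewrite fg//; exact/negP.
Qed.

(** [pair_potential] speaks of nonzero arguments, while the estimates above take phi measurable,
    nonnegative and even on the whole space. *)
Definition zero_at_origin phi x : R := if x == 0 then 0 else phi x.

Section potential.
Variable phi : 'rV[R]_d -> R.
Hypothesis phi_pot : pair_potential phi.
Local Notation phi0 := (zero_at_origin phi).

Lemma measurable_zero_at_origin : measurable_fun setT phi0.
Proof.
have [mphi _ _] := phi_pot.
have m1 : measurable [set (0 : 'rV[R]_d)] by exact: (measurable_point diag).
apply: measurable_fun_if => //.
- apply: (measurable_fun_bool true); rewrite setTI (_ : _ @^-1` _ = [set 0])//.
  by apply/seteqP; split => x /= /eqP.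
- rewrite setTI (_ : _ @^-1` _ = [set x | x != 0])//.
  by apply/seteqP; split => x /= => [->|/negPf].
Qed.

Lemma zero_at_origin_ge0 x : 0 <= phi0 x.
Proof.
by have [_ phi_ge0 _] := phi_pot; rewrite /zero_at_origin; case: ifPn => // /phi_ge0.
Qed.

Lemma zero_at_origin_even x : phi0 (- x) = phi0 x.
Proof.
have [_ _ phi_even] := phi_pot; rewrite /zero_at_origin oppr_eq0.
by case: ifPn => // /phi_even.
Qed.

Lemma C_phi_zero_at_origin : C_phi phi0 = C_phi phi.
Proof.
apply: (@integral_off_fset _ _ [fset 0]%fset).
  apply: measurable_funB => //; apply: measurableT_comp => //.
  exact: (measurable_funN measurable_zero_at_origin).
by move=> x; rewrite inE /zero_at_origin => /negPf ->.
Qed.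

(** For x outside eta no difference x - y with y in eta is 0, so the integrands agree off a finite
    set. The two functions then coincide at every configuration, which makes the operators equal as
    graphs. *)
Lemma hatL_zero_at_origin z (G : conf -> R) : measurable_fun setT G ->
  hatL z phi0 G = hatL z phi G.
Proof.
move=> mG; apply/funext => eta; apply: (congr1 (fun r => - #|` eta|%:R * G eta + z * r)).
apply: eq_big_seq => xi; rewrite fpowersetE => /fsubsetP xe; apply: (congr1 fine).
apply: (@integral_off_fset _ _ eta).
  exact: (measurable_birth_integrand measurable_zero_at_origin).
move=> x nxe; have ne y : y \in eta -> phi0 (x - y) = phi (x - y).
  move=> ye; rewrite /zero_at_origin subr_eq0; case: eqP => // xy.
  by rewrite xy ye in nxe.
congr (expR (- _) * _ * _).
  by apply: eq_big_seq => y /xe; exact: ne.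
by apply: eq_big_seq => y; rewrite inE => /andP[_ ye]; rewrite ne.
Qed.

Lemma hatL_operator_zero_at_origin z C : 0 < C ->
  hatL_operator z phi0 C = hatL_operator z phi C.
Proof.
move=> C0; have C2 : 0 < 2 * C by rewrite mulr_gt0.
have E u : spaceL (2 * C) u -> hatL z phi0 u = hatL z phi u.
  by move=> /(spaceLP u C2)[mu _]; exact: hatL_zero_at_origin.
apply/seteqP; split; case=> u v [su ve]; split; try exact: su.
  by rewrite -E.
by rewrite E.
Qed.

End potential.
End value_at_zero.

(** With c the integral [C_phi], this puts the activity in the form that cancels the constant of
    [normL_birth_le]. *)
Lemma activity_bound (R : realType) (z C c : R) : 0 < C ->
  z <= C * expR (- (C * c)) -> z * (expR (C * c) / C) <= 1.
Proof.
move=> C0 zC; rewrite mulrA ler_pdivrMr// mul1r.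
apply: (le_trans (ler_wpM2r (expR_ge0 _) zC)).
by rewrite -mulrA -expRD addNr expR0 mulr1.
Qed.

Theorem theorem4p17 (R : realType) (d : nat) (d_gt0 : (0 < d)%N)
    (phi : 'rV[R]_d -> R) (phi_pot : pair_potential phi)
    (Cphi_fin : (C_phi phi < +oo)%E) (C z : R) (C_gt1 : 1 < C) (z_gt0 : 0 < z)
    (z_le : z <= Num.min (C * expR (- (C * fine (C_phi phi))))
                         (2 * C * expR (- (2 * C * fine (C_phi phi)))))
    (T : R -> ({fset 'rV[R]_d} -> R) -> ({fset 'rV[R]_d} -> R))
    (T_semigroup : contraction_semigroup C T)
    (T_generator : semigroup_generator C T = closure_operator C (hatL_operator z phi C))
    (k : {fset 'rV[R]_d} -> R)
    (k_sun : closureK C (operator_domain (adjoint_operator C (hatL_operator z phi C))) k)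
    (k_pos : positive_definite C k) (t : R) (t_ge0 : 0 <= t) :
  exists kt : {fset 'rV[R]_d} -> R,
    [/\ sun_dual z phi C T t (k, kt),
        closureK C (operator_domain (adjoint_operator C (hatL_operator z phi C))) kt &
        positive_definite C kt].
Proof.
have C_gt0 : 0 < C by apply: lt_trans C_gt1.
have /andP[zC _] : (z <= C * expR (- (C * fine (C_phi phi)))) &&
  (z <= 2 * C * expR (- (2 * C * fine (C_phi phi)))) by rewrite -le_min.
have C0 := C_phi_zero_at_origin d_gt0 phi_pot.
have L0 := hatL_operator_zero_at_origin d_gt0 phi_pot z C_gt0.
(* The operators of phi and of its modification are literally equal, so closure, adjoint and sun
   dual are transported by rewriting with [L0]. *)
have [] := @positive_definite_sun_dual R d d_gt0 (zero_at_origin phi)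
  (measurable_zero_at_origin phi_pot) (zero_at_origin_ge0 phi_pot)
  (zero_at_origin_even phi_pot) _ z C T (ltW z_gt0) (ltW C_gt1) _ T_semigroup _ k t _ k_pos t_ge0.
- by rewrite C0.
- have -> : cphi (zero_at_origin phi) = fine (C_phi phi) by apply: (congr1 fine).
  exact: (activity_bound C_gt0 zC).
- by rewrite L0.
- by rewrite L0.
- by rewrite /sun_dual L0 => kt; exists kt.
Qed.
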